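(* Let $d,m\in\mathbb{N}$, and let $\mathbf{k},\mathbf{r}^0,\ldots,\mathbf{r}^m\in\mathbb{R}^d$ and $\lambda_0,\ldots,\lambda_m>0$ be such that $\lambda_0+\ldots+\lambda_m=1$ and $\mathbf{k}+\frac12\cdot\mathbf{1}=\lambda_0\mathbf{r}^0+\ldots+\lambda_m\mathbf{r}^m$ belongs to the interior of the convex hull of $\mathbf{r}^0,\ldots,\mathbf{r}^m$. Then for every $x\in\bigcap_{l=0}^m\mathcal{L}^{\mathbf{r}^l}$ there holds the sharp inequality $$\|\mathcal{D}^{\mathbf{k}}x\|_{C(\mathbb{R}^d)}\leqslant\sqrt{\mathcal{C}\cdot\prod_{j=0}^m\lambda_j^{-\lambda_j}}\cdot\prod_{j=0}^m\|\mathcal{D}^{\mathbf{r}^j}x\|_{L_2(\mathbb{R}^d)}^{\lambda_j},$$ where $$\mathcal{C}=\liminf_{\rho\to0^+}\ \sup_{\mathbf{h}\in\mathbb{R}_+^{m+1}}\ \prod_{j=0}^mh_j^{\lambda_j}\sum_{\mathbf{n}\in\mathbb{Z}_*^d}\frac{\rho^d\left(\int_{\mathfrak{c}_{\mathbf{n},1}}(2\pi\rho|\mathbf{t}|)^{\mathbf{k}}\,d\mathbf{t}\right)^2}{\sum_{l=0}^mh_l\int_{\mathfrak{c}_{\mathbf{n},1}}(2\pi\rho|\mathbf{t}|)^{2\mathbf{r}^l}\,d\mathbf{t}}=\frac1{\pi^d}\sup_{\mathbf{h}\in\mathbb{R}_+^{m+1}}\ \prod_{j=0}^mh_j^{\l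ambda_j}\int_{\mathbb{R}_+^d}\frac{\mathbf{t}^{2\mathbf{k}}\,d\mathbf{t}}{\sum_{l=0}^mh_l\mathbf{t}^{2\mathbf{r}^l}}.$$
   Context: $\mathbb{R}_+=(0,+\infty)$, $\mathbf{h}=(h_0,\ldots,h_m)$, $\mathbf{1}=(1,\ldots,1)\in\mathbb{R}^d$. For $\mathbf{t}\in\mathbb{R}^d$ and $\mathbf{k}\in\mathbb{R}^d$: $\mathbf{t}^{\mathbf{k}}=t_1^{k_1}\cdots t_d^{k_d}$ (when all $t_i>0$), and $(c|\mathbf{t}|)^{\mathbf{k}}=(c|t_1|)^{k_1}\cdots(c|t_d|)^{k_d}$ for $c>0$. $\mathbb{Z}_*^d=\{\mathbf{n}\in\mathbb{Z}^d:n_1\cdots n_d\neq0\}$ and $\mathfrak{c}_{\mathbf{n},1}=[n_1-\frac12,n_1+\frac12]\times\ldots\times[n_d-\frac12,n_d+\frac12]$. $\mathcal{F}:L_2(\mathbb{R}^d)\to L_2(\mathbb{R}^d)$ is the Fourier transform $\widehat{x}(\mathbf{u})=(\mathcal{F}x)(\mathbf{u})=\int_{\mathbb{R}^d}x(\mathbf{t})e^{-2\pi i(t_1u_1+\ldots+t_du_d)}\,d\mathbf{t}$, and $\mathcal{F}^{-1}$ its inverse. $\mathcal{E}^{\mathbf{k}}$ is the multiplication operator $(\mathcal{E}^{\mathbf{k}}x)(\mathbf{t})=(2\pi it_1)^{k_1}\cdots(2\pi it_d)^{k_d}x(\mathbf{t})$, where $(2\pi ia)^b=|2\pi a|^be^{i\pi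 b\,\mathrm{sign}(a)/2}$ for real $a,b$; and $\mathcal{D}^{\mathbf{k}}=\mathcal{F}^{-1}\circ\mathcal{E}^{\mathbf{k}}\circ\mathcal{F}$. $\mathcal{L}^{\mathbf{k}}$ is the space of functions $x:\mathbb{R}^d\to\mathbb{C}$, $x\in L_2(\mathbb{R}^d)$, with $\|x\|_{\mathcal{L}^{\mathbf{k}}}^2:=(2\pi)^{2k_1+\ldots+2k_d}\int_{\mathbb{R}^d}|t_1|^{2k_1}\cdots|t_d|^{2k_d}|\widehat{x}(\mathbf{t})|^2\,d\mathbf{t}<\infty$; on it $\|\mathcal{D}^{\mathbf{k}}x\|_{L_2(\mathbb{R}^d)}=\|x\|_{\mathcal{L}^{\mathbf{k}}}$. $\|\cdot\|_{C(\mathbb{R}^d)}$ is the supremum norm. Sharp means that the constant in front of the product of norms cannot be reduced. *)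

(* Defs.v *)
(* Points of R^d are row vectors 'rV[R]_d. *)
From HB Require Import structures.
From mathcomp Require Import all_boot all_order all_algebra.
From mathcomp Require Import complex.
From mathcomp Require Import all_classical all_reals all_analysis.

Set Implicit Arguments.
Unset Strict Implicit.
Unset Printing Implicit Defensive.

Import Order.TTheory GRing.Theory Num.Theory.
Import numFieldNormedType.Exports.
Import ComplexField.Normc.

Local Open Scope classical_set_scope.
Local Open Scope ring_scope.

Section measurable_rV.
Context {d : measure_display} {T : measurableType d}.
Variable n : nat.

Let coords (i : 'I_n) (v : 'rV[T]_n) : T := v ord0 i.

Let rV_set0 : g_sigma_preimage coords set0.
Proof. exact: sigma_algebra0. Qed.

Let rV_setC A : g_sigma_preimage coords A -> g_sigma_preimage coords (~` A).
Proof. exact: sigma_algebraC. Qed.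

Let rV_bigcup (F : (set 'rV[T]_n)^nat) :
  (forall i, g_sigma_preimage coords (F i)) ->
  g_sigma_preimage coords (\bigcup_i (F i)).
Proof. exact: sigma_algebra_bigcup. Qed.

(* The product sigma-algebra; for T = R it is the Borel sigma-algebra of R^n. *)
HB.instance Definition _ := @isMeasurable.Build (measure_tuple_display d)
  'rV[T]_n (g_sigma_preimage coords) rV_set0 rV_setC rV_bigcup.

End measurable_rV.

Section measurable_rV_theory.
Context d (T : measurableType d).

Lemma measurable_coord n (i : 'I_n) :
  measurable_fun [set: 'rV[T]_n] (fun v => v ord0 i).
Proof.
move=> _ Y mY; rewrite setTI; apply: sub_sigma_algebra => /=.
rewrite -bigcup_seq/=; exists i => /=; first by rewrite mem_index_enum.
by exists Y => //; rewrite setTI.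
Qed.

Lemma measurable_fun_rV d1 (T1 : measurableType d1) n (f : T1 -> 'rV[T]_n) :
  (forall i, measurable_fun setT (fun x => f x ord0 i)) -> measurable_fun setT f.
Proof.
move=> mf _ A; rewrite setTI; move: A.
have sA : sigma_algebra setT [set A : set 'rV[T]_n | measurable (f @^-1` A)].
  split => /=.
  - by rewrite preimage_set0.
  - by move=> A mA; rewrite setTD preimage_setC; exact: measurableC.
  - by move=> F mF; rewrite preimage_bigcup; exact: bigcupT_measurable.
suff H : g_sigma_preimage (fun i (v : 'rV[T]_n) => v ord0 i) `<=`
    [set A : set 'rV[T]_n | measurable (f @^-1` A)] by [].
apply: smallest_sub => // B; rewrite -bigcup_seq => -[/= i _ [C mC <-]].
by have := mf i measurableT C mC; rewrite !setTI.
Qed.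

Definition cons_rV n (p : T * 'rV[T]_n) : 'rV[T]_n.+1 :=
  row_mx (const_mx p.1 : 'rV_1) p.2.

Definition uncons_rV n (v : 'rV[T]_n.+1) : T * 'rV[T]_n :=
  (v ord0 ord0, rsubmx (v : 'rV_(1 + n))).

Lemma cons_rVK n : cancel (@cons_rV n) (@uncons_rV n).
Proof.
move=> [a v]; congr pair; last exact: (row_mxKr (const_mx a : 'rV_1) v).
rewrite /cons_rV /=.
have -> : ord0 = lshift n (ord0 : 'I_1) :> 'I_(1 + n) by exact/val_inj.
by apply: etrans (row_mxEl (const_mx a : 'rV_1) v ord0 ord0) _; rewrite mxE.
Qed.

Lemma uncons_rVK n : cancel (@uncons_rV n) (@cons_rV n).
Proof.
move=> v; rewrite /cons_rV /=.
have -> : const_mx (v ord0 ord0) = lsubmx (v : 'rV_(1 + n)) :> 'rV_1.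
  by apply/rowP => i; rewrite !mxE (ord1 i); congr (v _ _); exact/val_inj.
exact: (@hsubmxK _ 1 1 n v).
Qed.

Lemma measurable_cons_rV n : measurable_fun setT (@cons_rV n).
Proof.
apply: measurable_fun_rV => i.
rewrite -(@splitK 1 n i); case: (@fintype.split 1 n i) => j.
  rewrite [X in measurable_fun _ X](_ : _ = fst); first exact: measurable_fst.
  apply/funext => -[a v].
  by apply: etrans (row_mxEl (const_mx a : 'rV_1) v ord0 j) _; rewrite mxE.
rewrite [X in measurable_fun _ X](_ : _ = (fun v : 'rV[T]_n => v ord0 j) \o snd).
  by apply: measurableT_comp; [exact: measurable_coord|exact: measurable_snd].
by apply/funext => -[a v]; exact: (row_mxEr (const_mx a : 'rV_1) v ord0 j).
Qed.

Lemma measurable_uncons_rV n : measurable_fun setT (@uncons_rV n).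
Proof.
apply/measurable_fun_pairP; split; first exact: measurable_coord.
apply: measurable_fun_rV => i /=; under eq_fun do rewrite mxE.
exact: measurable_coord.
Qed.

End measurable_rV_theory.

Section cons_measure.
Context d (T : measurableType d) (R : realType) (n : nat).
Variables (m1 : {sigma_finite_measure set T -> \bar R}).
Variables (m2 : {sigma_finite_measure set 'rV[T]_n -> \bar R}).

Definition cons_measure : set 'rV[T]_n.+1 -> \bar R :=
  pushforward (m1 \x m2)%E (@cons_rV _ T n).

Let cons_measure0 : cons_measure set0 = 0%E.
Proof. by rewrite /cons_measure /pushforward preimage_set0 measure0. Qed.

Let cons_measure_ge0 A : (0 <= cons_measure A)%E.
Proof. by rewrite /cons_measure /pushforward measure_ge0. Qed.

Let cons_measure_sigma_additive : semi_sigma_additive cons_measure.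
Proof.
have mcons A : measurable A -> measurable (@cons_rV _ T n @^-1` A).
  by move=> mA; rewrite -[X in measurable X]setTI; exact: measurable_cons_rV.
move=> F mF tF mUF; rewrite /cons_measure /pushforward preimage_bigcup.
apply: measure_semi_sigma_additive.
- by move=> k; exact: mcons.
- apply/trivIsetP => /= i j _ _ ij; rewrite -preimage_setI.
  by move/trivIsetP : tF => /(_ _ _ _ _ ij) ->//; rewrite preimage_set0.
- by rewrite -preimage_bigcup; exact: mcons.
Qed.

HB.instance Definition _ := isMeasure.Build _ _ _ cons_measure
  cons_measure0 cons_measure_ge0 cons_measure_sigma_additive.

Let cons_measure_sigma_finite : sigma_finite setT cons_measure.
Proof.
have /sigma_finiteP[F [TF ndF Foo]] := sigma_finiteT m1.
have /sigma_finiteP[G [TG ndG Goo]] := sigma_finiteT m2.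
exists (fun k => @uncons_rV _ T n @^-1` (F k `*` G k)).
  rewrite -preimage_bigcup (_ : \bigcup_i _ = setT) ?preimage_setT//.
  rewrite predeqE => -[x y]; split=> // _.
  have [i _ Fx] : (\bigcup_i F i) x by rewrite -TF.
  have [j _ Gy] : (\bigcup_i G i) y by rewrite -TG.
  exists (maxn i j) => //; split.
    by move: x Fx; exact/subsetPset/ndF/leq_maxl.
  by move: y Gy; exact/subsetPset/ndG/leq_maxr.
move=> k; have [mF Fk] := Foo k; have [mG Gk] := Goo k; split.
  rewrite -[X in measurable X]setTI; apply: measurable_uncons_rV => //.
  exact: measurableX.
rewrite /cons_measure /pushforward -comp_preimage.
rewrite [X in X @^-1` _](_ : _ = id); last by apply/funext => p; exact: cons_rVK.
by rewrite preimage_id product_measure1E// lte_mul_pinfty// ge0_fin_numE.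
Qed.

HB.instance Definition _ := Measure_isSigmaFinite.Build _ _ _ cons_measure
  cons_measure_sigma_finite.

End cons_measure.

(* Lebesgue measure on (the Borel sets of) R^n.  The scalars carry the
   measurable structure [measurableTypeR R] on which [lebesgue_measure] lives;
   as a type, 'rV[measurableTypeR R]_n is 'rV[R]_n. *)
Fixpoint lebesgue_rV (R : realType) (n : nat) :
    {sigma_finite_measure set 'rV[measurableTypeR R]_n -> \bar R} :=
  match n with
  | 0 => @dirac _ 'rV[measurableTypeR R]_0 (0 : 'rV[R]_0) R
  | n'.+1 => cons_measure (@lebesgue_measure R) (lebesgue_rV R n')
  end.

Lemma lebesgue_rV_box (R : realType) (n : nat)
    (A : 'I_n -> set (measurableTypeR R)) : (forall i, measurable (A i)) ->
  lebesgue_rV R n [set t | forall i, A i (t ord0 i)] =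
  (\prod_(i < n) lebesgue_measure (A i))%E.
Proof.
elim: n => [|n IHn] in A *; move=> mA.
  rewrite big_ord0 /= diracE mem_set//; by case.
rewrite big_ord_recl -IHn// /= /cons_measure /pushforward.
rewrite (_ : _ @^-1` _ =
    A ord0 `*` [set t : 'rV_n | forall i, A (lift ord0 i) (t ord0 i)]).
  rewrite product_measure1E//.
  rewrite (_ : [set t | _] = \bigcap_(i in [set: 'I_n])
    ((fun t : 'rV[measurableTypeR R]_n => t ord0 i) @^-1` A (lift ord0 i))).
    apply: fin_bigcap_measurable => // i _.
    by rewrite -[X in measurable X]setTI; exact: measurable_coord.
  by apply/seteqP; split => t /= tA i; [move=> _|]; exact: tA.
have E0 a (v : 'rV[measurableTypeR R]_n) : cons_rV (a, v) ord0 ord0 = a.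
  by have := cons_rVK (a, v) => -[].
have ES a (v : 'rV[measurableTypeR R]_n) i :
  cons_rV (a, v) ord0 (lift ord0 i) = v ord0 i.
  rewrite (_ : lift ord0 i = rshift 1 i); last exact/val_inj.
  exact: (row_mxEr (const_mx a : 'rV_1) v ord0 i).
apply/seteqP; split => [[a v] /= H|[a v] /= [Aa Av] i].
  split; first by have := H ord0; rewrite E0.
  by move=> i; have := H (lift ord0 i); rewrite ES.
by case: (unliftP ord0 i) => [j|] ->; rewrite ?E0// ES.
Qed.

Section Rd.
Context {R : realType} {d : nat}.
Implicit Types (t u v a k : 'rV[R]_d) (x y f g : 'rV[R]_d -> R[i]).

(* t ^ a = t_1 ^ a_1 ... t_d ^ a_d; meant for nonnegative coordinates, powR
   sends 0 to 0 for nonzero exponents. *)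
Definition vpow t a : R := \prod_i (t ord0 i `^ a ord0 i).

Definition vabs t : 'rV[R]_d := map_mx Num.norm t.

Definition dotv t u : R := \sum_i t ord0 i * u ord0 i.

Definition conv_hull (n : nat) (r : 'I_n -> 'rV[R]_d) : set 'rV[R]_d :=
  [set v | exists w : 'I_n -> R,
    [/\ forall j, 0 <= w j, \sum_j w j = 1 & v = \sum_j w j *: r j]].

Definition orthant : set 'rV[R]_d := [set t | forall i, 0 < t ord0 i].

Definition cube (N : nat) : set 'rV[R]_d :=
  [set t | forall i, `|t ord0 i| <= N%:R].

(* The unit cell centered at the lattice point n. *)
Definition cell (n : 'rV[int]_d) : set 'rV[R]_d :=
  [set t | forall i, (n ord0 i)%:~R - 2^-1 <= t ord0 i <= (n ord0 i)%:~R + 2^-1].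

Definition lattice_star : set 'rV[int]_d := [set n | \prod_i n ord0 i != 0].

Definition cmeasurable f : Prop :=
  measurable_fun [set: 'rV[measurableTypeR R]_d] (fun t => complex.Re (f t)) /\
  measurable_fun [set: 'rV[measurableTypeR R]_d] (fun t => complex.Im (f t)).

Definition cintegral (A : set 'rV[R]_d) f : R[i] :=
  Complex (\int[lebesgue_rV R d]_(t in A) complex.Re (f t))
          (\int[lebesgue_rV R d]_(t in A) complex.Im (f t)).

Definition L2norm f : \bar R :=
  Lnorm (lebesgue_rV R d) 2%:E (fun t => (normc (f t))%:E).

Definition memL2 f : Prop := cmeasurable f /\ (L2norm f < +oo)%E.

(* e ^ (i theta) *)
Definition cexpi (theta : R) : R[i] := Complex (cos theta) (sin theta).

Definition fourier_trunc (N : nat) x u : R[i] :=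
  cintegral (cube N) (fun t => x t * cexpi (- (2 * pi * dotv t u))).

(* y represents the class F x in L_2: the integral defining the Fourier
   transform of x in L_2 is the limit in L_2 of its truncations to cubes. *)
Definition is_fourier x y : Prop :=
  [/\ memL2 x, memL2 y &
   L2norm (fun u => y u - fourier_trunc N x u) @[N --> \oo] --> 0%E].

(* A representative, unique up to null sets, of F x for x in L_2. *)
Definition fourier x : 'rV[R]_d -> R[i] :=
  xget (fun=> 0) [set y | is_fourier x y].

(* On L_2 this is the inverse of the unitary operator F (again up to null sets).
   Outside of L_2 it is the inversion integral, because (2 pi i t)^k (F x)(t) may
   be integrable without being square integrable, e.g. for d = 1, k = -1/4 and
   x in L_2 with a square integrable derivative.  On the intersection of L_1
   and L_2 both agree almost everywhere. *)
Definition inv_fourier y : 'rV[R]_d -> R[i] :=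
  if `[< memL2 y >] then xget (fun=> 0) [set x | is_fourier x y]
  else fun t => cintegral setT (fun u => y u * cexpi (2 * pi * dotv t u)).

(* (2 pi i a)^b = |2 pi a|^b e^(i pi b sign(a) / 2) *)
Definition pow2pii (a b : R) : R[i] :=
  Complex (`|2 * pi * a| `^ b) 0 * cexpi (pi * b * Num.sg a / 2).

Definition opE k x : 'rV[R]_d -> R[i] :=
  fun t => (\prod_i pow2pii (t ord0 i) (k ord0 i)) * x t.

Definition opD k x : 'rV[R]_d -> R[i] := inv_fourier (opE k (fourier x)).

Definition Lnorm2k k x : \bar R :=
  (((2 * pi) `^ (\sum_i 2 * k ord0 i))%:E *
   \int[lebesgue_rV R d]_t
     (vpow (vabs t) (2 *: k) * normc (fourier x t) ^+ 2)%:E)%E.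

(* The space L^k; [Lnorm2k] is the square of its norm. *)
Definition spaceL k : set ('rV[R]_d -> R[i]) :=
  [set x | memL2 x /\ (Lnorm2k k x < +oo)%E].

(* The norm in C(R^d) of a class of functions modulo null sets: the supremum of
   the modulus of its (unique) continuous representative, +oo if there is none. *)
Definition Cnorm f : \bar R :=
  ereal_inf [set s | exists g,
    [/\ continuous (fun t => complex.Re (g t)),
        continuous (fun t => complex.Im (g t)),
        {ae lebesgue_rV R d, forall t, f t = g t} &
        s = ereal_sup [set (normc (g t))%:E | t in setT]]].

End Rd.

(* Main.v *)
Require Import Defs.
From HB Require Import structures.
From mathcomp Require Import all_boot all_order all_algebra.
From mathcomp Require Import complex.
From mathcomp Require Import all_classical all_reals all_analysis.
From mathcomp Require Import measurable_realfun ring lra zify.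

Set Implicit Arguments.
Unset Strict Implicit.
Unset Printing Implicit Defensive.

Import Order.TTheory GRing.Theory Num.Theory.
Import numFieldNormedType.Exports.

Local Open Scope classical_set_scope.
Local Open Scope ring_scope.

(** On the Fourier side everything becomes a weighted extremal problem. With f = [fourier x], the
    function [opD k x] is the inverse transform of [opE k f], so its sup norm is at most the
    integral of |[opE k f]|, with equality at the origin when [opE k f] is nonnegative; the L2 norms
    on the right are weighted L2 norms of f.

    The inequality. For weights h put den(t) = sum_l h_l |2 pi t|^(2 r^l). Pointwise, 2 |2 pi t|^k
    |f| <= e |2 pi t|^(2k) / den + e^-1 den |f|^2 ([integral_opE_le]). Integrating, with h_l =
    lambda_l / X_l^2 for X_l the L2 norm of D^(r^l) x, and optimizing in e gives the stated constant
    ([integral_opE_le_prod], [interpolation_inequality]).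

    Sharpness. For fixed h the pointwise inequality is an equality, at e = 1, for f = conj((2 pi i
    t)^k) / den. This f is truncated to a set where everything is bounded ([extremizer]). The value
    of D^k x at 0 is then sum_l h_l X_l^2, and the weighted AM-GM inequality compares it with the
    product of the norms ([test_constant_ge]). Exhausting the space and taking the supremum over h
    gives K <= K' ([sharp_constant_le]).

    Finiteness. In logarithmic coordinates the weighted integrand is 1 / (t_1 ... t_d sum_l
    exp(w_l)), where the w_l are affine in ln t with lambda-mean zero. Since k + 1/2 is interior to
    the hull, the w_l control all coordinates of ln t, so there is exponential decay, dominated by a
    product of logistic densities whose masses do not depend on h ([weighted_integrand_le],
    [weighted_integral_bound]).

    The two formulas for the constant. On each cell Cauchy-Schwarz bounds the discrete summand by
    the integral of the integrand, for every rho ([discrete_term_le]). Away from the coordinate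
    hyperplanes powers are nearly constant on a cell, which reverses the bound up to a factor
    tending to 1 ([discrete_term_ge]). For the liminf of suprema it is enough to fix h before
    letting rho tend to 0 ([discrete_liminfE]).

    All this rests on Plancherel's theorem. Parseval's identity on the line comes from the
    autocorrelation and Abel summation ([parseval_real]); Tonelli and induction carry it to R^d for
    bounded functions of compact support ([isometry_bounded]); completeness of L2 extends it
    ([L2_complete], [isF_exists]); the adjoint relation yields surjectivity and inversion
    ([isF_inverse], [isF_inversion]). *)

(** * Affine change of variables on the line *)

Section affine.
Context {R : realType}.
Notation leb := (@lebesgue_measure R).
Variables (a b : R).
Hypothesis a0 : 0 < a.

Let phi (s : measurableTypeR R) : measurableTypeR R := a * s + b.

Let mphi : measurable_fun setT phi.
Proof.
by apply: measurable_funD => //; exact: measurable_funM.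
Qed.

Let pf : {measure set (measurableTypeR R) -> \bar R}.
Proof. by unshelve refine (pushforward leb phi : {measure set _ -> \bar R}); exact: mphi. Defined.

(** The preimage of a half-open interval under the affine map is a half-open interval with length
    divided by [a]; agreement on such intervals determines the measure. *)
Lemma lebesgue_measure_affine (A : set (measurableTypeR R)) : measurable A ->
  leb A = mscale (NngNum (ltW a0)) pf A.
Proof.
move=> mA; apply: lebesgue_measure_unique => //= _ [[u v]] _ <-.
rewrite /mscale/= /pf/= /pushforward.
rewrite (_ : phi @^-1` _ = [set` `](u - b) / a, (v - b) / a]]).
  rewrite !lebesgue_measure_itv/= !lte_fin ltr_pM2r ?invr_gt0// ltrD2r.
  case: ifPn => uv; last by rewrite mule0.
  by rewrite -!EFinB -EFinM; congr EFin; field; rewrite gt_eqF.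
apply/seteqP; split => s /=; rewrite !in_itv/= /phi.
  by rewrite ltr_pdivrMr// ler_pdivlMr// ltrBlDr lerBrDr ![s * a]mulrC.
by rewrite ltr_pdivrMr// ler_pdivlMr// ltrBlDr lerBrDr ![s * a]mulrC.
Qed.

Lemma ge0_integral_affine (f : R -> \bar R) :
  measurable_fun setT f -> (forall s, 0 <= f s)%E ->
  (\int[leb]_s f (a * s + b)%R = (a^-1)%:E * \int[leb]_s f s)%E.
Proof.
move=> mf f0.
rewrite [X in (_ * X)%E](@eq_measure_integral _ _ _ _ (mscale (NngNum (ltW a0)) pf)); last first.
  by move=> A mA _; exact: lebesgue_measure_affine.
rewrite ge0_integral_mscale// ge0_integral_pushforward//=.
rewrite muleA -EFinM mulVf ?gt_eqF// mul1e.
by rewrite preimage_setT.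
Qed.

Lemma integral_affine (f : R -> \bar R) : leb.-integrable setT f ->
  (\int[leb]_s f (a * s + b)%R = (a^-1)%:E * \int[leb]_s f s)%E.
Proof.
move=> intf; have mf : measurable_fun setT f by exact: measurable_int intf.
rewrite integralE [in RHS]integralE.
have -> : ((fun s => f (a * s + b)%R)^\+)%E = (fun s : R => (f^\+)%E (a * s + b)%R) by apply/funext => s; rewrite !funeposE.
have -> : ((fun s => f (a * s + b)%R)^\-)%E = (fun s : R => (f^\-)%E (a * s + b)%R) by apply/funext => s; rewrite !funenegE.
have mp := measurable_funepos mf; have mn := measurable_funeneg mf.
rewrite (ge0_integral_affine mp)// (ge0_integral_affine mn)//.
by apply/esym/muleBr => //; exact: integrable_add_def.
Qed.

End affine.



(** * Laplace transform of the cosine, and the Cauchy density *)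

Section laplace.
Context {R : realType}.
Notation leb := (@lebesgue_measure R).

(** The added 1 keeps the integrand nonnegative, as the improper fundamental theorem of calculus
    used in [integral_laplace1] requires. *)
Lemma is_derive_laplace (e w : R) (u : R) : 0 < e ->
  is_derive u 1 (fun u => expR (- e * u) * (w * sin (w * u) - e * cos (w * u)) / (e ^+ 2 + w ^+ 2) - expR (- e * u) / e)
    (expR (- e * u) * (1 + cos (w * u))).
Proof.
move=> e0.
have h1 : is_derive u 1 (fun u => expR (- e * u)) (- e * expR (- e * u)).
  by apply: is_derive_eq; rewrite /GRing.scale/= mulr1 mulrC.
have h2 : is_derive u 1 (fun u => sin (w * u)) (w * cos (w * u)).
  by apply: is_derive_eq; rewrite /GRing.scale/= mulr1 mulrC.
have h3 : is_derive u 1 (fun u => cos (w * u)) (- w * sin (w * u)).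
  by apply: is_derive_eq; rewrite /GRing.scale/= mulr1; ring.
have ew : e ^+ 2 + w ^+ 2 != 0 by rewrite gt_eqF// ltr_pwDl// ?exprn_gt0// sqr_ge0.
apply: is_derive_eq.
rewrite /GRing.scale/=.
by field; rewrite ew gt_eqF.
Qed.

Lemma cvg_expRN_bounded (e : R) (g : R -> R) (M : R) : 0 < e ->
  (forall x, `|g x| <= M) -> expR (- e * x) * g x @[x --> +oo] --> 0.
Proof.
move=> e0 gM.
have M0 : 0 <= M by rewrite (le_trans _ (gM 0)).
apply/cvgrPdist_lt => d d0; near=> x.
rewrite sub0r normrN normrM ger0_norm ?expR_ge0//.
have x0 : 0 < x by near: x; apply: nbhs_pinfty_gt; exact: num_real.
have H : (M + 1) / d < e * x.
  rewrite [e * x]mulrC -ltr_pdivrMr//; near: x; apply: nbhs_pinfty_gt; exact: num_real.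
rewrite mulNr expRN.
have ex : e * x < expR (e * x).
  by apply: lt_le_trans (expR_ge1Dx _); rewrite ltrDr.
rewrite (@le_lt_trans _ _ ((expR (e * x))^-1 * M))// ?ler_wpM2l ?invr_ge0 ?expR_ge0//.
rewrite mulrC ltr_pdivrMr ?expR_gt0//.
apply: (@lt_trans _ _ (d * (e * x))); last by rewrite ltr_pM2l.
move: H; rewrite ltr_pdivrMr// mulrC => H.
by apply: lt_trans H; rewrite ltrDl.
Unshelve. all: end_near. Qed.

Lemma continuous_laplace (e w : R) : continuous (fun u => expR (- e * u) * (1 + cos (w * u))).
Proof.
move=> u; apply: cvgM.
  apply: continuous_comp; last exact: continuous_expR.
  by apply: cvgM; [exact: cvg_cst|exact: cvg_id].
apply: cvgD; first exact: cvg_cst.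
apply: continuous_comp; last exact: continuous_cos.
by apply: cvgM; [exact: cvg_cst|exact: cvg_id].
Qed.

Lemma measurable_laplace (e w : R) (D : set R) :
  measurable_fun D (fun u => (expR (- e * u) * (1 + cos (w * u)))%:E).
Proof.
apply/measurable_EFinP; apply: measurable_funTS.
exact: (continuous_measurable_fun (@continuous_laplace e w)).
Qed.

Lemma integral_laplace1 (e w : R) : 0 < e ->
  (\int[leb]_(u in `[0%R, +oo[) (expR (- e * u) * (1 + cos (w * u)))%:E =
   (e / (e ^+ 2 + w ^+ 2) + e^-1)%:E)%E.
Proof.
move=> e0.
have ew : e ^+ 2 + w ^+ 2 != 0 by rewrite gt_eqF// ltr_pwDl// ?exprn_gt0// sqr_ge0.
pose F := (fun u => expR (- e * u) * (w * sin (w * u) - e * cos (w * u)) / (e ^+ 2 + w ^+ 2) - expR (- e * u) / e).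
have dF u : derivable F u 1 by have [] := is_derive_laplace w u e0.
rewrite (@ge0_continuous_FTC2y _ _ F _ 0).
- rewrite /F !mulr0 !expR0 sin0 cos0 -EFinB; congr EFin.
  by field; rewrite ew gt_eqF.
- move=> x _; apply: mulr_ge0; first exact: expR_ge0.
  by have := cos_geN1 (w * x); lra.
- by apply: continuous_subspaceT; exact: continuous_laplace.
- rewrite (_ : F = fun u => expR (- e * u) * ((w * sin (w * u) - e * cos (w * u)) / (e ^+ 2 + w ^+ 2) - e^-1)); last first.
    by apply/funext => u; rewrite /F [RHS]mulrBr mulrA.
  apply: (@cvg_expRN_bounded _ _ ((`|w| + `|e|) / (e ^+ 2 + w ^+ 2) + e^-1)) => // x.
  rewrite (le_trans (ler_normB _ _))// lerD//; last by rewrite ger0_norm// invr_ge0 ltW.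
  have ew0 : 0 < e ^+ 2 + w ^+ 2 by rewrite lt_def ew addr_ge0// sqr_ge0.
  rewrite normrM [X in _ * X <= _]gtr0_norm ?invr_gt0// ler_pM2r ?invr_gt0//.
  rewrite (le_trans (ler_normB _ _))// lerD// normrM ler_piMr// ler_norml.
    by rewrite sin_geN1 sin_le1.
  by rewrite cos_geN1 cos_le1.
- by [].
- by apply: cvg_at_right_filter; apply: differentiable_continuous; exact/derivable1_diffP.
- move=> x _; rewrite derive1E; have h := is_derive_laplace w x e0; exact: derive_val.
Qed.

Lemma integral_expRN (e : R) : 0 < e ->
  (\int[leb]_(u in `[0%R, +oo[) (expR (- e * u))%:E = (e^-1)%:E)%E.
Proof.
move=> e0; have h := integral_laplace1 0 e0.
have e2 : 2%:R != 0 :> R by [].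
(* At w = 0 the factor 1 + cos is the constant 2. *)
transitivity ((2^-1)%:E * \int[leb]_(u in `[0%R, +oo[) (expR (- e * u) * (1 + cos (0 * u)))%:E)%E.
  rewrite -ge0_integralZl//.
  - by apply: eq_integral => u _; rewrite -EFinM mul0r cos0; congr EFin; field.
  - exact: measurable_laplace.
rewrite h -EFinM; congr EFin; field.
by rewrite gt_eqF.
Qed.

Lemma integrable_expRN (e : R) : 0 < e ->
  leb.-integrable `[0%R, +oo[ (fun u => (expR (- e * u))%:E).
Proof.
move=> e0; apply/integrableP; split.
  apply/measurable_EFinP/measurable_funTS.
  by apply: measurableT_comp => //; exact: measurable_funM.
under eq_integral do rewrite gee0_abs ?lee_fin ?expR_ge0//.
by rewrite integral_expRN// ltry.
Qed.

Lemma integral_laplace (e w : R) : 0 < e ->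
  (\int[leb]_(u in `[0%R, +oo[) (expR (- e * u) * cos (w * u))%:E = (e / (e ^+ 2 + w ^+ 2))%:E)%E.
Proof.
move=> e0.
transitivity (\int[leb]_(u in `[0%R, +oo[) ((expR (- e * u) * (1 + cos (w * u)))%:E - (expR (- e * u))%:E))%E.
  by apply: eq_integral => u _; rewrite -EFinB; congr EFin; ring.
rewrite integralB//=; last 2 first.
- apply/integrableP; split.
    exact: measurable_laplace.
  under eq_integral.
    move=> u _; rewrite gee0_abs; last first.
      by rewrite lee_fin mulr_ge0 ?expR_ge0//; have := cos_geN1 (w * u); lra.
    over.
  by rewrite integral_laplace1// ltry.
- exact: integrable_expRN.
by rewrite integral_laplace1// integral_expRN// -EFinB addrK.
Qed.

(** The integrand is the Poisson kernel of Abel summation at parameter 1; its mass is the factor one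
    half in [abel_inversion0]. *)
Lemma integral_cauchy :
  (\int[leb]_v (1 / (1 + (2 * pi * v) ^+ 2))%:E = (2^-1)%:E)%E.
Proof.
have p0 : 0 < 2 * pi :> R by rewrite mulr_gt0// pi_gt0.
pose f (v : R) := ((oneDsqr v)^-1)%:E.
have mf : measurable_fun setT f.
  apply/measurable_EFinP.
  exact: (continuous_measurable_fun (@continuous_oneDsqrV R)).
transitivity (\int[leb]_v f ((2 * pi) * v + 0)%R)%E.
  by apply: eq_integral => v _; rewrite /f addr0 div1r.
rewrite ge0_integral_affine//; last by move=> v; rewrite lee_fin invr_ge0.
rewrite /f ge0_symfun_integralT//.
- rewrite -set_itvcy integral0y_oneDsqr -!EFinM; congr EFin.
  move: p0; generalize (@pi R) => p p0; field.
  by apply/eqP => p00; rewrite p00 mulr0 ltxx in p0.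
- exact: continuous_oneDsqrV.
- by move=> v /=; rewrite /oneDsqr sqrrN.
Qed.

End laplace.

(** * Integrability criteria and measurability of parameter integrals *)

Lemma integrable_indic_lty d (T : measurableType d) (R : realType)
    (mu : {measure set T -> \bar R}) (D : set T) :
  measurable D -> (mu D < +oo)%E -> mu.-integrable setT (fun x => (\1_D x)%:E).
Proof.
move=> mD Doo; apply/integrableP; split; first exact/measurable_EFinP.
under eq_integral do rewrite gee0_abs ?lee_fin//.
by rewrite integral_indic// setIT.
Qed.

Lemma measurable_fun_integral_prod d1 d2 (T1 : measurableType d1)
    (T2 : measurableType d2) (R : realType)
    (m2 : {sigma_finite_measure set T2 -> \bar R}) (f : T1 * T2 -> \bar R) :
  measurable_fun setT f -> measurable_fun setT (fun x => \int[m2]_y f (x, y))%E.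
Proof.
move=> mf.
rewrite (_ : (fun _ => _) = ((fun x => \int[m2]_y (f^\+)%E (x, y)) \- (fun x => \int[m2]_y (f^\-)%E (x, y)))%E).
  apply: emeasurable_funB.
    by apply: measurable_fun_fubini_tonelli_F => //; exact: measurable_funepos.
  by apply: measurable_fun_fubini_tonelli_F => //; exact: measurable_funeneg.
apply/funext => x; rewrite [LHS]integralE; congr (_ - _)%E.
  by apply: eq_integral => y _; rewrite !funeposE.
by apply: eq_integral => y _; rewrite !funenegE.
Qed.

Lemma measurable_fun_Rintegral_prod d1 d2 (T1 : measurableType d1)
    (T2 : measurableType d2) (R : realType)
    (m2 : {sigma_finite_measure set T2 -> \bar R}) (f : T1 * T2 -> R) :
  measurable_fun setT f -> measurable_fun setT (fun x => \int[m2]_y f (x, y)).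
Proof.
move=> mf; apply: (measurableT_comp (@fine_measurable R setT measurableT)).
exact: (measurable_fun_integral_prod m2 ((measurable_EFinP _ _).2 mf)).
Qed.

Lemma integrable_bounded_supp d (T : measurableType d) (R : realType)
    (mu : {measure set T -> \bar R}) (D : set T) (M : R) (f : T -> R) :
  measurable D -> (mu D < +oo)%E -> measurable_fun setT f ->
  (forall x, `|f x| <= M * \1_D x) -> mu.-integrable setT (EFin \o f).
Proof.
move=> mD Doo mf fM.
apply: (@le_integrable _ _ _ _ _ _ _ (fun x => (M * \1_D x)%:E)) => //.
- exact/measurable_EFinP.
- by move=> x _ /=; rewrite lee_fin (le_trans (fM x))// ler_norm.
- rewrite (_ : (fun x => _) = (fun x => M%:E * (\1_D x)%:E)%E); last by apply/funext => x; rewrite EFinM.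
  apply: integrableZl => //.
  exact: integrable_indic_lty.
Qed.

(** * Autocorrelation of a bounded function of compact support *)

Section parseval.
Context {R : realType}.
Notation leb := (@lebesgue_measure R).
Variables (a : R -> R) (M N : R).
Hypotheses (ma : measurable_fun setT a) (aM : forall s, `|a s| <= M)
  (aN : forall s, N < `|s| -> a s = 0) (N0 : 0 <= N).

Let D (c : R) : set R := `[- c, c].

Let mD c : measurable (D c). Proof. exact: measurable_itv. Qed.

Let D_oo c : (leb (D c) < +oo)%E.
Proof. by rewrite /D lebesgue_measure_itv/=; case: ifP => _; rewrite ?ltry// -EFinB ltry. Qed.

#[local] Hint Resolve mD D_oo : core.

Let M0 : 0 <= M. Proof. by rewrite (le_trans _ (aM 0)). Qed.

Let aD s : `|a s| <= M * \1_(D N) s.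
Proof.
rewrite indicE; have [/set_mem sD|] := boolP (s \in D N); first by rewrite mulr1.
rewrite notin_setE /D/= in_itv/= => sD; rewrite aN ?normr0 ?mulr0//.
by rewrite ltNge ler_norml; exact/negP.
Qed.

(** With [sincoef], the real part and minus the imaginary part of the Fourier transform of the real
    function [a]. *)
Definition coscoef (u : R) : R := \int[leb]_s (a s * cos (2 * pi * s * u)).
Definition sincoef (u : R) : R := \int[leb]_s (a s * sin (2 * pi * s * u)).
Definition autocorr (c : R) : R := \int[leb]_s (a s * a (c + s)).

Let integrable_D (c M' : R) (f : R -> R) : measurable_fun setT f ->
  (forall s, `|f s| <= M' * \1_(D c) s) -> leb.-integrable setT (EFin \o f).
Proof. by move=> mf fM; exact: (@integrable_bounded_supp _ (measurableTypeR R) R leb (D c) M' f (mD c) (D_oo c) mf fM). Qed.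

Let iD c : leb.-integrable setT (fun s => (\1_(D c) s)%:E).
Proof. exact: (@integrable_indic_lty _ (measurableTypeR R) R leb _ (mD c) (D_oo c)). Qed.

Let mtrig (f : R -> R) (u : R) : continuous f ->
  measurable_fun setT (fun s => f (2 * pi * s * u)).
Proof.
move=> cf; apply: (measurableT_comp (continuous_measurable_fun cf)).
by do ?apply: measurable_funM.
Qed.

Let int_trig (f : R -> R) (u : R) : continuous f -> (forall x, `|f x| <= 1) ->
  leb.-integrable setT (fun s => (a s * f (2 * pi * s * u))%:E).
Proof.
move=> cf f1; apply: (@integrable_D N M).
  by apply: measurable_funM => //; exact: mtrig.
move=> s; rewrite normrM (le_trans _ (aD s))// ler_piMr//.
Qed.

Let sin1 (x : R) : `|sin x| <= 1. Proof. by rewrite ler_norml sin_geN1 sin_le1. Qed.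
Let cos1 (x : R) : `|cos x| <= 1. Proof. by rewrite ler_norml cos_geN1 cos_le1. Qed.

Let int_cos u := int_trig u (@continuous_cos R) cos1.
Let int_sin u := int_trig u (@continuous_sin R) sin1.

Lemma integrable_coscoef u : leb.-integrable setT (fun s => (a s * cos (2 * pi * s * u))%:E).
Proof. exact: int_cos. Qed.

Lemma integrable_sincoef u : leb.-integrable setT (fun s => (a s * sin (2 * pi * s * u))%:E).
Proof. exact: int_sin. Qed.

Let mauto2 : measurable_fun setT (fun p : R * R => a p.2 * a (p.1 + p.2)).
Proof.
apply: measurable_funM; first exact: measurableT_comp.
by apply: measurableT_comp => //; exact: measurable_funD.
Qed.

Let g (u : R) (p : R * R) : R := a p.2 * a (p.1 + p.2) * cos (2 * pi * p.1 * u).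

Let mg u : measurable_fun setT (g u).
Proof.
apply: measurable_funM => //.
exact: (measurableT_comp (mtrig u (@continuous_cos R)) (@measurable_fst _ _ _ _)).
Qed.

Let auto_bound c s : `|a s * a (c + s)| <= M ^+ 2 * (\1_(D (N + N)) c * \1_(D N) s).
Proof.
rewrite normrM !indicE.
have [/set_mem sD|sD] := boolP (s \in D N); last first.
  by have := aD s; rewrite indicE (negbTE sD) mulr0 normr_le0 => /eqP ->; rewrite normr0 mul0r !mulr0.
have [/set_mem cD|cD] := boolP (c \in D (N + N)).
  by rewrite !mulr1 expr2 ler_pM.
rewrite !(mul0r,mulr0) [a (c + s)]aN ?normr0 ?mulr0//.
move: cD sD; rewrite notin_setE /D/= !in_itv/= => cD sD.
rewrite ltNge; apply/negP; rewrite ler_norml => cs; apply: cD.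
by apply/andP; split; lra.
Qed.

Let int_g u : (leb \x leb)%E.-integrable setT (EFin \o g u).
Proof.
apply: (@integrable_bounded_supp _ (measurableTypeR R * measurableTypeR R)%type R (leb \x leb)%E (D (N + N) `*` D N) (M ^+ 2) (g u)) => //.
- by apply: measurableX; exact: mD.
- apply: (@le_lt_trans _ _ (leb (D (N + N)) * leb (D N))%E).
    by rewrite le_eqVlt; apply/orP; left; apply/eqP; apply: product_measure1E; exact: mD.
  by rewrite lte_mul_pinfty// ge0_fin_numE.
- exact: mg.
- move=> [c s].
  have -> : \1_(D (N + N) `*` D N) (c, s) = \1_(D (N + N)) c * \1_(D N) s :> R.
    by rewrite !indicE in_setX/=; case: (_ \in _); case: (_ \in _); rewrite /= ?mulr1 ?mulr0.
  by rewrite /g normrM (le_trans _ (auto_bound c s))// ler_piMr.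
Qed.

Lemma integrable_autocorr c : leb.-integrable setT (fun s => (a s * a (c + s))%:E).
Proof.
apply: (@integrable_D N (M ^+ 2)).
  by apply: measurable_funM => //; apply: measurableT_comp => //; exact: measurable_funD.
move=> s; rewrite (le_trans (auto_bound c s))// ler_wpM2l ?sqr_ge0//.
by rewrite ler_piMl// indicE; case: (_ \in _).
Qed.

Lemma autocorr_bound c : `|autocorr c| <= M ^+ 2 * fine (leb (D N)) * \1_(D (N + N)) c.
Proof.
rewrite (le_trans (le_normr_Rintegral _ (integrable_autocorr c)))//.
rewrite (@le_trans _ _ (\int[leb]_s (M ^+ 2 * \1_(D (N + N)) c * \1_(D N) s)))//.
  apply: le_Rintegral => //.
  - exact: integrable_norm (integrable_autocorr c).
  - rewrite (_ : _ \o _ = (fun x => (M ^+ 2 * \1_(D (N + N)) c)%:E * (\1_(D N) x)%:E)%E).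
      by apply: integrableZl => //; exact: iD.
    by apply/funext => x /=; rewrite -EFinM.
  - by move=> s _; rewrite -mulrA auto_bound.
rewrite RintegralZl//; last exact: iD.
have -> : \int[leb]_s \1_(D N) s = fine (leb (D N)).
  by congr fine; apply: etrans (integral_indic _ _ _) _; rewrite ?setIT//; exact: mD.
by rewrite mulrAC.
Qed.

Lemma measurable_autocorr : measurable_fun setT autocorr.
Proof.
exact: (@measurable_fun_Rintegral_prod _ _ (measurableTypeR R) (measurableTypeR R) R leb _ mauto2).
Qed.

(** Wiener-Khinchin: Fubini, the shift t = c + s and the addition formula for cos(2 pi (t - s) u)
    split the cosine transform of the autocorrelation into products of transforms of [a]. *)
Lemma autocorr_fourier u :
  coscoef u ^+ 2 + sincoef u ^+ 2 = \int[leb]_c (autocorr c * cos (2 * pi * c * u)).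
Proof.
have F : (\int[leb]_c \int[leb]_s (g u (c, s))%:E = \int[leb]_s \int[leb]_c (g u (c, s))%:E)%E.
  exact: Fubini (int_g u).
have -> : \int[leb]_c (autocorr c * cos (2 * pi * c * u)) =
   fine (\int[leb]_c \int[leb]_s (g u (c, s))%:E)%E.
  congr fine; apply: eq_integral => c _; rewrite /g/= /autocorr.
  rewrite -RintegralZr; [|by []|exact: integrable_autocorr].
  rewrite /Rintegral fineK; first by [].
  apply: integrable_fin_num; first exact: measurableT.
  rewrite (_ : (fun _ => _) = (fun x => (a x * a (c + x))%:E * (cos (2 * pi * c * u))%:E)%E).
    by apply: integrableZr => //; exact: integrable_autocorr.
  by apply/funext => x; rewrite EFinM.
rewrite F.
transitivity (\int[leb]_s (a s * (cos (2 * pi * s * u) * coscoef u + sin (2 * pi * s * u) * sincoef u))).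
  rewrite (_ : (fun s => _) = (fun s => coscoef u * (a s * cos (2 * pi * s * u)) + sincoef u * (a s * sin (2 * pi * s * u)))); last first.
    by apply/funext => s; ring.
  rewrite (RintegralD measurableT (@integrableZl _ _ _ _ _ measurableT (coscoef u) _ (int_cos u))
    (@integrableZl _ _ _ _ _ measurableT (sincoef u) _ (int_sin u))).
  rewrite RintegralZl; [|by []|exact: int_cos].
  rewrite RintegralZl; [|by []|exact: int_sin].
  by rewrite -/(coscoef u) -/(sincoef u); ring.
congr fine; apply: eq_integral => s _.
clear F int_g mg.
(* The inner integrand in the variable t = c + s, written so that each summand factors into a
   function of s and a function of t. *)
pose f (t : R) := (a s * a t * (cos (2 * pi * t * u) * cos (2 * pi * s * u) + sin (2 * pi * t * u) * sin (2 * pi * s * u)))%:E.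
have fE : f = ((fun t => (a s * cos (2 * pi * s * u))%:E * (a t * cos (2 * pi * t * u))%:E) \+
              (fun t => (a s * sin (2 * pi * s * u))%:E * (a t * sin (2 * pi * t * u))%:E))%E.
  by apply/funext => t; rewrite /f/= -!EFinM -EFinD; congr EFin; ring.
have if1 : leb.-integrable setT (fun t => (a s * cos (2 * pi * s * u))%:E * (a t * cos (2 * pi * t * u))%:E)%E.
  exact: (@integrableZl _ _ _ _ _ measurableT _ _ (int_cos u)).
have if2 : leb.-integrable setT (fun t => (a s * sin (2 * pi * s * u))%:E * (a t * sin (2 * pi * t * u))%:E)%E.
  exact: (@integrableZl _ _ _ _ _ measurableT _ _ (int_sin u)).
have intf : leb.-integrable setT f by rewrite fE; exact: integrableD.
transitivity (\int[leb]_t f t)%E.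
  rewrite fE integralD//.
  rewrite (integralZl measurableT (int_cos u)) (integralZl measurableT (int_sin u)).
  rewrite /coscoef /sincoef /Rintegral.
  rewrite mulrDr !mulrA EFinD !EFinM !fineK; [by []|exact: (integrable_fin_num measurableT (int_sin u))|exact: (integrable_fin_num measurableT (int_cos u))].
have := @integral_affine R 1 s ltr01 f intf; rewrite invr1 mul1e => <-.
apply: eq_integral => c _; rewrite /f /g/= mul1r; congr EFin; congr (_ * _).
by rewrite -cosB; congr cos; ring.
Qed.


Let int_a : leb.-integrable setT (EFin \o a).
Proof. exact: (integrable_D ma aD). Qed.

Let continuous_shift_integral (G : R -> R) : continuous G ->
  (\int[leb]_(s in D N) `|G (c + s) - G s|) @[c --> 0] --> (0 : R).
Proof.
move=> cG.
have cGc c : continuous (fun s => `|G (c + s) - G s|).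
  move=> s; apply: cvg_norm; apply: cvgB; last exact: cG.
  apply: continuous_comp; last exact: cG.
  by apply: cvgD; [exact: cvg_cst|exact: cvg_id].
(* Shifts by less than 1 stay inside [-(N + 1), N + 1], where G is bounded; twice this bound is the
   dominating constant. *)
have [B GB] : exists B, forall t, `|t| <= N + 1 -> `|G t| <= B.
  have [t _ tM] : exists2 t, t \in `[(- (N + 1)), N + 1] &
      forall s, s \in `[(- (N + 1)), N + 1] -> `|G s| <= `|G t|.
    have NN : - (N + 1) <= N + 1 by move: N0; lra.
    apply: (EVT_max NN).
    by apply: continuous_subspaceT => s; apply: cvg_norm; exact: cG.
  by exists `|G t| => s sN; apply: tM; rewrite in_itv/= -ler_norml.
have Dc c : compact (D c) by exact: segment_compact.
have h : {in `]-1, 1[%classic, continuous (fun c => \int[leb]_(s in D N) `|G (c + s) - G s|)}.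
  apply: (@continuity_under_integral _ _ (measurableTypeR R) leb (fun c s => `|G (c + s) - G s|) (D N) (mD N) (-1) 1 _ _ (fun=> 2 * B)).
  - move=> c _; apply: continuous_compact_integrable; first exact: Dc.
    by apply: continuous_subspaceT; exact: cGc.
  - apply: aeW => s _ c _; apply: cvg_norm; apply: cvgB; last exact: cvg_cst.
    apply: continuous_comp; last exact: cG.
    by apply: cvgD; [exact: cvg_id|exact: cvg_cst].
  - apply: continuous_compact_integrable; first exact: Dc.
    by apply: continuous_subspaceT => s; exact: cvg_cst.
  - move=> c; rewrite /= in_itv/= => /andP[c1 c2]; apply: aeW => s; rewrite /D/= in_itv/= => /andP[s1 s2].
    rewrite normr_id (le_trans (ler_normB _ _))// mulr2n mulrDl mul1r lerD//.
      by apply: GB; rewrite ler_norml; apply/andP; split; lra.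
    by apply: GB; rewrite ler_norml; apply/andP; split; lra.
have := h 0; rewrite inE/= in_itv/= => /(_ _).
have -> : -1 < (0 : R) < 1 by apply/andP; split; lra.
move=> /(_ isT); rewrite /continuous_at.
under [X in _ --> X]eq_Rintegral do rewrite add0r subrr normr0.
rewrite (_ : \int[leb]_(_ in D N) 0 = 0)//.
by apply: etrans (Rintegral_cst _ _ _) _; rewrite ?mul0r//; exact: mD.
Qed.

(** Approximate [a] in L1 by a continuous G. Then a(s) - a(c + s) consists of two approximation
    errors and an increment of G, each with small integral, and the other factor |a(s)| is at most
    M. *)
Lemma autocorr_cvg0 : autocorr c @[c --> 0] --> autocorr 0.
Proof.
apply/cvgrPdist_le => e e0.
have iaE : leb.-integrable (D (N + 1)) (EFin \o a) by exact: (@integrableS _ (measurableTypeR R) R leb setT (D (N + 1)) (EFin \o a) measurableT (mD _) (@subsetT _ _) int_a).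
have [g_ [cg _ gcvg]] := @approximation_continuous_integrable R (D (N + 1)) a (mD _) (D_oo _) iaE.
(* Three errors, each multiplied by at most M, must add up to at most e; M + 1 avoids a division by
   zero. *)
pose eta := e / (3 * (M + 1)).
have eta0 : 0 < eta by rewrite divr_gt0// mulr_gt0// ltr_wpDl.
have [n gn] : exists n, (\int[leb]_(z in D (N + 1)) `|(a z - g_ n z)%:E| <= eta%:E)%E.
  have /fine_cvgP[[n1 _ fn1] /cvgrPdist_le/(_ _ eta0)[n2 _ fn2]] := gcvg.
  exists (maxn n1 n2); rewrite -(@fineK _ (integral _ _ _)); last by apply: fn1; exact: leq_maxl.
  rewrite lee_fin; have := fn2 (maxn n1 n2) (leq_maxr _ _).
  by rewrite sub0r normrN; apply: le_trans; exact: ler_norm.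
set G := g_ n in gn; have cG : continuous G := cg n.
have mG : measurable_fun setT G by exact: continuous_measurable_fun.
have := continuous_shift_integral cG => /cvgrPdist_le/(_ _ eta0) H.
have H1 : \forall c \near (0 : R), `|c| <= 1.
  have /cvgrPdist_le/(_ _ ltr01) := @cvg_id _ (nbhs (0 : R)).
  by apply: filterS => c; rewrite sub0r normrN.
near=> c.
have c1 : `|c| <= 1 by near: c.
have Hc : \int[leb]_(s in D N) `|G (c + s) - G s| <= eta.
  have : `|0 - \int[leb]_(s in D N) `|G (c + s) - G s| | <= eta by near: c.
  by rewrite sub0r normrN; apply: le_trans; exact: ler_norm.
pose b (t : R) : \bar R := (`|a t - G t| * \1_(D (N + 1)) t)%:E.
have b0 t : (0 <= b t)%E by rewrite lee_fin mulr_ge0.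
have mb : measurable_fun setT b.
  apply/measurable_EFinP; apply: measurable_funM; last exact: measurable_indic.
  by apply: measurableT_comp => //; exact: measurable_funB.
have Ib : (\int[leb]_t b t <= eta%:E)%E.
  apply: le_trans gn; rewrite [leRHS]integral_mkcond le_eqVlt; apply/orP; left; apply/eqP.
  apply: eq_integral => t _; rewrite /b patchE indicE.
  by case: ifPn => _; rewrite ?mulr1 ?mulr0.
have Ibc : (\int[leb]_s b (c + s)%R <= eta%:E)%E.
  apply: le_trans Ib; have := @ge0_integral_affine R 1 c ltr01 b mb b0.
  by rewrite invr1 mul1e => <-; under eq_integral do rewrite addrC -[X in (X + c)%R]mul1r.
pose hG (s : R) : \bar R := (`|G (c + s) - G s| * \1_(D N) s)%:E.
have mGc : measurable_fun setT (fun s => `|G (c + s) - G s|).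
  apply: measurableT_comp => //; apply: measurable_funB => //.
  by apply: measurableT_comp => //; exact: measurable_funD.
have mhG : measurable_fun setT hG.
  by apply/measurable_EFinP; apply: measurable_funM => //; exact: measurable_indic.
have IhG : (\int[leb]_s hG s <= eta%:E)%E.
  rewrite -lee_fin in Hc; apply: le_trans Hc.
  rewrite /Rintegral fineK.
    rewrite [leRHS]integral_mkcond le_eqVlt; apply/orP; left; apply/eqP.
    apply: eq_integral => t _; rewrite /hG patchE indicE.
    by case: ifPn => _; rewrite ?mulr1 ?mulr0.
  apply: integrable_fin_num; first exact: mD.
  apply: continuous_compact_integrable; first exact: segment_compact.
  apply: continuous_subspaceT => s; apply: cvg_norm; apply: cvgB; last exact: cG.
  apply: continuous_comp; last exact: cG.
  by apply: cvgD; [exact: cvg_cst|exact: cvg_id].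
have mbc : measurable_fun setT (fun s => b (c + s)).
  by apply: measurableT_comp => //; exact: measurable_funD.
rewrite -lee_fin /autocorr -RintegralB//; last 2 first.
- exact: integrable_autocorr.
- exact: integrable_autocorr.
rewrite EFin_normr_Rintegral//; last first.
  rewrite (_ : _ \o _ = ((fun s => (a s * a (0 + s))%:E) \- (fun s => (a s * a (c + s))%:E))%E); last by apply/funext.
  by apply: integrableB => //; exact: integrable_autocorr.
apply: le_trans (le_abse_integral _ _ _) _ => //.
  apply/measurable_EFinP; apply: measurable_funB; apply: measurable_funM => //; apply: measurableT_comp => //; exact: measurable_funD.
apply: (@le_trans _ _ (\int[leb]_s (M%:E * (b s + b (c + s)%R + hG s)))%E).
  apply: ge0_le_integral => //.
  - apply: measurableT_comp => //; apply/measurable_EFinP; apply: measurable_funB; apply: measurable_funM => //; apply: measurableT_comp => //; exact: measurable_funD.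
  - by apply: emeasurable_funM => //; do 2 apply: emeasurable_funD => //.
  move=> s _; rewrite /b /hG -!EFinD -EFinM lee_fin add0r -mulrBr normrM.
  have [/set_mem sD|sD] := boolP (s \in D N); last first.
    have := aD s; rewrite indicE (negbTE sD) mulr0 normr_le0 => /eqP ->.
    by rewrite normr0 mul0r mulr_ge0// !addr_ge0// mulr_ge0// indicE.
  have s1 : s \in D (N + 1).
    by rewrite inE; move: sD; rewrite /D/= !in_itv/= => /andP[? ?]; apply/andP; split; lra.
  have cs1 : (c + s) \in D (N + 1).
    move: c1; rewrite ler_norml => /andP[? ?].
    by rewrite inE; move: sD; rewrite /D/= !in_itv/= => /andP[? ?]; apply/andP; split; lra.
  rewrite !indicE s1 cs1 mem_set// !mulr1 ler_pM//.
  rewrite (_ : a s - a (c + s) = (a s - G s) - (a (c + s) - G (c + s)) - (G (c + s) - G s)); last by ring.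
  by rewrite (le_trans (ler_normB _ _))// lerD2r (le_trans (ler_normB _ _)).
rewrite ge0_integralZl//; last 2 first.
- by do 2 apply: emeasurable_funD => //.
- by move=> s _; rewrite !adde_ge0// lee_fin mulr_ge0// indicE.
rewrite ge0_integralD//; last 3 first.
- by move=> s _; rewrite adde_ge0.
- by apply: emeasurable_funD.
- by move=> s _; rewrite lee_fin mulr_ge0// indicE.
rewrite ge0_integralD//.
apply: (@le_trans _ _ (M%:E * (eta%:E + eta%:E + eta%:E)))%E.
  by rewrite lee_wpmul2l ?lee_fin//; apply: leeD => //; exact: leeD.
rewrite -!EFinD -EFinM lee_fin /eta.
rewrite (_ : _ + _ + _ = 3 * (e / (3 * (M + 1)))); last by ring.
rewrite (_ : M * _ = (M / (M + 1)) * e); last by field; rewrite gt_eqF// ltr_wpDl.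
have MM : M / (M + 1) <= 1 by rewrite ler_pdivrMr ?ltr_wpDl// mul1r lerDl.
by rewrite ler_piMl// ltW.
Unshelve. all: end_near. Qed.


Let measurable_coef (f : R -> R) : continuous f -> (forall x, `|f x| <= 1) ->
  measurable_fun setT (fun u => \int[leb]_s (a s * f (2 * pi * s * u))).
Proof.
move=> cf f1.
pose h (p : measurableTypeR R * measurableTypeR R) := a p.2 * f (2 * pi * p.2 * p.1).
suff mh : measurable_fun setT h by exact: (measurable_fun_Rintegral_prod leb mh).
apply: measurable_funM; first exact: (measurableT_comp ma).
apply: (measurableT_comp (continuous_measurable_fun cf)).
by apply: measurable_funM => //; apply: measurable_funM.
Qed.

Lemma measurable_coscoef : measurable_fun setT coscoef.
Proof. exact: measurable_coef (@continuous_cos R) cos1. Qed.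

Lemma measurable_sincoef : measurable_fun setT sincoef.
Proof. exact: measurable_coef (@continuous_sin R) sin1. Qed.

Lemma measurable_power : measurable_fun setT (fun u => coscoef u ^+ 2 + sincoef u ^+ 2).
Proof.
apply: measurable_funD; apply: measurable_funX.
  exact: measurable_coscoef.
exact: measurable_sincoef.
Qed.

End parseval.

(** * Abel summation of a nonnegative cosine transform *)

Section abel.
Context {R : realType}.
Notation leb := (@lebesgue_measure R).

Let D (c : R) : set R := `[- c, c].

Let mD c : measurable (D c). Proof. exact: measurable_itv. Qed.

Let D_oo c : (leb (D c) < +oo)%E.
Proof. by rewrite /D lebesgue_measure_itv/=; case: ifP => _; rewrite ?ltry// -EFinB ltry. Qed.

Variables (A K : R -> R) (B L : R).
Hypotheses (mA : measurable_fun setT A) (B0 : 0 <= B)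
  (AB : forall c, `|A c| <= B * \1_`[- L, L] c)
  (A_cvg0 : A c @[c --> 0] --> A 0)
  (mK : measurable_fun setT K) (K0 : forall u, 0 <= K u)
  (K_fourier : forall u, K u = \int[leb]_c (A c * cos (2 * pi * c * u))).

Let integrable_D (c M' : R) (f : R -> R) : measurable_fun setT f ->
  (forall s, `|f s| <= M' * \1_(D c) s) -> leb.-integrable setT (EFin \o f).
Proof. by move=> mf fM; exact: (@integrable_bounded_supp _ (measurableTypeR R) R leb (D c) M' f (mD c) (D_oo c) mf fM). Qed.

Let iD c : leb.-integrable setT (fun s => (\1_(D c) s)%:E).
Proof. exact: (@integrable_indic_lty _ (measurableTypeR R) R leb _ (mD c) (D_oo c)). Qed.

Let mtrig (f : R -> R) (u : R) : continuous f ->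
  measurable_fun setT (fun s => f (2 * pi * s * u)).
Proof.
move=> cf; apply: (measurableT_comp (continuous_measurable_fun cf)).
by do ?apply: measurable_funM.
Qed.

Let cos1 (x : R) : `|cos x| <= 1. Proof. by rewrite ler_norml cos_geN1 cos_le1. Qed.

Let U : set R := `[0, +oo[.
Let mU : measurable U. Proof. exact: measurable_itv. Qed.

Let poisson (e c : R) : R := e / (e ^+ 2 + (2 * pi * c) ^+ 2).

(** Fubini: integrating exp(-e u) cos(2 pi c u) over the half-line in u leaves the Poisson kernel in
    c. *)
Let int_abel (e : R) : 0 < e ->
  (\int[leb]_(u in U) (expR (- e * u) * K u)%:E = \int[leb]_c (A c * poisson e c)%:E)%E.
Proof.
move=> e0.
pose f (p : R * R) : R := A p.1 * cos (2 * pi * p.1 * p.2) * (expR (- e * p.2) * \1_U p.2).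
have mE : measurable_fun setT (fun u : R => expR (- e * u)).
  by apply: measurableT_comp => //; apply: measurable_funM.
have mEU : measurable_fun setT (fun u : R => expR (- e * u) * \1_U u).
  by apply: measurable_funM => //; exact: measurable_indic.
have mf : measurable_fun setT f.
  apply: measurable_funM; last exact: (measurableT_comp mEU measurable_snd).
  apply: measurable_funM; first exact: (measurableT_comp mA).
  apply: (measurableT_comp (continuous_measurable_fun (@continuous_cos R))).
  by apply: measurable_funM => //; apply: measurable_funM.
have mEf : measurable_fun setT (EFin \o f) by exact/measurable_EFinP.
have iE : leb.-integrable setT (fun u => (expR (- e * u) * \1_U u)%:E).
  have := integrable_expRN e0; rewrite integrable_mkcond//.
  congr (integrable _ _ _); apply/funext => u; rewrite patchE indicE.
  by case: ifPn => _; rewrite ?mulr1 ?mulr0.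
have iEE : (\int[leb]_u (expR (- e * u) * \1_U u)%:E = (e^-1)%:E)%E.
  rewrite -(integral_expRN e0) [RHS]integral_mkcond.
  apply: eq_integral => u _; rewrite patchE indicE.
  by case: ifPn => _; rewrite ?mulr1 ?mulr0.
have intf : (leb \x leb)%E.-integrable setT (EFin \o f).
  apply/(integrable12ltyP leb leb); first exact/measurable_EFinP.
  apply: (@le_lt_trans _ _ (\int[leb]_c ((B / e) * \1_(D L) c)%:E)%E).
    apply: ge0_le_integral => //.
    - by move=> c _; exact: integral_ge0.
    - apply: (@measurable_fun_integral_prod _ _ (measurableTypeR R) (measurableTypeR R) R leb (fun p => `|(f p)%:E|)%E) => //.
      exact: (measurableT_comp (@abse_measurable R setT) mEf).
    - have mI : measurable_fun setT (\1_(D L) : R -> R) by apply: measurable_indic; exact: mD.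
      by apply/measurable_EFinP; apply: (measurable_funM _ mI).
    move=> c _; apply: (@le_trans _ _ (\int[leb]_u ((B * \1_(D L) c)%:E * (expR (- e * u) * \1_U u)%:E))%E).
      apply: ge0_le_integral => //.
      + apply: measurableT_comp => //; apply/measurable_EFinP.
        by apply: (measurableT_comp mf); exact: measurable_pair1.
      + by apply: emeasurable_funM => //; exact: measurable_int iE.
      + move=> u _; rewrite /f/= lee_fin normrM [X in _ * X <= _]ger0_norm; last first.
          by rewrite mulr_ge0 ?expR_ge0// indicE.
        rewrite ler_wpM2r ?mulr_ge0 ?expR_ge0 ?indicE//.
        by rewrite normrM (le_trans _ (AB c))// ler_piMr.
    rewrite integralZl// iEE -EFinM lee_fin.
    by rewrite mulrAC.
  rewrite (_ : (fun x => _) = (fun x => (B / e)%:E * (\1_(D L) x)%:E)%E); last first.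
    by apply/funext => x; rewrite EFinM.
  rewrite (integralZl measurableT (iD L)).
  by have := integrable_fin_num measurableT (iD L); case: (integral _ _ _) => // r _; rewrite -EFinM ltry.
have F : (\int[leb]_c \int[leb]_u (f (c, u))%:E = \int[leb]_u \int[leb]_c (f (c, u))%:E)%E.
  exact: Fubini intf.
have -> : (\int[leb]_c (A c * poisson e c)%:E = \int[leb]_c \int[leb]_u (f (c, u))%:E)%E.
  apply: eq_integral => c _.
  have h := integral_laplace (2 * pi * c) e0.
  clear F intf iEE iE mf mEf.
  rewrite EFinM -h -integralZl; [|exact: mU|].
    rewrite [LHS]integral_mkcond; apply: eq_integral => u _; rewrite /f/= patchE indicE.
    case: ifPn => _; last by rewrite !mulr0.
    by rewrite mulr1 -EFinM; congr EFin; ring.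
  apply: (@le_integrable _ (measurableTypeR R) R leb U mU _ _ _ _ (integrable_expRN e0)).
    apply/measurable_EFinP; apply: measurable_funTS; apply: measurable_funM.
      exact: mE.
    apply: (measurableT_comp (continuous_measurable_fun (@continuous_cos R))).
    by apply: measurable_funM.
  by move=> u _; rewrite /= lee_fin normrM ler_piMr.
rewrite F [LHS]integral_mkcond; apply: eq_integral => u _.
clear F intf iEE iE mf mEf mEU.
rewrite patchE; have -> : (\int[leb]_c (f (c, u))%:E = ((expR (- e * u) * \1_U u) * K u)%:E)%E.
  have ia : leb.-integrable setT (fun c => (A c * cos (2 * pi * c * u))%:E).
    apply: (@integrable_D L B).
      apply: measurable_funM; first exact: mA.
      exact: (mtrig u (@continuous_cos R)).
    by move=> c; rewrite normrM (le_trans _ (AB c))// ler_piMr.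
  rewrite K_fourier EFinM /Rintegral fineK; last exact: integrable_fin_num.
  rewrite -(integralZl measurableT ia); apply: eq_integral => c _.
  by rewrite /f/= -EFinM; congr EFin; ring.
by rewrite indicE; case: ifPn => _; rewrite ?mulr0 ?mulr1 ?mul0r.
Qed.


Let A_le c : `|A c| <= B.
Proof. by rewrite (le_trans (AB _))// ler_piMr// indicE; case: (_ \in _). Qed.

Let cauchy (v : R) : R := 1 / (1 + (2 * pi * v) ^+ 2).

Let cauchy_ge0 v : 0 <= cauchy v.
Proof. by rewrite divr_ge0// addr_ge0// sqr_ge0. Qed.

Let mcauchy : measurable_fun setT cauchy.
Proof.
rewrite (_ : cauchy = (fun x => (oneDsqr x)^-1) \o (fun v => 2 * pi * v)).
  apply: (measurableT_comp (continuous_measurable_fun (@continuous_oneDsqrV R))).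
  by apply: measurable_funM.
by apply/funext => v; rewrite /cauchy div1r.
Qed.

Let icauchy : leb.-integrable setT (EFin \o cauchy).
Proof.
apply/integrableP; split; first exact/measurable_EFinP.
under eq_integral do rewrite /= ger0_norm//.
by rewrite integral_cauchy ltry.
Qed.

Let eps n : R := n.+1%:R^-1.
Let eps0 n : 0 < eps n. Proof. by rewrite invr_gt0. Qed.

Let mac (e : R) : measurable_fun setT (fun v => A (e * v) * cauchy v).
Proof.
apply: measurable_funM => //.
by apply: (measurableT_comp mA); exact: measurable_funM.
Qed.

Let int_poisson (e : R) : 0 < e ->
  (\int[leb]_c (A c * poisson e c)%:E = \int[leb]_v (A (e * v) * cauchy v)%:E)%E.
Proof.
move=> e0; pose f c := (A c * poisson e c)%:E.
have en : e != 0 by rewrite gt_eqF.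
have c0 (v : R) : 1 + (2 * pi * v) ^+ 2 != 0 by rewrite gt_eqF// ltr_pwDl// sqr_ge0.
have pE : poisson e = (fun c => e^-1 * cauchy (e^-1 * c)).
  apply/funext => c; rewrite /poisson /cauchy.
  rewrite (_ : e ^+ 2 + (2 * pi * c) ^+ 2 = e ^+ 2 * (1 + (2 * pi * (e^-1 * c)) ^+ 2)); last first.
    by rewrite [LHS](_ : _ = e ^+ 2 * (1 + (2 * pi * c) ^+ 2 / e ^+ 2)); [congr (_ * (_ + _)); rewrite -expr_div_n; congr (_ ^+ _); ring|field].
  move: (c0 (e^-1 * c)); set X := 1 + _ => X0.
  by field; rewrite en X0.
have mp : measurable_fun setT (poisson e).
  rewrite pE; apply: measurable_funM => //; apply: (measurableT_comp mcauchy).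
  exact: measurable_funM.
have cauchy1 v : cauchy v <= 1.
  by rewrite ler_pdivrMr ?mul1r ?lerDl ?sqr_ge0// ltr_pwDl// sqr_ge0.
have intf : leb.-integrable setT f.
  apply: (@integrable_D L (B * e^-1) (fun c => A c * poisson e c)).
    by apply: measurable_funM => //; exact: mA.
  move=> c; rewrite normrM mulrAC ler_pM//.
  have ei0 : 0 <= e^-1 by rewrite invr_ge0 ltW.
  by rewrite pE normrM (ger0_norm ei0) (ger0_norm (cauchy_ge0 _)) ler_piMr.
have := integral_affine 0 e0 intf => /(congr1 (fun x => e%:E * x)%E).
rewrite muleA -EFinM divff// mul1e => <-.
have fE v : f (e * v + 0) = ((e^-1)%:E * (A (e * v) * cauchy v)%:E)%E.
  rewrite /f pE addr0 -EFinM mulKf//; congr EFin; ring.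
have -> : (\int[leb]_v f (e * v + 0)%R = \int[leb]_v ((e^-1)%:E * (A (e * v) * cauchy v)%:E))%E.
  by apply: eq_integral => v _; exact: fE.
have iac : leb.-integrable setT (fun v => (A (e * v) * cauchy v)%:E).
    apply: (@le_integrable _ (measurableTypeR R) R leb setT measurableT (fun v => (A (e * v) * cauchy v)%:E) (fun s => B%:E * (cauchy s)%:E)%E).
  - by apply/measurable_EFinP; exact: (mac e).
  - move=> v _; have h0 := mulr_ge0 B0 (cauchy_ge0 v).
    rewrite -EFinM /= lee_fin normrM (ger0_norm h0) (ger0_norm (cauchy_ge0 v)).
    by apply: ler_wpM2r; [exact: cauchy_ge0|exact: A_le].
  - exact: (@integrableZl _ (measurableTypeR R) R leb setT measurableT B _ icauchy).
by rewrite (integralZl measurableT iac) muleA -EFinM divff// mul1e.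
Qed.

Let cvg_cauchy : (\int[leb]_v (A (eps n * v) * cauchy v)%:E)%E @[n --> \oo] -->
  (2^-1 * A 0)%:E.
Proof.
have [|||||_ _] := @dominated_convergence _ (measurableTypeR R) R leb setT measurableT
  (fun n v => (A (eps n * v) * cauchy v)%:E) (fun v => (A 0 * cauchy v)%:E)
  (fun v => (B%:E * (cauchy v)%:E)%E).
- by move=> n; apply/measurable_EFinP; exact: (mac (eps n)).
- by apply/measurable_EFinP; apply: measurable_funM.
- apply: aeW => v _; apply: cvg_EFin; first exact: nearW.
  apply: cvgM; last exact: cvg_cst.
  apply: (cvg_comp (fun n => eps n * v) A _ A_cvg0).
  rewrite -(mul0r v); apply: cvgM; last exact: cvg_cst.
  exact: cvg_harmonic.
- exact: (@integrableZl _ (measurableTypeR R) R leb setT measurableT B _ icauchy).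
- apply: aeW => v n _; rewrite -EFinM /= lee_fin normrM (ger0_norm (cauchy_ge0 _)).
  by apply: ler_wpM2r; [exact: cauchy_ge0|exact: A_le].
rewrite (_ : (\int[leb]_v (A 0 * cauchy v)%:E = (2^-1 * A 0)%:E)%E)//.
under eq_integral do rewrite EFinM.
by rewrite (integralZl measurableT icauchy) integral_cauchy -EFinM mulrC.
Qed.

Let cvg_abel : (\int[leb]_(u in U) (expR (- eps n * u) * K u)%:E)%E @[n --> \oo] -->
  (\int[leb]_(u in U) (K u)%:E)%E.
Proof.
have := @cvg_monotone_convergence _ (measurableTypeR R) R leb U mU
  (fun n u => (expR (- eps n * u) * K u)%:E).
rewrite (_ : (\int[leb]_(x in U) limn ((fun n u => (expR (- eps n * u) * K u)%:E)^~ x) = (\int[leb]_(u in U) (K u)%:E))%E); last first.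
  apply: eq_integral => u _; apply/cvg_lim => //; apply: cvg_EFin; first exact: nearW.
  have h0 : (- eps n * u) @[n --> \oo] --> (0 : R).
    rewrite -(mul0r u); apply: cvgM; last exact: cvg_cst.
    by rewrite -oppr0; apply: cvgN; exact: cvg_harmonic.
  have h : expR (- eps n * u) @[n --> \oo] --> (1 : R).
    by rewrite -(@expR0 R); apply: (cvg_comp _ expR h0); exact: continuous_expR.
  by rewrite -[X in _ --> X]mul1r; apply: cvgM h _; exact: cvg_cst.
apply.
- move=> n; apply/measurable_EFinP; apply: measurable_funTS; apply: measurable_funM => //.
  by apply: measurableT_comp => //; exact: measurable_funM.
- by move=> n u _; rewrite lee_fin mulr_ge0 ?expR_ge0.
- move=> u; rewrite /U/= in_itv/= andbT => u0 n m nm.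
  rewrite lee_fin ler_wpM2r// ler_expR ler_wpM2r// lerN2.
  by rewrite /eps lef_pV2 ?posrE// ler_nat.
Qed.

(** Nonnegativity of K takes the place of integrability: the damping exp(-u / (n + 1)) increases to
    1, so monotone convergence recovers the integral of K. On the other side, after rescaling by
    [eps n], the values A(eps v) tend boundedly to A(0) against the Cauchy density. *)
Lemma abel_inversion0 :
  (\int[leb]_(u in `[0%R, +oo[) (K u)%:E = (2^-1 * A 0)%:E)%E.
Proof.
have := cvg_abel.
under eq_fun do rewrite int_abel// int_poisson//.
by move/cvg_lim => <-//; move/cvg_lim : cvg_cauchy => ->.
Qed.

End abel.

(** The autocorrelation at 0 is the integral of a^2, and its cosine transform is a sum of squares,
    to which [abel_inversion0] applies. *)
Lemma parseval_real (R : realType) (a : R -> R) (M N : R) :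
  measurable_fun setT a -> (forall s, `|a s| <= M) ->
  (forall s, N < `|s| -> a s = 0) -> 0 <= N ->
  (\int[lebesgue_measure]_(u in `[0%R, +oo[) (coscoef a u ^+ 2 + sincoef a u ^+ 2)%:E =
   (2^-1)%:E * \int[lebesgue_measure]_s (a s ^+ 2)%:E)%E.
Proof.
move=> ma aM aN N0.
transitivity ((2^-1 * autocorr a 0)%:E); last first.
  rewrite EFinM /autocorr /Rintegral fineK.
    by congr (_ * _)%E; apply: eq_integral => s _; rewrite add0r expr2.
  exact: (integrable_fin_num measurableT (integrable_autocorr ma aM aN 0)).
rewrite (abel_inversion0 (measurable_autocorr ma) _ (autocorr_bound ma aM aN) (autocorr_cvg0 ma aM aN N0)
  (measurable_power ma)).
- by [].
- by rewrite mulr_ge0 ?sqr_ge0// fine_ge0.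
- by move=> u; rewrite addr_ge0// sqr_ge0.
- exact: (autocorr_fourier ma aM aN).
Qed.

(** * Complex-valued functions and their integrals *)

Section complex_tools.
Context {R : realType}.
Implicit Types z w : R[i].

Definition normsq z : R := complex.Re z ^+ 2 + complex.Im z ^+ 2.

Lemma normsq_ge0 z : 0 <= normsq z.
Proof. by rewrite addr_ge0// sqr_ge0. Qed.

Lemma normsqM z w : normsq (z * w) = normsq z * normsq w.
Proof. by case: z w => [a b] [c e]; rewrite /normsq/=; ring. Qed.

Lemma normsq_cexpi (t : R) : normsq (cexpi t) = 1.
Proof. by rewrite /normsq/= cos2Dsin2. Qed.

Lemma normsqE z : normsq z = ComplexField.Normc.normc z ^+ 2.
Proof.
by case: z => [a b]; rewrite /ComplexField.Normc.normc sqr_sqrtr ?normsq_ge0// addr_ge0// sqr_ge0.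
Qed.

Lemma normsq_eq0 z : (normsq z == 0) = (z == 0).
Proof.
case: z => [a b]; rewrite /normsq/= paddr_eq0 ?sqr_ge0// !sqrf_eq0.
by apply/andP/eqP => [[/eqP-> /eqP->]//|[-> ->]]; rewrite !eqxx.
Qed.

Lemma cexpiD (s t : R) : cexpi (s + t) = cexpi s * cexpi t.
Proof. by rewrite /cexpi cosD sinD; apply/eqP; rewrite eq_complex/=; apply/andP; split; apply/eqP; ring. Qed.

Lemma cexpi0 : cexpi 0 = 1 :> R[i].
Proof. by rewrite /cexpi cos0 sin0. Qed.

Lemma ReM_le z w (M : R) : `|complex.Re z| <= M -> `|complex.Im z| <= M ->
  normsq w = 1 -> `|complex.Re (z * w)| <= 2 * M /\ `|complex.Im (z * w)| <= 2 * M.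
Proof.
case: z w => [a b] [c e]; rewrite /normsq/= => aM bM ce.
have c1 : `|c| <= 1 by rewrite -sqr_norm_le1 || (rewrite -(@ler_sqr _ _ 1) ?nnegrE// expr1n real_normK ?num_real// -ce lerDl sqr_ge0).
have e1 : `|e| <= 1 by rewrite -(@ler_sqr _ _ 1) ?nnegrE// expr1n real_normK ?num_real// -ce lerDr sqr_ge0.
have le1 (x y : R) : `|x| <= M -> `|y| <= 1 -> `|x * y| <= M.
  by move=> xM y1; rewrite normrM (le_trans _ xM)// ler_piMr.
split.
  by rewrite (le_trans (ler_normB _ _))// mulr2n mulrDl mul1r lerD// le1.
by rewrite (le_trans (ler_normD _ _))// mulr2n mulrDl mul1r lerD// le1.
Qed.

End complex_tools.

Section cint.
Context d (T : measurableType d) {R : realType}.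
Variable mu : {measure set T -> \bar R}.
Implicit Types f g : T -> R[i].

(** The condition [cmeasurable] over an arbitrary measurable space, so that slices and functions on
    products are covered. *)
Definition cmeas f : Prop :=
  measurable_fun setT (fun t => complex.Re (f t)) /\
  measurable_fun setT (fun t => complex.Im (f t)).

Definition cintegrable f : Prop :=
  mu.-integrable setT (fun t => (complex.Re (f t))%:E) /\
  mu.-integrable setT (fun t => (complex.Im (f t))%:E).

Definition cint f : R[i] :=
  Complex (\int[mu]_t complex.Re (f t)) (\int[mu]_t complex.Im (f t)).

Lemma cmeasM f g : cmeas f -> cmeas g -> cmeas (fun t => f t * g t).
Proof.
move=> [f1 f2] [g1 g2]; split.
  rewrite (_ : (fun t => _) = (fun t => complex.Re (f t) * complex.Re (g t) - complex.Im (f t) * complex.Im (g t))).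
    by apply: measurable_funB; exact: measurable_funM.
  by apply/funext => t; case: (f t) (g t) => [? ?] [].
rewrite (_ : (fun t => _) = (fun t => complex.Re (f t) * complex.Im (g t) + complex.Im (f t) * complex.Re (g t))).
  by apply: measurable_funD; exact: measurable_funM.
by apply/funext => t; case: (f t) (g t) => [? ?] [].
Qed.

Lemma cmeasD f g : cmeas f -> cmeas g -> cmeas (fun t => f t + g t).
Proof.
move=> [f1 f2] [g1 g2]; split.
  rewrite (_ : (fun t => _) = (fun t => complex.Re (f t) + complex.Re (g t))).
    exact: measurable_funD.
  by apply/funext => t; case: (f t) (g t) => [? ?] [].
rewrite (_ : (fun t => _) = (fun t => complex.Im (f t) + complex.Im (g t))).
  exact: measurable_funD.
by apply/funext => t; case: (f t) (g t) => [? ?] [].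
Qed.

Lemma cmeasN f : cmeas f -> cmeas (fun t => - f t).
Proof.
move=> [f1 f2]; split.
  rewrite (_ : (fun t => _) = (fun t => - complex.Re (f t))); first exact: measurable_funN.
  by apply/funext => t; case: (f t).
rewrite (_ : (fun t => _) = (fun t => - complex.Im (f t))); first exact: measurable_funN.
by apply/funext => t; case: (f t).
Qed.

Lemma cmeasB f g : cmeas f -> cmeas g -> cmeas (fun t => f t - g t).
Proof. by move=> mf mg; apply: cmeasD => //; exact: cmeasN. Qed.

Lemma cmeas_cst z : cmeas (fun=> z).
Proof. by split; exact: measurable_cst. Qed.

Lemma cmeas_cexpi (h : T -> R) : measurable_fun setT h -> cmeas (fun t => cexpi (h t)).
Proof.
move=> mh; split.
  exact: (measurableT_comp (continuous_measurable_fun (@continuous_cos R)) mh).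
exact: (measurableT_comp (continuous_measurable_fun (@continuous_sin R)) mh).
Qed.

Lemma measurable_normsq f : cmeas f -> measurable_fun setT (fun t => normsq (f t)).
Proof. by move=> [? ?]; apply: measurable_funD; exact: measurable_funX. Qed.

Lemma measurable_normsqE f : cmeas f -> measurable_fun setT (fun t => (normsq (f t))%:E).
Proof. by move=> mf; apply/measurable_EFinP; exact: measurable_normsq. Qed.

Lemma cmeas_patch f (D : set T) : measurable D -> cmeas f ->
  cmeas (fun t => if t \in D then f t else 0).
Proof.
move=> mD [f1 f2]; have mI : measurable_fun setT (\1_D : T -> R) by exact: measurable_indic.
split.
  rewrite (_ : (fun t => _) = (fun t => complex.Re (f t) * \1_D t)); first exact: measurable_funM.
  by apply/funext => t; rewrite indicE; case: ifPn => _; rewrite ?mulr1 ?mulr0.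
rewrite (_ : (fun t => _) = (fun t => complex.Im (f t) * \1_D t)); first exact: measurable_funM.
by apply/funext => t; rewrite indicE; case: ifPn => _; rewrite ?mulr1 ?mulr0.
Qed.

Lemma eq_cint f g : f =1 g -> cint f = cint g.
Proof. by move=> fg; congr cint; apply/funext. Qed.

Lemma cintMr f z : cintegrable f -> cint (fun t => f t * z) = cint f * z.
Proof.
case: z => p q [f1 f2].
have iZ (h : T -> R) (c : R) : mu.-integrable setT (fun t => (h t)%:E) ->
    mu.-integrable setT (EFin \o (fun t => h t * c)).
  move=> ih; rewrite (_ : _ \o _ = (fun t => (h t)%:E * c%:E)%E); first exact: integrableZr.
  by apply/funext => t; rewrite /= EFinM.
apply/eqP; rewrite eq_complex/=; apply/andP; split; apply/eqP.
  rewrite -(RintegralZr _ measurableT f1) -(RintegralZr _ measurableT f2) -RintegralB//; [|exact: iZ|exact: iZ].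
  by apply: eq_Rintegral => t _; case: (f t).
rewrite -(RintegralZr _ measurableT f1) -(RintegralZr _ measurableT f2) -RintegralD//; [|exact: iZ|exact: iZ].
by apply: eq_Rintegral => t _; case: (f t).
Qed.

Lemma cintegrableMr f z : cintegrable f -> cintegrable (fun t => f t * z).
Proof.
case: z => p q [f1 f2]; split.
  rewrite (_ : (fun t => _) = ((fun t => (complex.Re (f t))%:E * p%:E) \- (fun t => (complex.Im (f t))%:E * q%:E))%E).
    by apply: integrableB => //; exact: integrableZr.
  by apply/funext => t; case: (f t).
rewrite (_ : (fun t => _) = ((fun t => (complex.Re (f t))%:E * q%:E) \+ (fun t => (complex.Im (f t))%:E * p%:E))%E).
  by apply: integrableD => //; exact: integrableZr.
by apply/funext => t; case: (f t).
Qed.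

Lemma cintegrableD f g : cintegrable f -> cintegrable g -> cintegrable (fun t => f t + g t).
Proof.
move=> [f1 f2] [g1 g2]; split.
  rewrite (_ : (fun t => _) = ((fun t => (complex.Re (f t))%:E) \+ (fun t => (complex.Re (g t))%:E))%E).
    exact: integrableD.
  by apply/funext => t; case: (f t) (g t) => [? ?] [].
rewrite (_ : (fun t => _) = ((fun t => (complex.Im (f t))%:E) \+ (fun t => (complex.Im (g t))%:E))%E).
  exact: integrableD.
by apply/funext => t; case: (f t) (g t) => [? ?] [].
Qed.

Lemma cintD f g : cintegrable f -> cintegrable g ->
  cint (fun t => f t + g t) = cint f + cint g.
Proof.
move=> [f1 f2] [g1 g2]; apply/eqP; rewrite eq_complex/=; apply/andP; split; apply/eqP.
  by rewrite -RintegralD//; apply: eq_Rintegral => t _; case: (f t) (g t) => ? ? [].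
by rewrite -RintegralD//; apply: eq_Rintegral => t _; case: (f t) (g t) => ? ? [].
Qed.

End cint.

(** * Parseval's identity on the line for complex functions *)

Section parseval1.
Context {R : realType}.
Notation leb := (@lebesgue_measure R).

Lemma ge0_integral_symmetric (g : R -> \bar R) : measurable_fun setT g ->
  (forall u, 0 <= g u)%E ->
  (\int[leb]_(u in setT) g u = \int[leb]_(u in `[0%R, +oo[) (g u + g (- (u : R))%R))%E.
Proof.
move=> mg g0.
have mgN : measurable_fun setT (fun u : R => g (- u)%R) by exact: measurableT_comp.
rewrite (@ge0_integralD _ (measurableTypeR R) R leb `[0%R, +oo[%classic) //.
- rewrite [X in (_ = _ + X)%E](ge0_integration_by_substitution0 mgN)//.
  under [X in (_ = _ + X)%E]eq_integral do rewrite opprK.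
  rewrite -(setTI setT) -[X in integral _ (X `&` _) _](_ : `[0%R, +oo[%classic `|` `]-oo, 0%R[%classic = setT :> set R).
    rewrite setIT ge0_integral_setU//.
    + congr (_ + _)%E; rewrite integral_itv_bndo_bndc//; exact: measurable_funTS.
    + exact: measurable_funTS.
    + by apply/disj_setPRL => x /=; rewrite !in_itv/= andbT leNgt => x0; apply/negP; rewrite negbK.
  by apply/seteqP; split => // x _ /=; rewrite !in_itv/= andbT; have [|] := leP 0 x; [left|right].
- exact: measurable_funTS.
- exact: measurable_funTS.
Qed.

Variables (f : R -> R[i]) (M N : R).
Hypotheses (mf : cmeas (f : measurableTypeR R -> R[i]))
  (fM : forall s, `|complex.Re (f s)| <= M /\ `|complex.Im (f s)| <= M)
  (fN : forall s, N < `|s| -> f s = 0) (N0 : 0 <= N).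

Definition FT1 (u : R) : R[i] := cint leb (fun s => f s * cexpi (- (2 * pi * (s * u)))).

Let a s := complex.Re (f s).
Let b s := complex.Im (f s).
Let aM s : `|a s| <= M. Proof. by have [] := fM s. Qed.
Let bM s : `|b s| <= M. Proof. by have [] := fM s. Qed.
Let aN s : N < `|s| -> a s = 0. Proof. by move=> /fN; rewrite /a => ->. Qed.
Let bN s : N < `|s| -> b s = 0. Proof. by move=> /fN; rewrite /b => ->. Qed.
Let ma : measurable_fun setT a. Proof. by case: mf. Qed.
Let mb : measurable_fun setT b. Proof. by case: mf. Qed.

Lemma FT1E u : FT1 u = Complex (coscoef a u + sincoef b u) (coscoef b u - sincoef a u).
Proof.
apply/eqP; rewrite eq_complex/=; apply/andP; split; apply/eqP.
  rewrite /coscoef /sincoef -RintegralD; [|by []|exact: (integrable_coscoef ma aM aN)|exact: (integrable_sincoef mb bM bN)].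
  apply: eq_Rintegral => s _; rewrite -[2 * pi * s * u]mulrA; rewrite /a /b.
  by case: (f s) => x y; rewrite /= cosN sinN; ring.
rewrite /coscoef /sincoef -RintegralB; [|by []|exact: (integrable_coscoef mb bM bN)|exact: (integrable_sincoef ma aM aN)].
apply: eq_Rintegral => s _; rewrite -[2 * pi * s * u]mulrA; rewrite /a /b.
by case: (f s) => x y; rewrite /= cosN sinN; ring.
Qed.

(** The real and imaginary parts of f interact only through terms odd in u. These cancel when u is
    paired with -u, and [parseval_real] for each part remains. *)
Lemma parseval1 :
  (\int[leb]_u (normsq (FT1 u))%:E = \int[leb]_s (normsq (f s))%:E)%E.
Proof.
have cN g u : coscoef g (- u) = coscoef g u.
  by apply: eq_Rintegral => s _; rewrite mulrN cosN.
have sN g u : leb.-integrable setT (fun s => (g s * sin (2 * pi * s * u))%:E) ->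
    sincoef g (- u) = - sincoef g u.
  move=> ig; rewrite -[RHS]mulN1r /sincoef -(RintegralZl _ measurableT ig).
  by apply: eq_Rintegral => s _; rewrite mulrN sinN mulrN mulN1r.
have sa u := sN a u (integrable_sincoef ma aM aN u).
have sb u := sN b u (integrable_sincoef mb bM bN u).
have msq : measurable_fun setT (fun u => (normsq (FT1 u))%:E).
  rewrite (_ : (fun u => _) = (fun u => ((coscoef a u + sincoef b u) ^+ 2 + (coscoef b u - sincoef a u) ^+ 2)%:E)).
    apply/measurable_EFinP; apply: measurable_funD; apply: measurable_funX.
      by apply: measurable_funD; [exact: measurable_coscoef|exact: measurable_sincoef].
    by apply: measurable_funB; [exact: measurable_coscoef|exact: measurable_sincoef].
  by apply/funext => u; rewrite FT1E.
rewrite ge0_integral_symmetric//; last by move=> u; rewrite lee_fin normsq_ge0.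
have pa := parseval_real ma aM aN N0; have pb := parseval_real mb bM bN N0.
have mpa := measurable_power ma; have mpb := measurable_power mb.
have p0 g u : 0 <= coscoef g u ^+ 2 + sincoef g u ^+ 2 by rewrite addr_ge0// sqr_ge0.
transitivity (\int[leb]_(u in `[0%R, +oo[) (2%:E * (coscoef a u ^+ 2 + sincoef a u ^+ 2)%:E + 2%:E * (coscoef b u ^+ 2 + sincoef b u ^+ 2)%:E))%E.
  by apply: eq_integral => u _; rewrite !FT1E /normsq/= !cN sa sb -!EFinM -!EFinD; congr EFin; ring.
have m2 (h : R -> R) (A : set R) : measurable_fun setT h -> measurable_fun A (fun u => (h u)%:E).
  by move=> mh; apply/measurable_EFinP; exact: measurable_funTS.
rewrite ge0_integralD//=.
- rewrite !ge0_integralZl//=.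
  + rewrite pa pb !muleA -!EFinM mulfV// !mul1e -ge0_integralD//.
    1,3: by move=> s _; rewrite lee_fin sqr_ge0.
    1: exact: (m2 (fun s => a s ^+ 2) setT (measurable_funX _ ma)).
    exact: (m2 (fun s => b s ^+ 2) setT (measurable_funX _ mb)).
  + exact: m2.
  + by move=> u _; rewrite lee_fin p0.
  + exact: m2.
  + by move=> u _; rewrite lee_fin p0.
- by move=> u _; rewrite -EFinM lee_fin mulr_ge0// p0.
- by apply: emeasurable_funM; [exact: measurable_cst|exact: m2].
- by move=> u _; rewrite -EFinM lee_fin mulr_ge0// p0.
- by apply: emeasurable_funM; [exact: measurable_cst|exact: m2].
Qed.

End parseval1.

(** * Tonelli and Fubini for the coordinates of R^n *)

Section lebesgue_rV_theory.
Context {R : realType}.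
Notation leb := (@lebesgue_measure R).
Notation mr := (measurableTypeR R).
Notation lrV := (lebesgue_rV R).

Lemma cons_rV0 n (a : R) (v : 'rV[mr]_n) : cons_rV (a : mr, v) ord0 ord0 = a.
Proof. by have := cons_rVK (a : mr, v) => -[]. Qed.

Lemma cons_rVS n (a : R) (v : 'rV[mr]_n) i :
  cons_rV (a : mr, v) ord0 (lift ord0 i) = v ord0 i.
Proof.
rewrite (_ : lift ord0 i = rshift 1 i); last exact/val_inj.
exact: (row_mxEr (const_mx a : 'rV_1) v ord0 i).
Qed.

Lemma dotv_cons n (s u0 : R) (v u : 'rV[R]_n) :
  dotv (cons_rV (s : mr, v : 'rV[mr]_n) : 'rV[R]_n.+1)
       (cons_rV (u0 : mr, u : 'rV[mr]_n) : 'rV[R]_n.+1) = s * u0 + dotv v u.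
Proof.
rewrite /dotv big_ord_recl !cons_rV0; congr (_ + _).
by apply: eq_bigr => i _; rewrite !cons_rVS.
Qed.

Definition product_rV n : {measure set (mr * 'rV[mr]_n)%type -> \bar R} :=
  (leb \x lrV n)%E.

(** By construction this is the measure of R^(n+1) ([pushE]); in bundled form it allows change of
    variables along [cons_rV]. *)
Let push n : {measure set 'rV[mr]_n.+1 -> \bar R}.
Proof.
unshelve refine (pushforward (product_rV n) (@cons_rV _ mr n) : {measure set _ -> \bar R}).
exact: measurable_cons_rV.
Defined.

Let pushE n A : lrV n.+1 A = push n A. Proof. by []. Qed.

Lemma ge0_integral_rVS_prod n (f : 'rV[mr]_n.+1 -> \bar R) :
  measurable_fun setT f -> (forall t, 0 <= f t)%E ->
  (\int[lrV n.+1]_t f t = \int[product_rV n]_p f (cons_rV p))%E.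
Proof.
move=> mf f0; rewrite (@eq_measure_integral _ _ _ _ (push n))//.
by rewrite ge0_integral_pushforward//; exact: measurable_cons_rV.
Qed.

Lemma ge0_integral_rVS n (f : 'rV[mr]_n.+1 -> \bar R) :
  measurable_fun setT f -> (forall t, 0 <= f t)%E ->
  (\int[lrV n.+1]_t f t = \int[leb]_s \int[lrV n]_v f (cons_rV (s, v)))%E.
Proof.
move=> mf f0; rewrite ge0_integral_rVS_prod//.
rewrite /product_rV fubini_tonelli1//.
by apply: measurableT_comp => //; exact: measurable_cons_rV.
Qed.

Lemma ge0_integral_rVS_swap n (f : 'rV[mr]_n.+1 -> \bar R) :
  measurable_fun setT f -> (forall t, 0 <= f t)%E ->
  (\int[lrV n.+1]_t f t = \int[lrV n]_v \int[leb]_s f (cons_rV (s, v)))%E.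
Proof.
move=> mf f0; rewrite ge0_integral_rVS_prod//.
rewrite /product_rV fubini_tonelli2//.
by apply: measurableT_comp => //; exact: measurable_cons_rV.
Qed.

Lemma integrable_rVS n (f : 'rV[mr]_n.+1 -> \bar R) :
  (lrV n.+1).-integrable setT f ->
  (product_rV n).-integrable setT (fun p => f (cons_rV p)).
Proof.
move=> /integrableP[mf foo]; apply/integrableP; split.
  by apply: measurableT_comp => //; exact: measurable_cons_rV.
rewrite -(ge0_integral_rVS_prod (f := fun t => `|f t|%E))//.
exact: measurableT_comp.
Qed.

Lemma integral_rVS_swap n (f : 'rV[mr]_n.+1 -> \bar R) :
  (lrV n.+1).-integrable setT f ->
  (\int[lrV n.+1]_t f t = \int[lrV n]_v \int[leb]_s f (cons_rV (s, v)))%E.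
Proof.
move=> intf; have mf : measurable_fun setT f by exact: measurable_int intf.
have ic := integrable_rVS intf.
rewrite (@eq_measure_integral _ _ _ _ (push n))//.
apply: etrans (@integral_pushforward _ _ _ _ R _ (@measurable_cons_rV _ mr n) (product_rV n) setT f mf ic measurableT) _.
exact/esym/(integral21_prod_meas1 ic).
Qed.

Lemma measurable_dotv d1 (T : measurableType d1) n (f g : T -> 'rV[mr]_n) :
  measurable_fun setT f -> measurable_fun setT g ->
  measurable_fun setT (fun p => dotv (f p : 'rV[R]_n) (g p : 'rV[R]_n) : R).
Proof.
move=> mf mg; apply: measurable_sum => i.
by apply: measurable_funM; exact: (measurableT_comp (measurable_coord i)).
Qed.

Lemma cubeE n (N : nat) : @cube R n N = [set t | forall i, `[(- N%:R)%R, N%:R]%classic (t ord0 i)].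
Proof. by apply/seteqP; split => t /= tN i; have := tN i; rewrite /= in_itv/= ler_norml. Qed.

Lemma measurable_rV_box n (A : 'I_n -> set R) : (forall i, measurable (A i)) ->
  measurable ([set t | forall i, A i (t ord0 i)] : set 'rV[mr]_n).
Proof.
move=> mA.
have H : measurable (\bigcap_(i in [set: 'I_n]) ((fun t : 'rV[mr]_n => t ord0 i) @^-1` A i)).
  apply: fin_bigcap_measurable => // i _.
  by rewrite -[X in measurable X]setTI; apply: measurable_coord => //; exact: mA.
apply: (eq_ind _ measurable H).
by apply/seteqP; split => t /= tA i; [|move=> _]; exact: tA.
Qed.

Lemma measurable_cube n (N : nat) : measurable (@cube R n N : set 'rV[mr]_n).
Proof. by rewrite cubeE; apply: (@measurable_rV_box n (fun=> `[(- N%:R)%R, N%:R]%classic)) => i; exact: measurable_itv. Qed.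

Lemma lebesgue_cube_lty n (N : nat) : (lrV n (@cube R n N) < +oo)%E.
Proof.
rewrite cubeE (@lebesgue_rV_box R n (fun=> `[(- N%:R)%R, N%:R]%classic)); last by move=> i; exact: measurable_itv.
rewrite -ge0_fin_numE; last first.
  by apply: prode_ge0 => i _; exact: measure_ge0.
apply: (big_ind (fun x => x \is a fin_num)) => //.
  by move=> x y; exact: fin_numM.
by move=> i _; rewrite lebesgue_measure_itv/=; case: ifP.
Qed.

End lebesgue_rV_theory.

Lemma lebesgue_segment_lty {R : realType} (c : R) :
  (@lebesgue_measure R `[(- c)%R, c]%classic < +oo)%E.
Proof. by rewrite lebesgue_measure_itv/=; case: ifP => _; rewrite ?ltry// -EFinB ltry. Qed.

(** * The isometry on R^n for bounded functions of compact support *)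

Section FT.
Context {R : realType}.
Notation leb := (@lebesgue_measure R).
Notation mr := (measurableTypeR R).
Notation lrV := (lebesgue_rV R).

Definition phase n (t u : 'rV[R]_n) : R[i] := cexpi (- (2 * pi * dotv t u)).

Definition FT n (f : 'rV[R]_n -> R[i]) (u : 'rV[R]_n) : R[i] :=
  cint (lrV n) (fun t => f t * phase t u).

Lemma cmeas_comp d1 d2 (T1 : measurableType d1) (T2 : measurableType d2)
    (f : T2 -> R[i]) (g : T1 -> T2) :
  cmeas f -> measurable_fun setT g -> cmeas (fun t => f (g t)).
Proof. by move=> [f1 f2] mg; split; [exact: (measurableT_comp f1 mg)|exact: (measurableT_comp f2 mg)]. Qed.

Lemma cmeas_phase d1 (T : measurableType d1) n (f g : T -> 'rV[mr]_n) :
  measurable_fun setT f -> measurable_fun setT g ->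
  cmeas (fun p => phase (f p : 'rV[R]_n) (g p : 'rV[R]_n)).
Proof.
move=> mf mg; apply: cmeas_cexpi; apply: measurableT_comp => //.
by apply: measurable_funM => //; exact: measurable_dotv.
Qed.

Lemma cmeas_cint_prod d1 d2 (T1 : measurableType d1) (T2 : measurableType d2)
    (m2 : {sigma_finite_measure set T2 -> \bar R}) (f : T1 * T2 -> R[i]) :
  cmeas f -> cmeas (fun x => cint m2 (fun y => f (x, y))).
Proof.
move=> [f1 f2]; split.
  exact: (measurable_fun_Rintegral_prod m2 f1).
exact: (measurable_fun_Rintegral_prod m2 f2).
Qed.

Lemma cmeas_FT n (f : 'rV[mr]_n -> R[i]) : cmeas f -> cmeas (FT f : 'rV[mr]_n -> R[i]).
Proof.
move=> mf; apply: (@cmeas_cint_prod _ _ 'rV[mr]_n 'rV[mr]_n (lrV n) (fun p => f p.2 * phase p.2 p.1)).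
by apply: cmeasM; [exact: cmeas_comp|exact: cmeas_phase].
Qed.

Definition bounded_supp n (M : R) (N : nat) (f : 'rV[R]_n -> R[i]) :=
  [/\ cmeas (f : 'rV[mr]_n -> R[i]),
      forall t, `|complex.Re (f t)| <= M /\ `|complex.Im (f t)| <= M &
      forall t, ~ cube N t -> f t = 0].

Lemma normsq_phase n (t u : 'rV[R]_n) : normsq (phase t u) = 1.
Proof. exact: normsq_cexpi. Qed.

Lemma bounded_suppM n M N (f : 'rV[R]_n -> R[i]) (u : 'rV[R]_n) : bounded_supp M N f ->
  bounded_supp (2 * M) N (fun t => f t * phase t u).
Proof.
move=> [mf fM fN]; split.
- apply: cmeasM => //; apply: (@cmeas_phase _ 'rV[mr]_n n id (fun=> u)) => //.
- by move=> t; have [? ?] := fM t; apply: ReM_le => //; exact: normsq_phase.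
- by move=> t /fN ->; rewrite mul0r.
Qed.

Lemma bounded_supp_cintegrable n M N (f : 'rV[R]_n -> R[i]) : bounded_supp M N f ->
  cintegrable (lrV n) f.
Proof.
move=> [[m1 m2] fM fN].
have h (g : 'rV[mr]_n -> R) : measurable_fun setT g -> (forall t, `|g t| <= M) ->
    (forall t, ~ cube N t -> g t = 0) -> (lrV n).-integrable setT (EFin \o g).
  move=> mg gM gN; apply: (@integrable_bounded_supp _ 'rV[mr]_n R (lrV n) (cube N) M g) => //.
  - exact: measurable_cube.
  - exact: lebesgue_cube_lty.
  - move=> t; rewrite indicE; have [_|] := boolP (t \in cube N).
      by rewrite mulr1; exact: gM.
    by rewrite notin_setE => /gN ->; rewrite normr0 mulr0.
split.
  by apply: (h (fun t => complex.Re (f t))) => // t; [have [] := fM t|move=> /fN ->].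
by apply: (h (fun t => complex.Im (f t))) => // t; [have [] := fM t|move=> /fN ->].
Qed.


Lemma cube_cons n (N : nat) (s : R) (v : 'rV[R]_n) :
  cube N (cons_rV (s : mr, v : 'rV[mr]_n) : 'rV[R]_n.+1) <-> `|s| <= N%:R /\ cube N v.
Proof.
split => [H|[sN vN] i].
  split; first by have := H ord0; rewrite cons_rV0.
  by move=> i; have := H (lift ord0 i); rewrite cons_rVS.
by case: (unliftP ord0 i) => [j|] ->; rewrite ?cons_rV0// cons_rVS.
Qed.

Section slice.
Variables (n : nat) (M : R) (N : nat) (f : 'rV[R]_n.+1 -> R[i]).
Hypothesis bf : bounded_supp M N f.

Let slice (v : 'rV[R]_n) (s : R) : R[i] := f (cons_rV (s : mr, v : 'rV[mr]_n)).

Lemma slice_cmeas v : cmeas (slice v : mr -> R[i]).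
Proof.
have [mf _ _] := bf.
apply: (@cmeas_comp _ _ mr 'rV[mr]_n.+1 f (fun s => cons_rV (s, v : 'rV[mr]_n)) mf).
by apply: measurableT_comp; [exact: measurable_cons_rV|exact: measurable_pair2].
Qed.

Lemma slice_bound v s : `|complex.Re (slice v s)| <= M /\ `|complex.Im (slice v s)| <= M.
Proof. by have [_ fM _] := bf; exact: fM. Qed.

Lemma slice_supp v s : N%:R < `|s| -> slice v s = 0.
Proof.
have [_ _ fN] := bf => sN; apply: fN => /cube_cons[sN' _].
by move: sN; rewrite ltNge sN'.
Qed.

Lemma slice_cintegrable v (u0 : R) :
  cintegrable leb (fun s => slice v s * cexpi (- (2 * pi * (s * u0)))).
Proof.
have [mf fM fN] := bf.
have cm : cmeas (fun s : mr => slice v s * cexpi (- (2 * pi * (s * u0)))).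
  apply: cmeasM; first exact: slice_cmeas.
  apply: cmeas_cexpi; apply: measurableT_comp => //; apply: measurable_funM => //.
  by apply: measurable_funM.
have cb s := ReM_le (slice_bound v s).1 (slice_bound v s).2 (normsq_cexpi (- (2 * pi * (s * u0)))).
have h (g : mr -> R) : measurable_fun setT g -> (forall t, `|g t| <= 2 * M) ->
    (forall t, N%:R < `|t| -> g t = 0) -> leb.-integrable setT (EFin \o g).
  move=> mg gM gN.
  apply: (@integrable_bounded_supp _ mr R leb `[(- N%:R)%R, N%:R]%classic (2 * M) g (measurable_itv _) (lebesgue_segment_lty _) mg).
  move=> t; rewrite indicE; have [_|] := boolP (t \in _).
    by rewrite mulr1; exact: gM.
  rewrite notin_setE/= in_itv/= -ler_norml => /negP; rewrite -ltNge => /gN ->.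
  by rewrite normr0 mulr0.
case: cm => cm1 cm2; split.
  apply: (h _ cm1) => t; first by have [] := cb t.
  by move=> /(slice_supp v) ->; rewrite mul0r.
apply: (h _ cm2) => t; first by have [] := cb t.
by move=> /(slice_supp v) ->; rewrite mul0r.
Qed.

Definition partialFT (u0 : R) (v : 'rV[R]_n) : R[i] := FT1 (slice v) u0.

Lemma cmeas_partialFT2 :
  cmeas (fun p : mr * 'rV[mr]_n => partialFT p.1 (p.2 : 'rV[R]_n)).
Proof.
have [mf _ _] := bf.
apply: (@cmeas_cint_prod _ _ (mr * 'rV[mr]_n)%type mr leb
  (fun q => f (cons_rV (q.2, q.1.2)) * cexpi (- (2 * pi * (q.2 * q.1.1))))).
apply: cmeasM.
  apply: cmeas_comp => //; apply: measurableT_comp; first exact: measurable_cons_rV.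
  apply/measurable_fun_pairP; split; first exact: (@measurable_snd _ _ (mr * 'rV[mr]_n)%type mr).
  exact: (measurableT_comp (@measurable_snd _ _ mr 'rV[mr]_n) (@measurable_fst _ _ (mr * 'rV[mr]_n)%type mr)).
apply: cmeas_cexpi; apply: measurableT_comp => //; apply: measurable_funM => //.
apply: measurable_funM; first exact: (@measurable_snd _ _ (mr * 'rV[mr]_n)%type mr).
exact: (measurableT_comp (@measurable_fst _ _ mr 'rV[mr]_n) (@measurable_fst _ _ (mr * 'rV[mr]_n)%type mr)).
Qed.

(** This is what lets the induction on the dimension run: for each first frequency the transform in
    the first coordinate is again bounded and supported in the same cube. The bound is that of the
    integrand times the length of the interval. *)
Lemma partialFT_bounded_supp (u0 : R) : exists M', bounded_supp M' N (partialFT u0).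
Proof.
have [mf fM fN] := bf.
have M0 : 0 <= M by have [h _] := fM 0; rewrite (le_trans _ h).
set I : set R := `[(- N%:R)%R, N%:R]%classic.
exists (2 * M * fine (leb I)); split.
- apply: (@cmeas_comp _ _ _ _ _ (fun v : 'rV[mr]_n => (u0 : mr, v)) cmeas_partialFT2).
  exact: measurable_pair1.
- move=> v; have [i1 i2] := slice_cintegrable v u0.
  have Ioo : (leb I < +oo)%E by exact: lebesgue_segment_lty.
  have iI : leb.-integrable setT (fun s => (\1_I s)%:E).
    by apply: (@integrable_indic_lty _ mr R leb) => //; exact: measurable_itv.
  have cb s := ReM_le (slice_bound v s).1 (slice_bound v s).2 (normsq_cexpi (- (2 * pi * (s * u0)))).
  have h (g : R -> R) : leb.-integrable setT (fun s => (g s)%:E) ->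
      (forall s, `|g s| <= 2 * M) -> (forall s, N%:R < `|s| -> g s = 0) ->
      `|\int[leb]_s g s| <= 2 * M * fine (leb I).
    move=> ig gM gN; apply: (le_trans (le_normr_Rintegral _ ig)) => //.
    have -> : fine (leb I) = \int[leb]_s \1_I s.
      by congr fine; apply/esym; apply: etrans (integral_indic _ _ _) _; rewrite ?setIT//; exact: measurable_itv.
    rewrite -(RintegralZl _ measurableT iI); apply: le_Rintegral => //.
    + exact: integrable_norm ig.
    + by apply: (@integrableZl _ mr R leb setT measurableT (2 * M) _ iI).
    + move=> s _; rewrite indicE; have [_|] := boolP (s \in _); first by rewrite mulr1; exact: gM.
      rewrite notin_setE /I/= in_itv/= -ler_norml => /negP; rewrite -ltNge => /gN ->.
      by rewrite normr0 mulr0.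
  split.
    apply: h i1 _ _ => s; first by have [] := cb s.
    by move=> /(slice_supp v) ->; rewrite mul0r.
  apply: h i2 _ _ => s; first by have [] := cb s.
  by move=> /(slice_supp v) ->; rewrite mul0r.
- move=> v vN; rewrite /partialFT /FT1.
  have -> : (fun s => slice v s * cexpi (- (2 * pi * (s * u0)))) = (fun=> 0).
    by apply/funext => s; rewrite /slice fN ?mul0r// => /cube_cons[].
  by rewrite /cint /Rintegral/= integral0.
Qed.

(** The phase is a product over the coordinates, so Fubini performs the first integration inside the
    others. *)
Lemma FT_cons (u0 : R) (u : 'rV[R]_n) :
  FT f (cons_rV (u0 : mr, u : 'rV[mr]_n)) = FT (partialFT u0) u.
Proof.
have bF := bounded_suppM (cons_rV (u0 : mr, u : 'rV[mr]_n)) bf.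
have [iF1 iF2] := bounded_supp_cintegrable bF.
have E v s : f (cons_rV (s : mr, v)) * phase (cons_rV (s : mr, v : 'rV[mr]_n)) (cons_rV (u0 : mr, u : 'rV[mr]_n))
   = slice v s * cexpi (- (2 * pi * (s * u0))) * phase v u.
  by rewrite -mulrA -cexpiD /phase dotv_cons mulrDr opprD.
have key (v : 'rV[R]_n) : cint leb (fun s => f (cons_rV (s : mr, v : 'rV[mr]_n)) * phase (cons_rV (s : mr, v : 'rV[mr]_n)) (cons_rV (u0 : mr, u : 'rV[mr]_n)))
    = partialFT u0 v * phase v u.
  by under eq_cint do rewrite E; rewrite cintMr//; exact: slice_cintegrable.
have ci v : cintegrable leb (fun s => f (cons_rV (s : mr, v : 'rV[mr]_n)) * phase (cons_rV (s : mr, v : 'rV[mr]_n)) (cons_rV (u0 : mr, u : 'rV[mr]_n))).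
  rewrite (_ : (fun s => _) = (fun s => slice v s * cexpi (- (2 * pi * (s * u0))) * phase v u)); last by apply/funext => s; rewrite E.
  by apply: cintegrableMr; exact: slice_cintegrable.
apply/eqP; rewrite eq_complex; apply/andP; split; apply/eqP.
  change (\int[lrV n.+1]_t complex.Re (f t * phase t (cons_rV (u0 : mr, u : 'rV[mr]_n)))
    = \int[lrV n]_v complex.Re (partialFT u0 v * phase v u)).
  rewrite /Rintegral (integral_rVS_swap iF1); congr fine; apply: eq_integral => v _.
  rewrite -key /cint [X in _ = X%:E]/= /Rintegral fineK//.
  by apply: integrable_fin_num => //; have [] := ci v.
change (\int[lrV n.+1]_t complex.Im (f t * phase t (cons_rV (u0 : mr, u : 'rV[mr]_n)))
    = \int[lrV n]_v complex.Im (partialFT u0 v * phase v u)).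
rewrite /Rintegral (integral_rVS_swap iF2); congr fine; apply: eq_integral => v _.
rewrite -key /cint [X in _ = X%:E]/= /Rintegral fineK//.
by apply: integrable_fin_num => //; have [] := ci v.
Qed.

End slice.

(** Induction on n. For each u0 the induction hypothesis applies to [partialFT f u0]; Tonelli then
    exchanges u0 with the remaining coordinates, and [parseval1] applies on every slice. In
    dimension 0 the measure is a point mass and the phase has modulus 1. *)
Theorem isometry_bounded n M N (f : 'rV[R]_n -> R[i]) : bounded_supp M N f ->
  (\int[lrV n]_u (normsq (FT f u))%:E = \int[lrV n]_t (normsq (f t))%:E)%E.
Proof.
elim: n M f => [|n IHn] M f bf; have [mf fM fN] := bf.
  have mF := measurable_normsqE (cmeas_FT mf); have mq := measurable_normsqE mf.
  have r0 (u : 'rV[R]_0) : u = 0 by apply/rowP; case.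
  apply: eq_integral => u _; congr EFin; rewrite [in RHS](r0 u).
  transitivity (normsq (f 0 * phase 0 u)); last by rewrite normsqM normsq_phase mulr1.
  have [mg1 mg2] : cmeas (fun t : 'rV[mr]_0 => f t * phase t u).
    by apply: cmeasM => //; exact: (@cmeas_phase _ _ _ id (fun=> u)).
  congr normsq; rewrite /FT /cint /Rintegral.
  rewrite !integral_dirac//; try exact/measurable_EFinP.
  by rewrite diracT !mul1e; case: (f 0 * phase 0 u).
have mq (g : 'rV[mr]_n.+1 -> R[i]) : cmeas g -> measurable_fun setT (fun u => (normsq (g u))%:E).
  exact: measurable_normsqE.
rewrite ge0_integral_rVS; [|by apply: mq; exact: cmeas_FT|by move=> t; rewrite lee_fin normsq_ge0].
transitivity (\int[leb]_u0 \int[lrV n]_v (normsq (partialFT f u0 v))%:E)%E.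
  apply: eq_integral => u0 _; have [M' bP] := partialFT_bounded_supp bf u0.
  rewrite -(IHn M' _ bP); apply: eq_integral => u _.
  by rewrite (FT_cons bf).
have mP := measurable_normsqE (cmeas_partialFT2 bf).
rewrite (fubini_tonelli _ mP); last by move=> p; rewrite lee_fin normsq_ge0.
rewrite ge0_integral_rVS_swap; [|exact: mq|by move=> t; rewrite lee_fin normsq_ge0].
apply: eq_integral => v _.
exact: (parseval1 (slice_cmeas bf v) (slice_bound bf v) (slice_supp bf v)).
Qed.

End FT.

(** * The Hilbert space L2: Cauchy-Schwarz, limits, completeness *)

(** For c > 0 evaluate at the minimizer s = b / c. For c <= 0 some s makes the polynomial negative
    unless b = c = 0. *)
Lemma discriminant_le (R : realType) (a b c : R) :
  (forall s, 0 <= a - 2 * s * b + s ^+ 2 * c) -> b ^+ 2 <= a * c.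
Proof.
move=> H; have a0 : 0 <= a by have := H 0; rewrite mulr0 mul0r expr0n mul0r subr0 addr0.
have [c0|c0] := ltP 0 c.
  have := H (b / c); rewrite (_ : _ + _ = a - b ^+ 2 / c); last by field; rewrite gt_eqF.
  by rewrite subr_ge0 ler_pdivrMr.
have [b00|b0] := eqVneq b 0.
  rewrite b00 in H *; rewrite expr0n/=.
  have c00 : c = 0.
    apply/eqP; rewrite eq_le c0 leNgt; apply/negP => cl0.
    have := H (Num.sqrt ((a + 1) / - c)); rewrite mulr0 subr0 sqr_sqrtr; last first.
      by rewrite divr_ge0 ?oppr_ge0// addr_ge0.
    rewrite (_ : _ + _ = -1); last by field; rewrite ?oppr_eq0 lt_eqF.
    by rewrite lerNr oppr0 ler10.
  by rewrite c00 mulr0.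
have := H ((a + 1) / (2 * b)); rewrite (_ : _ - _ = -1); last by field.
set s2 := _ ^+ 2 => h; have : s2 * c <= 0 by rewrite mulr_ge0_le0// sqr_ge0.
lra.
Qed.

Section ccvg.
Context {R : realType}.

Definition ccvg (u : nat -> R[i]) (z : R[i]) : Prop :=
  (complex.Re (u n) @[n --> \oo] --> complex.Re z) /\
  (complex.Im (u n) @[n --> \oo] --> complex.Im z).

Lemma ccvg_normsq u z : ccvg u z -> normsq (u n) @[n --> \oo] --> normsq z.
Proof. by move=> [u1 u2]; apply: cvgD; under eq_fun do rewrite expr2; rewrite expr2; exact: cvgM. Qed.

Lemma ccvgB u v z w : ccvg u z -> ccvg v w -> ccvg (fun n => u n - v n) (z - w).
Proof.
move=> [u1 u2] [v1 v2]; split.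
  rewrite (_ : (fun n => _) = (fun n => complex.Re (u n) - complex.Re (v n))); last by apply/funext => n; case: (u n) (v n) => ? ? [].
  by rewrite (_ : complex.Re _ = complex.Re z - complex.Re w); [exact: cvgB|case: z w {u1 u2 v1 v2} => ? ? []].
rewrite (_ : (fun n => _) = (fun n => complex.Im (u n) - complex.Im (v n))); last by apply/funext => n; case: (u n) (v n) => ? ? [].
by rewrite (_ : complex.Im _ = complex.Im z - complex.Im w); [exact: cvgB|case: z w {u1 u2 v1 v2} => ? ? []].
Qed.

Lemma ccvgM u v z w : ccvg u z -> ccvg v w -> ccvg (fun n => u n * v n) (z * w).
Proof.
move=> [u1 u2] [v1 v2]; split.
  rewrite (_ : (fun k => _) = (fun k => complex.Re (u k) * complex.Re (v k) - complex.Im (u k) * complex.Im (v k))); last by apply/funext => k; case: (u k) (v k) => ? ? [].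
  rewrite (_ : complex.Re (z * w) = complex.Re z * complex.Re w - complex.Im z * complex.Im w); last by case: z w {u1 u2 v1 v2} => ? ? [].
  by apply: cvgB; exact: cvgM.
rewrite (_ : (fun k => _) = (fun k => complex.Re (u k) * complex.Im (v k) + complex.Im (u k) * complex.Re (v k))); last by apply/funext => k; case: (u k) (v k) => ? ? [].
rewrite (_ : complex.Im (z * w) = complex.Re z * complex.Im w + complex.Im z * complex.Re w); last by case: z w {u1 u2 v1 v2} => ? ? [].
by apply: cvgD; exact: cvgM.
Qed.

Lemma ccvg_cst z : ccvg (fun=> z) z.
Proof. by split; exact: cvg_cst. Qed.

End ccvg.

Section L2.
Context d (T : measurableType d) {R : realType}.
Variable mu : {measure set T -> \bar R}.
Implicit Types f g h : T -> R[i].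

Definition N2 f : \bar R := (\int[mu]_t (normsq (f t))%:E)%E.
Definition L2 f : Prop := cmeas f /\ (N2 f < +oo)%E.
(** The square of the L2 norm as a real number; it carries information only on [L2], where [nnK]
    holds. *)
Definition nn f : R := fine (N2 f).
(** The real part of the Hermitian inner product, the form that polarizes [nn] (see [nnB]). *)
Definition ip f g : R :=
  \int[mu]_t (complex.Re (f t) * complex.Re (g t) + complex.Im (f t) * complex.Im (g t)).

Lemma N2_ge0 f : (0 <= N2 f)%E.
Proof. by apply: integral_ge0 => t _; rewrite lee_fin normsq_ge0. Qed.

Lemma nn_ge0 f : 0 <= nn f.
Proof. by rewrite fine_ge0// N2_ge0. Qed.

Lemma N2_fin f : L2 f -> N2 f \is a fin_num.
Proof. by move=> [_ foo]; rewrite ge0_fin_numE// N2_ge0. Qed.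

Lemma nnK f : L2 f -> (nn f)%:E = N2 f.
Proof. by move=> /N2_fin f2; rewrite fineK. Qed.

Lemma L2_le f g : cmeas f -> L2 g -> (forall t, normsq (f t) <= normsq (g t)) -> L2 f /\ nn f <= nn g.
Proof.
move=> mf Lg fg; have [mg goo] := Lg.
have le : (N2 f <= N2 g)%E.
  apply: ge0_le_integral => //; try exact: measurable_normsqE.
  - by move=> t _; rewrite lee_fin normsq_ge0.
  - by move=> t _; rewrite lee_fin.
have Lf : L2 f by split => //; exact: le_lt_trans goo.
by split => //; rewrite -lee_fin !nnK.
Qed.

Lemma normsq_integrable f : L2 f -> mu.-integrable setT (fun t => (normsq (f t))%:E).
Proof.
move=> [mf foo]; apply/integrableP; split; first exact: measurable_normsqE.
by under eq_integral do rewrite gee0_abs ?lee_fin ?normsq_ge0//.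
Qed.

(** Serves as triangle inequality for squared norms; the constant 2 is harmless in limits. *)
Lemma normsqD_le (z w : R[i]) : normsq (z + w) <= 2 * normsq z + 2 * normsq w.
Proof.
case: z w => a b [c e]; rewrite /normsq/= -subr_ge0.
rewrite (_ : _ - _ = (a - c) ^+ 2 + (b - e) ^+ 2); last by ring.
by rewrite addr_ge0// sqr_ge0.
Qed.

Lemma normsqN (z : R[i]) : normsq (- z) = normsq z.
Proof. by case: z => a b; rewrite /normsq/= !sqrrN. Qed.

Lemma L2D f g : L2 f -> L2 g -> L2 (fun t => f t + g t).
Proof.
move=> Lf Lg; have [mf foo] := Lf; have [mg goo] := Lg.
have mfg := cmeasD mf mg; split => //.
apply: (@le_lt_trans _ _ (\int[mu]_t (2%:E * (normsq (f t))%:E + 2%:E * (normsq (g t))%:E))%E).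
  apply: ge0_le_integral => //.
  - by move=> t _; rewrite lee_fin normsq_ge0.
  - exact: measurable_normsqE.
  - by apply: emeasurable_funD; apply: emeasurable_funM => //; exact: measurable_normsqE.
  - by move=> t _; rewrite -!EFinM -EFinD lee_fin normsqD_le.
have i1 := integrableZl measurableT 2 (normsq_integrable Lf).
have i2 := integrableZl measurableT 2 (normsq_integrable Lg).
by apply: integrable_lty => //; exact: integrableD.
Qed.

Lemma L2N f : L2 f -> L2 (fun t => - f t).
Proof.
move=> [mf foo]; split; first exact: cmeasN.
by rewrite /N2; under eq_integral do rewrite normsqN.
Qed.

Lemma L2B f g : L2 f -> L2 g -> L2 (fun t => f t - g t).
Proof. by move=> Lf Lg; apply: L2D => //; exact: L2N. Qed.

Lemma ip_integrable f g : L2 f -> L2 g ->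
  mu.-integrable setT (fun t => (complex.Re (f t) * complex.Re (g t) + complex.Im (f t) * complex.Im (g t))%:E).
Proof.
move=> Lf Lg; have [[f1 f2] _] := Lf; have [[g1 g2] _] := Lg.
have iD := integrableD measurableT (normsq_integrable Lf) (normsq_integrable Lg).
apply: (@le_integrable _ _ _ mu setT measurableT _ _ _ _ iD).
  by apply/measurable_EFinP; apply: measurable_funD; exact: measurable_funM.
move=> t _; have n0 := addr_ge0 (normsq_ge0 (f t)) (normsq_ge0 (g t)).
rewrite /= lee_fin (ger0_norm n0) {n0}.
case: (f t) (g t) => a b [c e]; rewrite /normsq/=.
have h (x y : R) : 2 * `|x * y| <= x ^+ 2 + y ^+ 2.
  rewrite normrM -[x ^+ 2]real_normK ?num_real// -[y ^+ 2]real_normK ?num_real//.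
  by rewrite -subr_ge0 (_ : _ - _ = (`|x| - `|y|) ^+ 2) ?sqr_ge0//; ring.
apply: le_trans (ler_normD _ _) _.
have := h a c; have := h b e; have := sqr_ge0 a; have := sqr_ge0 b; have := sqr_ge0 c; have := sqr_ge0 e.
lra.
Qed.

Lemma nnE f : nn f = ip f f.
Proof. by congr fine; apply: eq_integral => t _; rewrite /normsq !expr2. Qed.

Lemma ipC f g : ip f g = ip g f.
Proof. by apply: eq_Rintegral => t _; rewrite ![_ * complex.Re (g t)]mulrC ![_ * complex.Im (g t)]mulrC. Qed.

Lemma ipBr f g h : L2 f -> L2 g -> L2 h ->
  ip f (fun t => g t - h t) = ip f g - ip f h.
Proof.
move=> Lf Lg Lh; rewrite /ip -(RintegralB measurableT (ip_integrable Lf Lg) (ip_integrable Lf Lh)).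
by apply: eq_Rintegral => t _; case: (f t) (g t) (h t) => a b [c e] [p q]; rewrite /=; ring.
Qed.

Lemma ipBl f g h : L2 f -> L2 g -> L2 h ->
  ip (fun t => f t - g t) h = ip f h - ip g h.
Proof. by move=> Lf Lg Lh; rewrite ![ip _ h]ipC ipBr. Qed.

Lemma nnB f g : L2 f -> L2 g -> nn (fun t => f t - g t) = nn f - 2 * ip f g + nn g.
Proof.
move=> Lf Lg; have LB := L2B Lf Lg.
by rewrite nnE ipBr// !ipBl// !nnE [ip g f]ipC; ring.
Qed.

Let rscale (s : R) f (t : T) : R[i] := Complex (s * complex.Re (f t)) (s * complex.Im (f t)).

Let L2_rscale s f : L2 f -> L2 (rscale s f) /\ nn (rscale s f) = s ^+ 2 * nn f.
Proof.
move=> Lf; have [[f1 f2] foo] := Lf.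
have E : N2 (rscale s f) = ((s ^+ 2)%:E * N2 f)%E.
  rewrite /N2 -ge0_integralZl//.
  - by apply: eq_integral => t _; rewrite -EFinM /normsq/=; congr EFin; ring.
  - by apply: measurable_normsqE.
  - by move=> t _; rewrite lee_fin normsq_ge0.
  - by rewrite lee_fin sqr_ge0.
split; last by rewrite /nn E fineM// N2_fin.
split; first by split; exact: measurable_funM.
by rewrite E -(nnK Lf) -EFinM ltry.
Qed.

Lemma ip_CS f g : L2 f -> L2 g -> ip f g ^+ 2 <= nn f * nn g.
Proof.
move=> Lf Lg; apply: discriminant_le => s.
have [Ls ns] := L2_rscale s Lg.
have := nn_ge0 (fun t => f t - rscale s g t); rewrite nnB// ns.
rewrite (_ : ip f (rscale s g) = s * ip f g); first by rewrite mulrA.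
rewrite /ip -(RintegralZl _ measurableT (ip_integrable Lf Lg)).
by apply: eq_Rintegral => t _ /=; ring.
Qed.

Lemma cvg_ip (u : nat -> T -> R[i]) f g : (forall n, L2 (u n)) -> L2 f -> L2 g ->
  nn (fun t => u n t - f t) @[n --> \oo] --> (0 : R) ->
  ip (u n) g @[n --> \oo] --> ip f g.
Proof.
move=> Lu Lf Lg u0.
have h n : `|ip (u n) g - ip f g| <= Num.sqrt (nn (fun t => u n t - f t) * nn g).
  rewrite -ipBl// -sqrtr_sqr ler_wsqrtr//; apply: ip_CS => //; exact: L2B.
apply/subr_cvg0/norm_cvg0P.
apply: (@squeeze_cvgr _ _ _ _ (fun=> 0) (fun n => Num.sqrt (nn (fun t => u n t - f t) * nn g))).
- by apply: nearW => n; rewrite normr_ge0 h.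
- exact: cvg_cst.
- have h0 : nn (fun t => u n t - f t) * nn g @[n --> \oo] --> (0 : R).
    by rewrite -(mul0r (nn g)); apply: cvgM => //; exact: cvg_cst.
  rewrite -(@sqrtr0 R); apply: (cvg_comp _ _ h0); exact: sqrt_continuous.
Qed.

Lemma cvg_nn (u : nat -> T -> R[i]) f : (forall n, L2 (u n)) -> L2 f ->
  nn (fun t => u n t - f t) @[n --> \oo] --> (0 : R) ->
  nn (u n) @[n --> \oo] --> nn f.
Proof.
move=> Lu Lf u0.
have E n : nn (u n) = nn (fun t => u n t - f t) + 2 * ip (u n) f - nn f by rewrite nnB//; ring.
have E2 : nn f = 0 + 2 * ip f f - nn f by rewrite nnE; ring.
have h1 : 2 * ip (u n) f @[n --> \oo] --> 2 * ip f f.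
  by apply: cvgM; [exact: cvg_cst|exact: cvg_ip].
have h := cvgB (cvgD u0 h1) (cvg_cst (nn f)).
have -> : (fun n => nn (u n)) = (fun n => nn (fun t => u n t - f t) + 2 * ip (u n) f - nn f) by apply/funext.
by rewrite -E2 in h; exact: h.
Qed.

Lemma nn_eq0_ae f : L2 f -> nn f = 0 -> {ae mu, forall t, f t = 0}.
Proof.
move=> Lf f0; have [mf _] := Lf.
have := nnK Lf; rewrite f0 => /esym N0.
have /(ae_eq_integral_abs mu measurableT (measurable_normsqE mf)) : (\int[mu]_t `|(normsq (f t))%:E| = 0)%E.
  by rewrite -[RHS]N0; apply: eq_integral => t _; rewrite gee0_abs// lee_fin normsq_ge0.
by apply: filterS => t /(_ Logic.I)[/eqP]; rewrite normsq_eq0 => /eqP.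
Qed.

Lemma eq_ae_N2 f g : cmeas f -> cmeas g -> {ae mu, forall t, f t = g t} -> N2 f = N2 g.
Proof.
move=> mf mg fg; apply: ge0_ae_eq_integral => //; try exact: measurable_normsqE.
- by move=> t _; rewrite lee_fin normsq_ge0.
- by move=> t _; rewrite lee_fin normsq_ge0.
by apply: filterS fg => t -> _.
Qed.

Lemma nn_sub_eq0 f g : cmeas f -> cmeas g -> {ae mu, forall t, f t = g t} ->
  N2 (fun t => f t - g t) = 0%E.
Proof.
move=> mf mg fg; rewrite (@eq_ae_N2 _ (fun=> 0)) //.
- rewrite /N2 integral0_eq// => t _; by rewrite /normsq/= expr0n addr0.
- exact: cmeasB.
- by apply: filterS fg => t ->; rewrite subrr.
Qed.

Lemma L2_limit_unique (u : nat -> T -> R[i]) f g : (forall n, L2 (u n)) -> L2 f -> L2 g ->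
  nn (fun t => u n t - f t) @[n --> \oo] --> (0 : R) ->
  nn (fun t => u n t - g t) @[n --> \oo] --> (0 : R) ->
  {ae mu, forall t, f t = g t}.
Proof.
move=> Lu Lf Lg uf ug.
have h : nn (fun t => u n t - g t) @[n --> \oo] --> nn (fun t => f t - g t).
  apply: (@cvg_nn (fun n t => u n t - g t) _ (fun n => L2B (Lu n) Lg) (L2B Lf Lg)).
  have -> : (fun n => nn (fun t => u n t - g t - (f t - g t))) = (fun n => nn (fun t => u n t - f t)).
    by apply/funext => n; congr nn; apply/funext => t; rewrite opprB addrA subrK.
  exact: uf.
apply: filterS (nn_eq0_ae (L2B Lf Lg) (cvg_unique (@Rhausdorff R) h ug)) => t.
exact: subr0_eq.
Qed.

(** Fatou: balls of L2 are closed under almost everywhere convergence. *)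
Lemma N2_fatou (u : nat -> T -> R[i]) f (c : \bar R) : (forall n, cmeas (u n)) -> cmeas f ->
  {ae mu, forall t, ccvg (u ^~ t) (f t)} ->
  (\forall n \near \oo, N2 (u n) <= c)%E -> (N2 f <= c)%E.
Proof.
move=> mu_ mf uf uc.
have mn n : measurable_fun setT (fun t => (normsq (u n t))%:E) by exact: measurable_normsqE.
have -> : N2 f = (\int[mu]_t limn_einf (fun n => (normsq (u n t))%:E))%E.
  apply: ge0_ae_eq_integral => //.
  - exact: measurable_normsqE.
  - apply: (@emeasurable_fun_cvg _ _ _ _ (fun n t => einfs (fun k => (normsq (u k t))%:E) n)).
      by move=> n; exact: measurable_fun_einfs.
    by move=> t _; rewrite limn_einf_lim; exact: is_cvg_einfs.
  - by move=> t _; rewrite lee_fin normsq_ge0.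
  - move=> t _; rewrite limn_einf_lim; apply: lime_ge; first exact: is_cvg_einfs.
    apply: nearW => n; apply: le_ereal_inf_tmp => _ [k /= _ <-].
    by rewrite lee_fin normsq_ge0.
  - apply: filterS uf => t /ccvg_normsq ut _.
    rewrite [RHS](_ : _ = (normsq (f t))%:E)//.
    by apply: (cvg_limn_einf_sup _).1; apply: cvg_EFin ut; exact: nearW.
apply: le_trans (fatou mu measurableT mn _) _.
  by move=> n t _; rewrite lee_fin normsq_ge0.
rewrite limn_einf_lim; apply: lime_le; first exact: is_cvg_einfs.
apply: filterS uc => n; apply: le_trans.
by apply: ereal_inf_lbound; exists n => /=.
Qed.


(** Riesz-Fischer: along a fast subsequence the increments are summable almost everywhere, which
    produces a pointwise limit. Fatou then turns the Cauchy condition into convergence of the whole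
    sequence. *)
Lemma L2_complete (u : nat -> T -> R[i]) : (forall n, L2 (u n)) ->
  (forall e, 0 < e -> exists N, forall n m, (N <= n)%N -> (N <= m)%N ->
     nn (fun t => u n t - u m t) <= e) ->
  exists2 f, L2 f & nn (fun t => u n t - f t) @[n --> \oo] --> (0 : R).
Proof.
move=> Lu cu.
have Lsub n m : L2 (fun t => u n t - u m t) by exact: L2B.
(* At rate 8^-k the k-th term 2^k |w_k|^2 below has integral at most 4^-k, hence at most 2^-k, so
   the series has a finite integral. *)
have /choice[N NP] : forall k : nat, exists Nk : nat, forall n m, (Nk <= n)%N -> (Nk <= m)%N ->
    nn (fun t => u n t - u m t) <= 8%:R ^- k.
  by move=> k; apply: cu; rewrite invr_gt0 exprn_gt0.
(* [p k] is at least k and at least [N j] for every j <= k. *)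
pose p k := (k + \sum_(j < k.+1) N j)%N.
have pN k j : (k <= j)%N -> (N k <= p j)%N.
  by move=> kj; rewrite /p (bigD1 (Ordinal (kj : (k < j.+1)%N)))//= addnCA leq_addr.
have geo n : \sum_(0 <= j < n) (2^-1 : R) ^+ j <= 2.
  rewrite (_ : \sum_(0 <= j < n) _ = 2 - 2 * (2^-1) ^+ n); first by rewrite gerBl mulr_ge0// exprn_ge0// invr_ge0.
  elim: n => [|n IH]; first by rewrite big_nil expr0 mulr1 subrr.
  by rewrite big_nat_recr//= IH exprS; field.
pose w k (t : T) := u (p k.+1) t - u (p k) t.
have Lw k : L2 (w k) by exact: Lsub.
have wk k : nn (w k) <= 8%:R ^- k by apply: NP; apply: pN.
have mw k : measurable_fun setT (fun t => (2%:R ^+ k * normsq (w k t))%:E).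
  apply/measurable_EFinP; apply: measurable_funM => //.
  by apply: measurable_normsq; have [] := Lw k.
have w0 k t : (0 <= (2%:R ^+ k * normsq (w k t))%:E)%E.
  by rewrite lee_fin mulr_ge0 ?exprn_ge0 ?normsq_ge0.
have Soo : (\int[mu]_t (\sum_(0 <= k <oo) (2%:R ^+ k * normsq (w k t))%:E) < +oo)%E.
  rewrite integral_nneseries//.
  apply: (@le_lt_trans _ _ (\sum_(0 <= k <oo) ((2^-1) ^+ k)%:E)%E); last first.
    apply: (@le_lt_trans _ _ 2%:E); last exact: ltry.
    apply: lime_le.
      by apply: is_cvg_nneseries => k _ _; rewrite lee_fin exprn_ge0// invr_ge0.
    by apply: nearW => n; rewrite sumEFin lee_fin geo.
  apply: lee_nneseries => //.
    by move=> *; apply: integral_ge0 => t _; exact: w0.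
  move=> k *; under eq_integral do rewrite EFinM.
  have mwk : measurable_fun setT (fun t => (normsq (w k t))%:E).
    by apply: measurable_normsqE; have [] := Lw k.
  rewrite (ge0_integralZl mu measurableT mwk); [|by move=> t _; rewrite lee_fin normsq_ge0|by rewrite lee_fin exprn_ge0].
  rewrite -/(N2 (w k)) -nnK// -EFinM lee_fin.
  apply: (@le_trans _ _ (2 ^+ k * 8%:R ^- k)); first by rewrite ler_wpM2l ?exprn_ge0.
  rewrite -exprVn -exprMn lerXn2r// ?nnegrE//; lra.
have iS : mu.-integrable setT (fun t => \sum_(0 <= k <oo) (2%:R ^+ k * normsq (w k t))%:E)%E.
  apply/integrableP; split.
    by apply: ge0_emeasurable_sum => // k t _ _; exact: w0.
  by under eq_integral do rewrite gee0_abs ?nneseries_ge0//.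
have cvR (h : R[i] -> R) : (forall z, `|h z| ^+ 2 <= normsq z) -> (forall z z', h (z - z') = h z - h z') ->
    {ae mu, forall t, cvgn (fun k => h (u (p k) t))}.
  move=> h1 hB; apply: filterS (integrable_ae measurableT iS) => t /(_ Logic.I) Sfin.
  set S := (\sum_(0 <= k <oo) _)%E in Sfin.
  have SE : S = (fine S)%:E by rewrite fineK.
  have -> : (fun k => h (u (p k) t)) = (fun k => h (u (p 0) t) + series (fun k => h (w k t)) k).
    apply/funext => k; rewrite [LHS](eq_sum_telescope (fun k => h (u (p k) t))); congr (_ + _).
    by rewrite /series/=; apply: eq_bigr => j _; rewrite /telescope /w hB.
  apply: is_cvgD; first exact: is_cvg_cst.
  apply: normed_cvg; apply: nondecreasing_is_cvgn.
    by apply/nondecreasing_seqP => k; rewrite /normed_series_of /series/= big_nat_recr//= lerDl.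
  exists (2 + fine S) => _ [k _ <-]; rewrite /normed_series_of /series/=.
  (* From y <= 1/q + q y^2 with q = 2^j: summability of the weighted squares gives absolute
     summability of the increments. *)
  apply: (@le_trans _ _ (\sum_(0 <= j < k) ((2^-1) ^+ j + 2 ^+ j * normsq (w j t)))).
    apply: ler_sum => j _.
    have q0 : 0 < 2 ^+ j :> R by rewrite exprn_gt0.
    have := h1 (w j t); set y := `|_|; rewrite exprVn; set q := 2 ^+ j in q0 *; move=> yn.
    have -> : y = (q^-1) * (q * y) by rewrite mulKf// gt_eqF.
    rewrite -(ler_pM2l q0) mulrA divff ?gt_eqF// mul1r mulrDr divff ?gt_eqF//.
    apply: (@le_trans _ _ (1 + (q * y) ^+ 2)); first by have := sqr_ge0 (q * y - 1); nra.
    rewrite lerD2l (_ : q * (q * _) = q ^+ 2 * normsq (w j t)); last by ring.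
    by rewrite exprMn ler_wpM2l ?sqr_ge0.
  rewrite big_split/= lerD//.
  rewrite -lee_fin -SE -sumEFin.
  exact: nneseries_lim_ge.
(* The upper limit is measurable without exception and equals the limit wherever there is one. *)
pose f t := Complex (fine (limn_esup (fun k => (complex.Re (u (p k) t))%:E)))
                    (fine (limn_esup (fun k => (complex.Im (u (p k) t))%:E))).
have mf : cmeas f.
  split; apply: (measurableT_comp (@fine_measurable R setT measurableT)); apply: measurable_fun_limn_esup => k; apply/measurable_EFinP; by have [[]] := Lu (p k).
have uf : {ae mu, forall t, ccvg (fun k => u (p k) t) (f t)}.
  have lim_fine (v : R^nat) : cvgn v -> v k @[k --> \oo] --> fine (limn_esup (fun k => (v k)%:E)).
    move=> /cvg_ex[/= l vl]; rewrite (cvg_limn_einf_sup (l := l%:E) _).2//.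
    by apply: cvg_EFin vl; exact: nearW.
  have cR : {ae mu, forall t, cvgn (fun k => complex.Re (u (p k) t))}.
    apply: cvR; first by case=> a b; rewrite real_normK ?num_real// /normsq/= lerDl sqr_ge0.
    by move=> [a b] [c e].
  have cI : {ae mu, forall t, cvgn (fun k => complex.Im (u (p k) t))}.
    apply: cvR; first by case=> a b; rewrite real_normK ?num_real// /normsq/= lerDr sqr_ge0.
    by move=> [a b] [c e].
  by apply: filterS2 cR cI => t tR tI; split; exact: lim_fine.
have key e n : 0 < e -> (forall m, (n <= m)%N -> nn (fun t => u n t - u m t) <= e) ->
    (N2 (fun t => u n t - f t)%R <= e%:E)%E.
  move=> e0 nm; apply: (@N2_fatou (fun k t => u n t - u (p k) t)).
  - by move=> k; have [] := Lsub n (p k).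
  - by apply: cmeasB => //; have [] := Lu n.
  - by apply: filterS uf => t; apply: ccvgB; exact: ccvg_cst.
  - exists n => // k /= nk; rewrite -(nnK (Lsub n (p k))) lee_fin.
    by apply: nm; rewrite (leq_trans nk)// leq_addr.
have Lf : L2 f.
  have [n0 n0P] := cu 1 ltr01.
  have [mun _] := Lu n0.
  have Ld : L2 (fun t => u n0 t - f t).
    split; first exact: cmeasB.
    by apply: le_lt_trans (ltry 1); apply: key => // m nm; apply: n0P.
  have := L2B (Lu n0) Ld; congr L2; apply/funext => t.
  by rewrite opprB addrC subrK.
exists f => //; apply/cvgrPdist_le => e e0.
have [n0 n0P] := cu e e0; exists n0 => // n /= nn0.
rewrite sub0r normrN ger0_norm ?nn_ge0// -lee_fin nnK; last exact: L2B.
by apply: key => // m nm; apply: n0P => //; exact: leq_trans nm.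
Qed.

End L2.

Section L2_more.
Context d (T : measurableType d) {R : realType}.
Variable mu : {measure set T -> \bar R}.
Implicit Types f g h : T -> R[i].

Lemma nnD_le f g : L2 mu f -> L2 mu g ->
  nn mu (fun t => f t + g t) <= 2 * nn mu f + 2 * nn mu g.
Proof.
move=> Lf Lg; have LD := L2D Lf Lg.
have i1 := normsq_integrable Lf; have i2 := normsq_integrable Lg.
have r1 : \int[mu]_t (2 * normsq (f t)) = 2 * nn mu f by rewrite (RintegralZl _ measurableT i1).
have r2 : \int[mu]_t (2 * normsq (g t)) = 2 * nn mu g by rewrite (RintegralZl _ measurableT i2).
have j1 := integrableZl measurableT 2 i1; have j2 := integrableZl measurableT 2 i2.
rewrite -r1 -r2 -(RintegralD measurableT j1 j2).
apply: le_Rintegral => //; first exact: normsq_integrable.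
  exact: (integrableD measurableT j1 j2).
by move=> t _; exact: normsqD_le.
Qed.

Lemma nn_sym f g : nn mu (fun t => f t - g t) = nn mu (fun t => g t - f t).
Proof. by congr fine; apply: eq_integral => t _; rewrite -normsqN opprB. Qed.

Lemma nn_triangle f g h : L2 mu f -> L2 mu g -> L2 mu h ->
  nn mu (fun t => f t - h t) <= 2 * nn mu (fun t => f t - g t) + 2 * nn mu (fun t => h t - g t).
Proof.
move=> Lf Lg Lh; rewrite [nn mu (fun t => h t - g t)]nn_sym.
apply: le_trans (nnD_le (L2B Lf Lg) (L2B Lg Lh)).
by rewrite le_eqVlt; apply/orP; left; apply/eqP; congr nn; apply/funext => t; rewrite addrA subrK.
Qed.

Lemma nn_dct (u : nat -> T -> R[i]) f : (forall n, cmeas (u n)) -> L2 mu f ->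
  (forall t, ccvg (u ^~ t) (f t)) -> (forall n t, normsq (u n t) <= normsq (f t)) ->
  nn mu (fun t => u n t - f t) @[n --> \oo] --> (0 : R).
Proof.
move=> mu_ Lf uf ul; have [mf _] := Lf.
have i4 := integrableZl measurableT 4 (normsq_integrable Lf).
have [|||||_ _ h] := @dominated_convergence _ _ _ mu setT measurableT
  (fun n t => (normsq (u n t - f t))%:E) (fun=> 0%E) (fun t => 4%:E * (normsq (f t))%:E)%E.
- by move=> n; apply: measurable_normsqE; exact: cmeasB.
- exact: measurable_cst.
- apply: aeW => t _; apply: cvg_EFin; first exact: nearW.
  have := ccvg_normsq (ccvgB (uf t) (ccvg_cst (f t))).
  by rewrite subrr /normsq/= expr0n addr0.
- exact: i4.
- apply: aeW => t n _; rewrite -EFinM gee0_abs lee_fin ?normsq_ge0//.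
  apply: le_trans (normsqD_le _ _) _; rewrite normsqN.
  by have := ul n t; lra.
rewrite integral0 in h.
exact: (fine_cvg h).
Qed.

(** By Fatou the squared distance between the pointwise limit and the L2 limit is below every
    positive number. *)
Lemma L2_ptwise_limit (u : nat -> T -> R[i]) f g : (forall n, L2 mu (u n)) -> L2 mu f -> cmeas g ->
  nn mu (fun t => u n t - f t) @[n --> \oo] --> (0 : R) ->
  {ae mu, forall t, ccvg (u ^~ t) (g t)} -> {ae mu, forall t, g t = f t}.
Proof.
move=> Lu Lf mg uf ug; have [mf _] := Lf.
have le0 e : 0 < e -> (N2 mu (fun t => g t - f t)%R <= e%:E)%E.
  move=> e0; apply: (@N2_fatou _ _ _ mu (fun n t => u n t - f t)).
  - by move=> n; apply: cmeasB => //; have [] := Lu n.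
  - exact: cmeasB.
  - by apply: filterS ug => t ut; apply: ccvgB => //; exact: ccvg_cst.
  - move/cvgrPdist_le : uf => /(_ _ e0); apply: filterS => n.
    rewrite sub0r normrN ger0_norm ?nn_ge0// => h.
    by rewrite -nnK ?lee_fin//; exact: L2B.
have Ld : L2 mu (fun t => g t - f t).
  by split; [exact: cmeasB|exact: le_lt_trans (le0 1 ltr01) (ltry _)].
have n0 : nn mu (fun t => g t - f t) = 0.
  apply/eqP; rewrite eq_le nn_ge0 andbT; apply/ler_addgt0Pl => e e0; rewrite addr0.
  by rewrite -lee_fin nnK//; exact: le0.
by apply: filterS (nn_eq0_ae Ld n0) => t /subr0_eq.
Qed.

Lemma eq_ae_L2 f g : cmeas g -> L2 mu f -> {ae mu, forall t, g t = f t} ->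
  L2 mu g /\ nn mu g = nn mu f.
Proof.
move=> mg [mf foo] gf; have E := eq_ae_N2 mg mf gf.
by split; [split => //; rewrite E|rewrite /nn E].
Qed.

Lemma nn_sub_ae f g h : cmeas g -> L2 mu f -> L2 mu h -> {ae mu, forall t, g t = f t} ->
  nn mu (fun t => h t - g t) = nn mu (fun t => h t - f t).
Proof.
move=> mg Lf Lh gf; have [mf _] := Lf; have [mh _] := Lh.
rewrite /nn (@eq_ae_N2 _ _ _ mu _ (fun t => h t - f t))//.
- exact: cmeasB.
- exact: cmeasB.
- by apply: filterS gf => t ->.
Qed.

End L2_more.

(** Cauchy sequences go to Cauchy sequences under an isometry. The operator is represented only by
    the sequences of arguments and images, because it is so far defined only on a subspace. *)
Lemma isometric_limit d (T : measurableType d) (R : realType)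
  (mu : {measure set T -> \bar R}) d2 (T2 : measurableType d2) (mu2 : {measure set T2 -> \bar R})
  (v : nat -> T2 -> R[i]) (u : nat -> T -> R[i]) (f : T2 -> R[i]) :
  (forall n, L2 mu2 (v n)) -> L2 mu2 f -> (forall n, L2 mu (u n)) ->
  (forall n, nn mu (u n) = nn mu2 (v n)) ->
  (forall n m, nn mu (fun t => u n t - u m t) = nn mu2 (fun t => v n t - v m t)) ->
  nn mu2 (fun t => v n t - f t) @[n --> \oo] --> (0 : R) ->
  exists g, [/\ L2 mu g, nn mu (fun t => u n t - g t) @[n --> \oo] --> (0 : R) & nn mu g = nn mu2 f].
Proof.
move=> Lv Lf Lu uv uvB vf.
have [|g Lg ug] := L2_complete Lu.
  (* [nn_triangle] doubles both distances: 2 e/4 + 2 e/4 = e. *)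
  move=> e e0; have e4 : 0 < e / 4 by rewrite divr_gt0.
  move/cvgrPdist_le : (vf) => /(_ _ e4)[N _ NP]; exists N => n m nN mN.
  rewrite uvB; apply: le_trans (nn_triangle (Lv n) Lf (Lv m)) _.
  have := NP n nN; have := NP m mN; rewrite /= !sub0r !normrN !ger0_norm ?nn_ge0//; lra.
exists g; split => //.
apply: (cvg_unique (@Rhausdorff R) (cvg_nn Lu Lg ug)).
have -> : (fun k => nn mu (u k)) = (fun k => nn mu2 (v k)) by apply/funext.
exact: cvg_nn.
Qed.


(** * The Fourier integral of integrable functions *)

Section FT_L1.
Context {R : realType} (n : nat).
Notation mr := (measurableTypeR R).
Notation mu := (lebesgue_rV R n).
Notation E := 'rV[R]_n.
Implicit Types f g x y : E -> R[i].

(** An integrable majorant for both parts of any function of no larger modulus ([normsq_le_l1]),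
    obtained without square roots. *)
Definition l1 (z : R[i]) : R := `|complex.Re z| + `|complex.Im z|.

Lemma l1_ge0 z : 0 <= l1 z. Proof. by rewrite addr_ge0. Qed.

Lemma normsq_le_l1 (z w : R[i]) : normsq z <= normsq w ->
  `|complex.Re z| <= l1 w /\ `|complex.Im z| <= l1 w.
Proof.
rewrite /normsq /l1; case: z w => a b [c e] /= h.
have hh : `|a| ^+ 2 + `|b| ^+ 2 <= (`|c| + `|e|) ^+ 2.
  rewrite !real_normK ?num_real// (le_trans h)// sqrrD !real_normK ?num_real//.
  by rewrite addrAC lerDl mulrn_wge0// mulr_ge0.
split; rewrite -ler_sqr ?nnegrE ?addr_ge0//; apply: le_trans hh; by rewrite ?lerDl ?lerDr sqr_ge0.
Qed.

Lemma l1_integrable (T : E -> R[i]) : cintegrable mu T -> mu.-integrable setT (fun t => (l1 (T t))%:E).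
Proof.
move=> [t1 t2]; have := integrableD measurableT (integrable_norm t1) (integrable_norm t2).
by congr (integrable _ _ _); apply/funext => t; rewrite /l1 EFinD.
Qed.

Lemma cintegrable_le f g : cmeas (f : 'rV[mr]_n -> R[i]) -> cintegrable mu g ->
  (forall t, normsq (f t) <= normsq (g t)) -> cintegrable mu f.
Proof.
move=> [f1 f2] ig fg; have il := l1_integrable ig.
split; apply: (@le_integrable _ _ _ mu setT measurableT _ _ _ _ il).
- exact/measurable_EFinP.
- by move=> t _; rewrite /= lee_fin (ger0_norm (l1_ge0 _)); have [] := normsq_le_l1 (fg t).
- exact/measurable_EFinP.
- by move=> t _; rewrite /= lee_fin (ger0_norm (l1_ge0 _)); have [] := normsq_le_l1 (fg t).
Qed.

Lemma cintegrable_cmeas f : cintegrable mu f -> cmeas (f : 'rV[mr]_n -> R[i]).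
Proof. by move=> [/measurable_int/measurable_EFinP h1 /measurable_int/measurable_EFinP h2]; split. Qed.

Lemma cmeas_phase1 (u : E) : cmeas ((fun t => phase t u) : 'rV[mr]_n -> R[i]).
Proof. exact: (@cmeas_phase _ _ 'rV[mr]_n n id (fun=> u)). Qed.

Lemma cintegrable_phase f u : cintegrable mu f -> cintegrable mu (fun t => f t * phase t u).
Proof.
move=> jf; apply: cintegrable_le (jf) _.
  by apply: cmeasM; [exact: cintegrable_cmeas|exact: cmeas_phase1].
by move=> t; rewrite normsqM normsq_phase mulr1.
Qed.

Lemma FTB f g u : cintegrable mu f -> cintegrable mu g ->
  FT (fun t => f t - g t) u = FT f u - FT g u.
Proof.
move=> jf jg; rewrite /FT -[- cint _ _]mulrN1 -cintMr; last exact: cintegrable_phase.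
rewrite -cintD; [|exact: cintegrable_phase|].
  by apply: eq_cint => t; rewrite mulrN1 mulrBl.
by apply: cintegrableMr; exact: cintegrable_phase.
Qed.

Lemma cint_dct (v : nat -> E -> R[i]) f g :
  (forall k, cmeas (v k : 'rV[mr]_n -> R[i])) -> cmeas (f : 'rV[mr]_n -> R[i]) -> cintegrable mu g ->
  (forall t, ccvg (v ^~ t) (f t)) -> (forall k t, normsq (v k t) <= normsq (g t)) ->
  ccvg (fun k => cint mu (v k)) (cint mu f).
Proof.
move=> mv mf jg vf vl; have il := l1_integrable jg.
have dct (p : R[i] -> R) : (forall k, measurable_fun setT (fun t : 'rV[mr]_n => p (v k t))) ->
    measurable_fun setT (fun t : 'rV[mr]_n => p (f t)) ->
    (forall t, p (v k t) @[k --> \oo] --> p (f t)) ->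
    (forall k t, `|p (v k t)| <= l1 (g t)) ->
    (\int[mu]_t p (v k t)) @[k --> \oo] --> \int[mu]_t p (f t).
  move=> p1 p2 p3 p4.
  have [|||||jp _ h] := @dominated_convergence _ _ _ mu setT measurableT
    (fun k t => (p (v k t))%:E) (fun t => (p (f t))%:E) (fun t => (l1 (g t))%:E).
  - by move=> k; exact/measurable_EFinP.
  - exact/measurable_EFinP.
  - by apply: aeW => t _; apply: cvg_EFin; [exact: nearW|exact: p3].
  - exact: il.
  - by apply: aeW => t k _; rewrite /= lee_fin.
  rewrite -[X in _ --> X](_ : fine (\int[mu]_t p (f t))%:E = _)//.
  apply: fine_cvg; rewrite /Rintegral fineK; first exact: h.
  exact: (integrable_fin_num measurableT jp).
split.
  apply: (dct (fun z => complex.Re z)).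
  - by move=> k; have [] := mv k.
  - by have [] := mf.
  - by move=> t; have [] := vf t.
  - by move=> k t; have [] := normsq_le_l1 (vl k t).
apply: (dct (fun z => complex.Im z)).
- by move=> k; have [] := mv k.
- by have [] := mf.
- by move=> t; have [] := vf t.
- by move=> k t; have [] := normsq_le_l1 (vl k t).
Qed.

Lemma FT_dct (v : nat -> E -> R[i]) f (u : E) :
  (forall k, cmeas (v k : 'rV[mr]_n -> R[i])) -> cintegrable mu f ->
  (forall t, ccvg (v ^~ t) (f t)) -> (forall k t, normsq (v k t) <= normsq (f t)) ->
  ccvg (fun k => FT (v k) u) (FT f u).
Proof.
move=> mv jf vf vl; have mf := cintegrable_cmeas jf.
apply: (@cint_dct (fun k t => v k t * phase t u) (fun t => f t * phase t u) f).
- by move=> k; apply: cmeasM => //; exact: cmeas_phase1.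
- by apply: cmeasM => //; exact: cmeas_phase1.
- exact: jf.
- by move=> t; apply: ccvgM (vf t) (@ccvg_cst _ _).
- by move=> k t; rewrite normsqM normsq_phase mulr1.
Qed.

End FT_L1.

(** * The Fourier transform on L2 *)

Section fourier_L2.
Context {R : realType} (n : nat).
Notation mr := (measurableTypeR R).
Notation mu := (lebesgue_rV R n).
Notation E := 'rV[R]_n.
Notation L2 := (@L2 _ 'rV[mr]_n R mu).
Notation nn := (@nn _ 'rV[mr]_n R mu).
Notation ip := (@ip _ 'rV[mr]_n R mu).
Implicit Types f g x y : E -> R[i].

Definition restrict (D : set E) f (t : E) : R[i] := if t \in D then f t else 0.

(** Cutting off in height, as [cube] cuts off in space; the two together reduce L2 functions to
    bounded functions of compact support. *)
Definition levels f (K : nat) : set E :=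
  [set t | `|complex.Re (f t)| <= K%:R /\ `|complex.Im (f t)| <= K%:R].

Lemma normsq_restrict D f t : normsq (restrict D f t) <= normsq (f t).
Proof. by rewrite /restrict; case: ifPn => // _; rewrite {1}/normsq/= expr0n addr0 normsq_ge0. Qed.

Lemma restrict_cmeas (D : set 'rV[mr]_n) f : measurable D -> cmeas (f : 'rV[mr]_n -> R[i]) ->
  cmeas (restrict D f : 'rV[mr]_n -> R[i]).
Proof. exact: cmeas_patch. Qed.

Lemma restrict_L2 (D : set 'rV[mr]_n) f : measurable D -> L2 f -> L2 (restrict D f).
Proof.
move=> mD Lf; have [mf _] := Lf.
by have [] := L2_le (restrict_cmeas mD mf) Lf (normsq_restrict D f).
Qed.

Lemma measurable_levels f K : cmeas (f : 'rV[mr]_n -> R[i]) ->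
  measurable (levels f K : set 'rV[mr]_n).
Proof.
move=> [f1 f2].
have h (p : 'rV[mr]_n -> R) : measurable_fun setT p -> measurable ([set t | `|p t| <= K%:R] : set 'rV[mr]_n).
  move=> mp; have mnp : measurable_fun setT (fun t => `|p t|) by exact: measurableT_comp.
  have := mnp measurableT `]-oo, K%:R]%classic (measurable_itv _).
  by rewrite setTI; congr measurable; apply/seteqP; split => t; rewrite /= in_itv.
exact: measurableI (h _ f1) (h _ f2).
Qed.

Lemma ccvg_restrict (D : nat -> set E) f t : (exists N, forall k, (N <= k)%N -> D k t) ->
  ccvg (fun k => restrict (D k) f t) (f t).
Proof.
move=> [N NP]; split; apply: (@cvg_near_cst _ _ _ _ eventually); exists N => // k /= Nk;
  by rewrite /restrict mem_set//; exact: NP.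
Qed.

Lemma bound_nat (z : R) : exists N : nat, forall k, (N <= k)%N -> z <= k%:R.
Proof.
exists (Num.truncn `|z|).+1 => k Nk; apply: le_trans (ler_norm z) _.
apply: le_trans (ltW (truncnS_gt _)) _; by rewrite ler_nat.
Qed.

Lemma ccvg_levels f t : ccvg (fun k => restrict (levels f k) f t) (f t).
Proof.
apply: ccvg_restrict; have [N1 h1] := bound_nat `|complex.Re (f t)|.
have [N2 h2] := bound_nat `|complex.Im (f t)|.
exists (maxn N1 N2) => k; rewrite geq_max => /andP[k1 k2]; split; [exact: h1|exact: h2].
Qed.

Lemma ccvg_cube f t : ccvg (fun k => restrict (cube k) f t) (f t).
Proof.
apply: ccvg_restrict.
have [N NP] := bound_nat (\sum_i `|t ord0 i|).
exists N => k /NP h i; apply: le_trans h.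
by rewrite (bigD1 i)//= lerDl sumr_ge0.
Qed.

Lemma cvg_restrict_cube f : L2 f -> nn (fun t => restrict (cube k) f t - f t) @[k --> \oo] --> (0 : R).
Proof.
move=> Lf; have [mf _] := Lf; apply: nn_dct => //.
- by move=> k; apply: restrict_cmeas => //; exact: measurable_cube.
- by move=> t; exact: ccvg_cube.
- by move=> k t; exact: normsq_restrict.
Qed.

Definition csupp (N : nat) f := forall t, ~ cube N t -> f t = 0.

(** On the cube |p| <= 1 + |p|^2, and the cube has finite measure. *)
Lemma csupp_cintegrable N f : csupp N f -> L2 f -> cintegrable mu f.
Proof.
move=> fN Lf; have [[f1 f2] _] := Lf.
have iD : mu.-integrable setT (fun t => (\1_(cube N : set 'rV[mr]_n) t)%:E).
  by apply: integrable_indic_lty; [exact: measurable_cube|exact: lebesgue_cube_lty].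
have iS := integrableD measurableT iD (normsq_integrable Lf).
have h (p : 'rV[mr]_n -> R) : measurable_fun setT p -> (forall t, `|p t| ^+ 2 <= normsq (f t)) ->
    mu.-integrable setT (fun t => (p t)%:E).
  move=> mp pf; apply: (@le_integrable _ _ _ mu setT measurableT _ _ _ _ iS).
    exact/measurable_EFinP.
  move=> t _; have n0 : 0 <= \1_(cube N : set 'rV[mr]_n) t + normsq (f t) :> R by rewrite addr_ge0 ?normsq_ge0// indicE.
  rewrite /= lee_fin (ger0_norm n0) indicE.
  have [_|] := boolP (t \in _).
    apply: le_trans (_ : 1 + `|p t| ^+ 2 <= _); last by rewrite lerD2l.
    by have := sqr_ge0 (`|p t| - 1); have := normr_ge0 (p t); nra.
  rewrite notin_setE => /fN ft0; have := pf t; rewrite ft0 /normsq/= expr0n/= !addr0.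
  by have := normr_ge0 (p t); nra.
split.
  apply: h => // t; rewrite real_normK ?num_real// /normsq lerDl sqr_ge0//.
by apply: h => // t; rewrite real_normK ?num_real// /normsq lerDr sqr_ge0.
Qed.

(** Cut f off in height. The transforms of the cut-offs converge in L2 by isometry and pointwise to
    [FT f] by dominated convergence, so [FT f] is the L2 limit. *)
Lemma isometry_csupp N f : csupp N f -> L2 f -> L2 (FT f) /\ nn (FT f) = nn f.
Proof.
move=> fN Lf; have [mf _] := Lf; have jf := csupp_cintegrable fN Lf.
pose v k := restrict (levels f k) f.
have mv k : cmeas (v k : 'rV[mr]_n -> R[i]) by apply: restrict_cmeas => //; exact: measurable_levels.
have Lv k : L2 (v k) by apply: restrict_L2 => //; exact: measurable_levels.
have bv k : bounded_supp k%:R N (v k).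
  split => //.
    by move=> t; rewrite /v /restrict; case: ifPn => [/set_mem[]//|_]; rewrite /= normr0.
  by move=> t /fN ft; rewrite /v /restrict ft if_same.
have bvB k m : bounded_supp (k%:R + m%:R) N (fun t => v k t - v m t).
  have [_ kb kN] := bv k; have [_ mb mN] := bv m; split.
  - exact: cmeasB.
  - move=> t; have := kb t; have := mb t; case: (v k t) (v m t) => a b [c e] /= [? ?] [? ?].
    by split; apply: le_trans (ler_normB _ _) _; exact: lerD.
  - by move=> t tN; rewrite kN// mN// subrr.
have vf : nn (fun t => v k t - f t) @[k --> \oo] --> (0 : R).
  apply: nn_dct => //; first by move=> t; exact: ccvg_levels.
  by move=> k t; exact: normsq_restrict.
have iso M g : bounded_supp M N g -> L2 g -> L2 (FT g) /\ nn (FT g) = nn g.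
  move=> bg [mg goo]; have I := isometry_bounded bg; split; last by rewrite /nn /N2 I.
  by split; [exact: cmeas_FT|rewrite /N2 I].
have jv k : cintegrable mu (v k) by exact: bounded_supp_cintegrable (bv k).
have isov k := iso _ _ (bv k) (Lv k).
have [||||g [Lg vg ng]] := @isometric_limit _ _ _ mu _ _ mu v (fun k => FT (v k)) f Lv Lf.
- by move=> k; have [] := isov k.
- by move=> k; have [] := isov k.
- move=> k m; transitivity (nn (FT (fun t => v k t - v m t))).
    by congr nn; apply/funext => u; rewrite FTB.
  by have [] := iso _ _ (bvB k m) (L2B (Lv k) (Lv m)).
- exact: vf.
have mFf : cmeas (FT f : 'rV[mr]_n -> R[i]) by exact: cmeas_FT.
have LFv k : L2 (FT (v k)) by have [] := isov k.
have pt : {ae mu, forall t, ccvg (fun k => FT (v k) t) (FT f t)}.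
  apply: aeW => u; apply: FT_dct => //; first by move=> t; exact: ccvg_levels.
  by move=> k t; exact: normsq_restrict.
have ae := L2_ptwise_limit LFv Lg mFf vg pt.
by have [? ->] := eq_ae_L2 mFf Lg ae; rewrite ng.
Qed.

Lemma csupp_restrict N f : csupp N (restrict (cube N) f).
Proof. by move=> t tN; rewrite /restrict memNset. Qed.

Lemma csuppW N M f : (N <= M)%N -> csupp N f -> csupp M f.
Proof.
move=> NM fN t tM; apply: fN => tN; apply: tM => i.
by apply: le_trans (tN i) _; rewrite ler_nat.
Qed.

Lemma fourier_truncE N x : fourier_trunc N x = FT (restrict (cube N) x).
Proof.
apply/funext => u; rewrite /fourier_trunc /cintegral /FT /cint; congr Complex.
  rewrite Rintegral_mkcond; apply: eq_Rintegral => t _; rewrite patchE /restrict.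
  by case: ifPn => //; rewrite mul0r.
rewrite Rintegral_mkcond; apply: eq_Rintegral => t _; rewrite patchE /restrict.
by case: ifPn => //; rewrite mul0r.
Qed.

Lemma trunc_L2 N x : L2 x -> L2 (restrict (cube N) x).
Proof. by move=> Lx; apply: restrict_L2 => //; exact: measurable_cube. Qed.

Lemma FT_trunc N x : L2 x -> L2 (FT (restrict (cube N) x)) /\
  nn (FT (restrict (cube N) x)) = nn (restrict (cube N) x).
Proof. by move=> Lx; apply: (@isometry_csupp N); [exact: csupp_restrict|exact: trunc_L2]. Qed.

(* is_fourier in terms of nn *)
Definition isF x y := [/\ L2 x, L2 y & nn (fun u => FT (restrict (cube N) x) u - y u) @[N --> \oo] --> (0 : R)].

(** The difference of two truncations to cubes again has compact support, so [isometry_csupp] makes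
    the truncated transforms a Cauchy sequence. *)
Lemma isF_exists x : L2 x -> exists2 y, isF x y & nn y = nn x.
Proof.
move=> Lx.
have jx N := csupp_cintegrable (@csupp_restrict N x) (trunc_L2 N Lx).
have [||||y [Ly xy ny]] := @isometric_limit _ _ _ mu _ _ mu (fun N => restrict (cube N) x) (fun N => FT (restrict (cube N) x)) x (fun N => trunc_L2 N Lx) Lx.
- by move=> N; have [] := FT_trunc N Lx.
- by move=> N; have [] := FT_trunc N Lx.
- move=> N M; transitivity (nn (FT (fun t => restrict (cube N) x t - restrict (cube M) x t))).
    by congr nn; apply/funext => u; rewrite FTB.
  have [] := @isometry_csupp (maxn N M) (fun t => restrict (cube N) x t - restrict (cube M) x t) => //.
    move=> t tNM; rewrite (csuppW (leq_maxl N M) (@csupp_restrict N x) tNM).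
    by rewrite (csuppW (leq_maxr N M) (@csupp_restrict M x) tNM) subrr.
  by apply: L2B; exact: trunc_L2.
- exact: cvg_restrict_cube.
by exists y.
Qed.

Lemma isF_unique x y y' : isF x y -> isF x y' -> {ae mu, forall t, y t = y' t}.
Proof.
move=> [Lx Ly xy] [_ Ly' xy'].
exact: (L2_limit_unique (fun N => (FT_trunc N Lx).1) Ly Ly' xy xy').
Qed.

Lemma isF_isometry x y : isF x y -> nn y = nn x.
Proof.
move=> Fxy; have [Lx Ly _] := Fxy; have [y' Fxy' <-] := isF_exists Lx.
have [_ Ly' _] := Fxy'; have [my' _] := Ly'; have [my _] := Ly.
by have [] := eq_ae_L2 my Ly' (isF_unique Fxy Fxy').
Qed.

Lemma isF_ae x y y' : isF x y -> cmeas (y' : 'rV[mr]_n -> R[i]) -> {ae mu, forall t, y' t = y t} -> isF x y'.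
Proof.
move=> [Lx Ly xy] my' yy'; have [Ly' _] := eq_ae_L2 my' Ly yy'; split => //.
have -> : (fun N => nn (fun u => FT (restrict (cube N) x) u - y' u)) = (fun N => nn (fun u => FT (restrict (cube N) x) u - y u)) => //.
apply/funext => N; apply: nn_sub_ae => //.
by have [] := FT_trunc N Lx.
Qed.

Lemma isFB x x' y y' : isF x y -> isF x' y' -> isF (fun t => x t - x' t) (fun t => y t - y' t).
Proof.
move=> [Lx Ly xy] [Lx' Ly' xy']; split; [exact: L2B|exact: L2B|].
have LF N := (FT_trunc N Lx).1; have LF' N := (FT_trunc N Lx').1.
have EB N : FT (restrict (cube N) (fun t => x t - x' t)) = (fun u => FT (restrict (cube N) x) u - FT (restrict (cube N) x') u).
  apply/funext => u; rewrite -FTB; [|exact: csupp_cintegrable (@csupp_restrict N x) (trunc_L2 N Lx)|exact: csupp_cintegrable (@csupp_restrict N x') (trunc_L2 N Lx')].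
  by congr (FT _ u); apply/funext => t; rewrite /restrict; case: ifPn => //; rewrite subr0.
apply: (@squeeze_cvgr _ _ _ _ (fun=> 0) (fun N => 2 * nn (fun u => FT (restrict (cube N) x) u - y u) + 2 * nn (fun u => FT (restrict (cube N) x') u - y' u))).
- apply: nearW => N; rewrite nn_ge0/= EB.
  have [L1 L2'] := (L2B (LF N) Ly, L2B (LF' N) Ly').
  have := nnD_le L1 (L2N L2').
  rewrite (_ : nn (fun t => - (FT (restrict (cube N) x') t - y' t)) = nn (fun t => FT (restrict (cube N) x') t - y' t)); last first.
    by congr fine; apply: eq_integral => t _; rewrite normsqN.
  apply: le_trans; rewrite le_eqVlt; apply/orP; left; apply/eqP; congr nn; apply/funext => t; ring.
- exact: cvg_cst.
- rewrite -[X in _ --> X](_ : 2 * 0 + 2 * 0 = 0 :> R); last by rewrite mulr0 addr0.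
  by apply: cvgD; apply: cvgM => //; exact: cvg_cst.
Qed.

Lemma isF_inj x x' y : isF x y -> isF x' y -> {ae mu, forall t, x t = x' t}.
Proof.
move=> Fx Fx'; have FB := isFB Fx Fx'; have [LB _ _] := FB.
have n0 : nn (fun t => x t - x' t) = 0.
  rewrite -(isF_isometry FB) /nn /N2; under eq_integral do rewrite subrr /normsq/= expr0n addr0.
  by rewrite integral0.
by apply: filterS (nn_eq0_ae LB n0) => t /subr0_eq.
Qed.

End fourier_L2.

(** * Adjoint relation, surjectivity and inversion *)

Section adjoint.
Context {R : realType} (n : nat).
Notation mr := (measurableTypeR R).
Notation mu := (lebesgue_rV R n).
Notation E := 'rV[R]_n.
Notation L2 := (@L2 _ 'rV[mr]_n R mu).
Notation nn := (@nn _ 'rV[mr]_n R mu).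
Notation ip := (@ip _ 'rV[mr]_n R mu).
Implicit Types f g x y z w : E -> R[i].

Lemma phaseC (t u : E) : phase t u = phase u t.
Proof. by congr (cexpi (- (2 * pi * _))); apply: eq_bigr => i _; rewrite mulrC. Qed.

Lemma Re_le_l1 (p q : R[i]) : `|complex.Re (p * q)| <= l1 p * l1 q.
Proof.
case: p q => a b [c e]; rewrite /l1/=; apply: le_trans (ler_normB _ _) _; rewrite !normrM.
have := normr_ge0 a; have := normr_ge0 b; have := normr_ge0 c; have := normr_ge0 e; nra.
Qed.

Lemma l1_phase (t u : E) (p : R[i]) : l1 (phase t u * p) <= 2 * l1 p.
Proof.
have h : normsq (phase t u * p) <= normsq p by rewrite normsqM normsq_phase mul1r.
have [h1 h2] := normsq_le_l1 h; rewrite {1}/l1; lra.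
Qed.

Lemma measurable_l1 f : cmeas (f : 'rV[mr]_n -> R[i]) -> measurable_fun setT (fun t : 'rV[mr]_n => l1 (f t)).
Proof. by move=> [f1 f2]; apply: measurable_funD; exact: measurableT_comp. Qed.

Lemma integral_Re_FT f (q : R[i]) (u : E) : cintegrable mu f ->
  (\int[mu]_t (complex.Re (f t * phase t u * q))%:E = (complex.Re (FT f u * q))%:E)%E.
Proof.
move=> jf; rewrite /FT -cintMr; last exact: cintegrable_phase.
have [jq _] := cintegrableMr q (cintegrable_phase u jf).
rewrite /cint [in RHS]/= /Rintegral fineK; first by [].
exact: (integrable_fin_num measurableT jq).
Qed.

(** The kernel is symmetric in its two variables, so Fubini moves the transform from one factor to
    the other. Real parts are taken because [ip] is a real inner product. *)
Lemma FT_multiplication f g : cintegrable mu f -> cintegrable mu g ->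
  \int[mu]_u complex.Re (FT f u * g u) = \int[mu]_t complex.Re (f t * FT g t).
Proof.
move=> jf jg; have mf := cintegrable_cmeas jf; have mg := cintegrable_cmeas jg.
pose h (p : 'rV[mr]_n * 'rV[mr]_n) := complex.Re (f p.2 * (phase p.2 p.1 * g p.1)).
have mh : measurable_fun setT h.
  have [] : cmeas (fun p : 'rV[mr]_n * 'rV[mr]_n => f p.2 * (phase p.2 p.1 * g p.1)) => //.
  apply: cmeasM; first exact: cmeas_comp.
  by apply: cmeasM; [exact: cmeas_phase|exact: cmeas_comp].
have lf := l1_integrable jf; have lg := l1_integrable jg.
pose A := \int[mu]_t l1 (f t).
have AE : (\int[mu]_t (l1 (f t))%:E = A%:E)%E by rewrite /A /Rintegral fineK// (integrable_fin_num measurableT lf).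
have ih : (mu \x mu)%E.-integrable setT (EFin \o h).
  apply/(integrable12ltyP mu mu); first exact/measurable_EFinP.
  have j2 := integrableZl measurableT (2 * A) lg.
  apply: le_lt_trans (integrable_lty measurableT j2).
  apply: ge0_le_integral => //.
  - by move=> u _; exact: integral_ge0.
  - apply: (@measurable_fun_integral_prod _ _ 'rV[mr]_n 'rV[mr]_n R mu (fun p => `|(h p)%:E|)%E).
    by apply: measurableT_comp => //; exact/measurable_EFinP.
  - exact: measurable_int j2.
  move=> u _; apply: (@le_trans _ _ (\int[mu]_t ((2 * l1 (g u))%:E * (l1 (f t))%:E))%E).
    apply: ge0_le_integral => //.
    + apply: measurableT_comp => //; apply/measurable_EFinP.
      by apply: (measurableT_comp mh); exact: measurable_pair1.
    + exact: measurable_int (integrableZl measurableT _ lf).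
    + move=> t _; rewrite -EFinM /h/= lee_fin; apply: le_trans (Re_le_l1 _ _) _.
      by rewrite [X in _ <= X]mulrC ler_wpM2l ?l1_ge0// l1_phase.
  by rewrite (integralZl measurableT lf) AE -!EFinM lee_fin mulrAC.
have F : (\int[mu]_u \int[mu]_t (h (u, t))%:E = \int[mu]_t \int[mu]_u (h (u, t))%:E)%E.
  exact: Fubini ih.
transitivity (fine (\int[mu]_u \int[mu]_t (h (u, t))%:E)%E).
  congr fine; apply: eq_integral => u _; rewrite -(integral_Re_FT _ _ jf).
  by apply: eq_integral => t _; rewrite /h/= mulrA.
rewrite F; congr fine; apply: eq_integral => t _.
rewrite [f t * _]mulrC -(integral_Re_FT _ _ jg); apply: eq_integral => u _.
by rewrite /h/= phaseC mulrC [phase _ _ * _]mulrC.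
Qed.

Lemma ip_conj f g : ip f (fun t => conjc (g t)) = \int[mu]_t complex.Re (f t * g t).
Proof.
apply: eq_Rintegral => t _; case: (f t) (g t) => a b [c e] /=; ring.
Qed.

Lemma normsq_conj (p : R[i]) : normsq (conjc p) = normsq p.
Proof. by case: p => a b; rewrite /normsq/= sqrrN. Qed.

Lemma conjcB (p q : R[i]) : conjc p - conjc q = conjc (p - q).
Proof. by case: p q => a b [c e]; rewrite /=; apply/eqP; rewrite eq_complex/=; apply/andP; split; apply/eqP; ring. Qed.

Lemma cmeas_conj f : cmeas (f : 'rV[mr]_n -> R[i]) -> cmeas ((fun t => conjc (f t)) : 'rV[mr]_n -> R[i]).
Proof.
move=> [f1 f2]; split.
  by rewrite (_ : (fun t => _) = (fun t => complex.Re (f t)))//; apply/funext => t; case: (f t).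
rewrite (_ : (fun t => _) = (fun t => - complex.Im (f t))); first exact: measurable_funN.
by apply/funext => t; case: (f t).
Qed.

Lemma nn_conj f : nn (fun t => conjc (f t)) = nn f.
Proof. by congr fine; apply: eq_integral => t _; rewrite normsq_conj. Qed.

Lemma L2_conj f : L2 f -> L2 (fun t => conjc (f t)).
Proof.
move=> [mf foo]; split; first exact: cmeas_conj.
by rewrite /N2; under eq_integral do rewrite normsq_conj.
Qed.

(** [FT_multiplication] for truncations, followed by the limit first in N and then in M through
    continuity of [ip] in each argument. *)
Lemma isF_adjoint x y z w : isF x y -> isF z w ->
  ip y (fun t => conjc (z t)) = ip x (fun t => conjc (w t)).
Proof.
move=> [Lx Ly xy] [Lz Lw zw].
have LFx N := (FT_trunc N Lx).1; have LFz N := (FT_trunc N Lz).1.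
have Lx' N := trunc_L2 N Lx; have Lz' N := trunc_L2 N Lz.
have trunc N M : ip (FT (restrict (cube N) x)) (fun t => conjc (restrict (cube M) z t)) =
    ip (restrict (cube N) x) (fun t => conjc (FT (restrict (cube M) z) t)).
  rewrite !ip_conj; apply: FT_multiplication.
    exact: csupp_cintegrable (@csupp_restrict _ _ N x) _.
  exact: csupp_cintegrable (@csupp_restrict _ _ M z) _.
have s1 M : ip y (fun t => conjc (restrict (cube M) z t)) = ip x (fun t => conjc (FT (restrict (cube M) z) t)).
  have c1 := cvg_ip LFx Ly (L2_conj (Lz' M)) xy.
  have c2 := cvg_ip Lx' Lx (L2_conj (LFz M)) (cvg_restrict_cube Lx).
  apply: (cvg_unique (@Rhausdorff R) c1).
  rewrite (_ : (fun N => _) = (fun N => ip (restrict (cube N) x) (fun t => conjc (FT (restrict (cube M) z) t))))//.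
  by apply/funext => N; exact: trunc.
have cz : nn (fun t => conjc (restrict (cube M) z t) - conjc (z t)) @[M --> \oo] --> (0 : R).
  rewrite (_ : (fun M => _) = (fun M => nn (fun t => restrict (cube M) z t - z t))); first exact: cvg_restrict_cube.
  by apply/funext => M; rewrite -nn_conj; congr nn; apply/funext => t; rewrite conjcB conjcK.
have cw : nn (fun t => conjc (FT (restrict (cube M) z) t) - conjc (w t)) @[M --> \oo] --> (0 : R).
  rewrite (_ : (fun M => _) = (fun M => nn (fun t => FT (restrict (cube M) z) t - w t)))//.
  by apply/funext => M; rewrite -nn_conj; congr nn; apply/funext => t; rewrite conjcB conjcK.
have c1 := cvg_ip (fun M => L2_conj (Lz' M)) (L2_conj Lz) Ly cz.
have c2 := cvg_ip (fun M => L2_conj (LFz M)) (L2_conj Lw) Lx cw.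
rewrite ipC [RHS]ipC; apply: (cvg_unique (@Rhausdorff R) c1).
rewrite (_ : (fun M => _) = (fun M => ip (fun t => conjc (FT (restrict (cube M) z) t)) x))//.
by apply/funext => M; rewrite ipC s1 ipC.
Qed.

(** Let y' be the transform of conj(w). The adjoint relation gives <y', y> = |w|^2, and isometry
    gives |y'| = |y| = |w|; hence |y' - y|^2 = 0. This exhibits an explicit preimage of y. *)
Lemma isF_inverse y w : isF (fun t => conjc (y t)) w -> isF (fun t => conjc (w t)) y.
Proof.
move=> Fyw; have [Lcy Lw _] := Fyw.
have Ly : L2 y by have := L2_conj Lcy; congr L2; apply/funext => t; rewrite conjcK.
have Lx := L2_conj Lw; set x := (fun t => conjc (w t)) in Lx *.
have [y' Fxy' _] := isF_exists Lx; have [_ Ly' _] := Fxy'.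
have n0 : nn (fun t => y' t - y t) = 0.
  rewrite nnB// (isF_isometry Fxy').
  have := isF_adjoint Fxy' Fyw; rewrite (_ : (fun t => conjc (conjc (y t))) = y); last by apply/funext => t; rewrite conjcK.
  by move=> ->; rewrite -nnE nn_conj (isF_isometry Fyw) nn_conj; ring.
have [my _] := Ly.
apply: (isF_ae Fxy' my).
by apply: filterS (nn_eq0_ae (L2B Ly' Ly) n0) => t /subr0_eq.
Qed.

Lemma isF_surj y : L2 y -> exists x, isF x y.
Proof.
move=> Ly; have [w Fw _] := isF_exists (L2_conj Ly).
by exists (fun t => conjc (w t)); exact: isF_inverse.
Qed.

(** The preimage from [isF_inverse] is the conjugate of an L2 limit of truncated integrals, which
    for integrable y also converge pointwise by dominated convergence. *)
Lemma isF_inversion x y : isF x y -> cintegrable mu y ->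
  {ae mu, forall t, x t = conjc (FT (fun u => conjc (y u)) t)}.
Proof.
move=> Fxy jy; have [_ Ly _] := Fxy.
have my := cintegrable_cmeas jy.
have jcy : cintegrable mu (fun u => conjc (y u)).
  apply: cintegrable_le (jy) _; first exact: cmeas_conj.
  by move=> t; rewrite normsq_conj.
have mcy := cintegrable_cmeas jcy.
have [w Fw _] := isF_exists (L2_conj Ly); have [_ Lw cw] := Fw.
have pt : {ae mu, forall t, ccvg (fun N => FT (restrict (cube N) (fun u => conjc (y u))) t) (FT (fun u => conjc (y u)) t)}.
  apply: aeW => t; apply: FT_dct => //.
  - by move=> N; apply: restrict_cmeas => //; exact: measurable_cube.
  - by move=> s; exact: ccvg_cube.
  - by move=> N s; exact: normsq_restrict.
have ae1 := L2_ptwise_limit (fun N => (FT_trunc N (L2_conj Ly)).1) Lw (cmeas_FT mcy) cw pt.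
have ae2 := isF_inj Fxy (isF_inverse Fw).
by apply: filterS2 ae1 ae2 => t -> ->.
Qed.

End adjoint.

(** * The transforms of the statement in terms of [isF] *)

Section fourier_defs.
Context {R : realType} (n : nat).
Notation mr := (measurableTypeR R).
Notation mu := (lebesgue_rV R n).
Notation E := 'rV[R]_n.
Notation L2 := (@L2 _ 'rV[mr]_n R mu).
Notation N2 := (@N2 _ 'rV[mr]_n R mu).
Notation nn := (@nn _ 'rV[mr]_n R mu).
Implicit Types f g x y : E -> R[i].

Lemma L2normE f : L2norm f = (N2 f `^ 2^-1)%E.
Proof.
have two0 : 2 != 0 :> R by [].
have -> : N2 f = (L2norm f `^ 2)%E.
  rewrite poweR_Lnorm//; apply: eq_integral => t _.
  have nc0 (z : R[i]) : 0 <= ComplexField.Normc.normc z by case: z => a b; exact: sqrtr_ge0.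
  by rewrite /= ?poweR_EFin ger0_norm// powR_mulrn// normsqE.
by rewrite -poweRrM divff// poweRe1// Lnorm_ge0.
Qed.

Lemma L2norm_sqrt f : L2 f -> L2norm f = (Num.sqrt (nn f))%:E.
Proof. by move=> Lf; rewrite L2normE -nnK// poweR_EFin powR12_sqrt// nn_ge0. Qed.

Lemma memL2P f : memL2 f <-> L2 f.
Proof.
split=> [[mf foo]|Lf].
  split => //; rewrite ltey; apply/eqP => N2y; move: foo; rewrite L2normE N2y.
  by rewrite poweRyr ?ltxx// invr_eq0.
by split; [have [] := Lf|rewrite L2norm_sqrt// ltry].
Qed.

Lemma is_fourierP x y : is_fourier x y <-> isF x y.
Proof.
have key (Lx : L2 x) (Ly : L2 y) :
    (L2norm (fun u => y u - fourier_trunc N x u) @[N --> \oo] --> 0%E) <->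
    (nn (fun u => FT (restrict (cube N) x) u - y u) @[N --> \oo] --> (0 : R)).
  have LB N := L2B (FT_trunc N Lx).1 Ly.
  have LB' N := L2B Ly (FT_trunc N Lx).1.
  have -> : (fun N => L2norm (fun u => y u - fourier_trunc N x u)) =
      (fun N => (Num.sqrt (nn (fun u => FT (restrict (cube N) x) u - y u)))%:E).
    by apply/funext => N; rewrite fourier_truncE L2norm_sqrt// nn_sym.
  split=> h.
    have h1 : Num.sqrt (nn (fun u => FT (restrict (cube N) x) u - y u)) @[N --> \oo] --> (0 : R).
      exact: (@fine_cvg R _ _ _ _ 0 h).
    have hh := cvgM h1 h1; rewrite mulr0 in hh.
    rewrite (_ : (fun N => nn (fun u => FT (restrict (cube N) x) u - y u)) =
      (fun N => Num.sqrt (nn (fun u => FT (restrict (cube N) x) u - y u)) * Num.sqrt (nn (fun u => FT (restrict (cube N) x) u - y u)))); first exact: hh.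
    by apply/funext => N; rewrite -expr2 sqr_sqrtr// nn_ge0.
  apply: (@cvg_EFin R _ _ _ _ 0); first exact: nearW.
  rewrite -(@sqrtr0 R); apply: (cvg_comp _ _ h); exact: sqrt_continuous.
split=> [[/memL2P Lx /memL2P Ly /(key Lx Ly)]//|[Lx Ly /(key Lx Ly)]].
by split => //; exact/memL2P.
Qed.

Lemma fourierP x : L2 x -> isF x (fourier x).
Proof.
move=> Lx; have [y Fxy _] := isF_exists Lx.
apply/is_fourierP; rewrite /fourier; case: xgetP => // /(_ y) []; exact/is_fourierP.
Qed.

Lemma inv_fourierP y : L2 y -> isF (inv_fourier y) y.
Proof.
move=> Ly; rewrite /inv_fourier; case: asboolP => [_|/memL2P//].
have [x Fxy] := isF_surj Ly.
apply/is_fourierP; case: xgetP => // /(_ x) []; exact/is_fourierP.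
Qed.

(** Conjugating twice turns the inversion integral into [FT], so that the results on [FT] apply;
    [inversion_integralE] gives the usual form. *)
Definition inversion_integral y (t : E) : R[i] := conjc (FT (fun u => conjc (y u)) t).

Lemma cintegrable_conj y : cintegrable mu y -> cintegrable mu (fun u => conjc (y u)).
Proof.
move=> jy; apply: cintegrable_le (jy) _; first exact/cmeas_conj/cintegrable_cmeas.
by move=> t; rewrite normsq_conj.
Qed.

Lemma inversion_integralE y t : cintegrable mu y ->
  inversion_integral y t = cintegral setT (fun u => y u * cexpi (2 * pi * dotv t u)).
Proof.
move=> jy; have [_ j2] := cintegrable_phase t (cintegrable_conj jy).
rewrite /inversion_integral /cintegral /FT /cint /=; congr Complex.
  apply: eq_Rintegral => u _; rewrite phaseC /phase; case: (y u) => a b /=.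
  by rewrite cosN sinN; ring.
rewrite -mulN1r -(RintegralZl _ measurableT j2).
apply: eq_Rintegral => u _; rewrite phaseC /phase; case: (y u) => a b /=.
by rewrite cosN sinN; ring.
Qed.

(** In the L2 branch of [inv_fourier] this is the inversion theorem, in the other branch it is the
    definition. *)
Lemma inv_fourier_ae y : cintegrable mu y -> {ae mu, forall t, inv_fourier y t = inversion_integral y t}.
Proof.
move=> jy; have my := cintegrable_cmeas jy.
have [Ly|nLy] := pselect (L2 y); first exact: (isF_inversion (inv_fourierP Ly)).
apply: aeW => t; rewrite /inv_fourier; case: asboolP => [/memL2P//|_].
by rewrite inversion_integralE.
Qed.

End fourier_defs.

(** * Continuity and size of the inversion integral *)

Section inversion_integral_regularity.
Context {R : realType} (n : nat).
Notation mr := (measurableTypeR R).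
Notation mu := (lebesgue_rV R n).
Notation E := 'rV[R]_n.
Implicit Types f y : E -> R[i].

(** Balls of radius 1 / (k + 1) form a neighbourhood base. Sequences are the form in which dominated
    convergence delivers continuity. *)
Lemma sequentially_continuous (g : E -> R) :
  (forall (u : E) (v : nat -> E), (forall i, v k ord0 i @[k --> \oo] --> u ord0 i) ->
    g (v k) @[k --> \oo] --> g u) -> continuous g.
Proof.
move=> H u; have FF : Filter (nbhs u) by exact: nbhs_filter.
apply/(@cvgrPdist_lt _ _ _ _ FF) => e e0; apply: contrapT => nH.
have /choice[v vP] : forall k : nat, exists v : E, ball u (k.+1%:R^-1) v /\ ~ `|g u - g v| < e.
  move=> k; apply: contrapT => nk; apply: nH; apply/nbhs_ballP; exists (k.+1%:R^-1); first by rewrite /= invr_gt0.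
  by move=> v uv; apply: contrapT => nv; apply: nk; exists v.
have vu i : v k ord0 i @[k --> \oo] --> u ord0 i.
  apply/cvgrPdist_lt => a a0; near=> k.
  have [[_ /(_ ord0 i)]] := vP k; rewrite /ball/= => h _.
  apply: lt_trans h _; near: k; exact: (near_infty_natSinv_lt (PosNum a0)).
have /cvgrPdist_lt/(_ e e0)[N _ /(_ N (leqnn N))/=] := H u v vu.
by have [] := vP N.
Unshelve. all: by end_near. Qed.

(** If g and h differed at t they would differ on a box around t, and boxes have positive
    measure. *)
Lemma ae_eq_continuous (g h : E -> R) : continuous g -> continuous h ->
  {ae mu, forall t, g t = h t} -> g = h.
Proof.
move=> cg ch [A [mA A0 gA]]; apply/funext => t; apply: contrapT => /eqP gh.
have FF : Filter (nbhs t) by exact: nbhs_filter.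
have cgh : (fun s => g s - h s) @ t --> g t - h t by apply: (@cvgB _ _ _ _ FF); [exact: (cg t)|exact: (ch t)].
have gh0 : g t - h t != 0 by rewrite subr_eq0.
have /nbhs_ballP[r /= r0 te] := @cvgr_neq0 _ _ _ _ FF _ _ cgh gh0.
pose I (i : 'I_n) : set R := `](t ord0 i - r), (t ord0 i + r)[%classic.
pose B := [set s : E | forall i, I i (s ord0 i)].
have BA : B `<=` A.
  apply: subset_trans gA => s Bs /= /eqP; apply/negP; rewrite -subr_eq0; apply: te; split => // i j.
  by rewrite (ord1 i) /ball/= ltr_distlC; have := Bs j; rewrite /I /= in_itv.
have mB : measurable (B : set 'rV[mr]_n) by apply: (@measurable_rV_box R n I) => i; exact: measurable_itv.
have : (mu B <= mu A)%E by apply: le_measure; rewrite ?inE.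
rewrite A0 (@lebesgue_rV_box R n I); last by move=> i; exact: measurable_itv.
apply/negP; rewrite -ltNge; under eq_bigr do rewrite lebesgue_measure_itv/=.
have -> : (\prod_(i < n) (if (t ord0 i - r)%:E < (t ord0 i + r)%:E then (t ord0 i + r)%:E - (t ord0 i - r)%:E else 0) = (\prod_(i < n) (r + r))%:E :> \bar R)%E.
  rewrite -prodEFin; apply: eq_bigr => i _; rewrite lte_fin ifT; last by lra.
  by rewrite -EFinB; congr EFin; ring.
by rewrite lte_fin; apply: prodr_gt0 => i _; rewrite addr_gt0.
Qed.

Lemma FT_continuous f (u : E) (v : nat -> E) : cintegrable mu f ->
  (forall i, v k ord0 i @[k --> \oo] --> u ord0 i) -> ccvg (fun k => FT f (v k)) (FT f u).
Proof.
move=> jf vu; have mf := cintegrable_cmeas jf.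
apply: (@cint_dct R n (fun k t => f t * phase t (v k)) (fun t => f t * phase t u) f).
- by move=> k; apply: cmeasM => //; exact: cmeas_phase1.
- by apply: cmeasM => //; exact: cmeas_phase1.
- exact: jf.
- move=> t; apply: ccvgM; first exact: ccvg_cst.
  have h : - (2 * pi * dotv t (v k)) @[k --> \oo] --> - (2 * pi * dotv t u).
    apply: cvgN; apply: cvgMr; apply: cvg_big => [|i _]; first exact: add_continuous.
    by apply: cvgMr; exact: vu.
  split; first exact: (cvg_comp _ _ h (@continuous_cos R _)).
  exact: (cvg_comp _ _ h (@continuous_sin R _)).
- by move=> k t; rewrite normsqM normsq_phase mulr1.
Qed.

Lemma inversion_integral_continuous y : cintegrable mu y ->
  continuous (fun t => complex.Re (inversion_integral y t)) /\
  continuous (fun t => complex.Im (inversion_integral y t)).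
Proof.
have ReC (z : R[i]) : complex.Re (conjc z) = complex.Re z by case: z.
have ImC (z : R[i]) : complex.Im (conjc z) = - complex.Im z by case: z.
move=> /cintegrable_conj jy; split; apply: sequentially_continuous => u v vu; rewrite /inversion_integral.
  under eq_fun do rewrite ReC; rewrite ReC; exact: (FT_continuous jy vu).1.
under eq_fun do rewrite ImC; rewrite ImC; apply: cvgN; exact: (FT_continuous jy vu).2.
Qed.

(** Multiplication by the conjugate of Z = [FT f u] turns the integral into |Z|^2, which is then at
    most |Z| times the integral of |f|. *)
Lemma normc_FT_le f (u : E) : cintegrable mu f ->
  ((ComplexField.Normc.normc (FT f u))%:E <= \int[mu]_t (Num.sqrt (normsq (f t)))%:E)%E.
Proof.
move=> jf; have mf := cintegrable_cmeas jf; set Z := FT f u.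
have ZE : ComplexField.Normc.normc Z = Num.sqrt (normsq Z) by case: (Z).
have [Z0|Z0] := eqVneq (normsq Z) 0.
  by rewrite ZE Z0 sqrtr0; apply: integral_ge0 => t _; rewrite lee_fin sqrtr_ge0.
have Zp : 0 < Num.sqrt (normsq Z) by rewrite sqrtr_gt0 lt_neqAle eq_sym Z0 normsq_ge0.
have ms : measurable_fun setT (fun t : 'rV[mr]_n => (Num.sqrt (normsq (f t)))%:E).
  apply/measurable_EFinP; have mq := @measurable_normsq _ 'rV[mr]_n R _ mf.
  by apply: (measurableT_comp _ mq); apply: continuous_measurable_fun; exact: sqrt_continuous.
rewrite -(@lee_pmul2r _ (Num.sqrt (normsq Z))%:E)//.
rewrite -(ge0_integralZr mu measurableT ms) => [|t _|]; [|by rewrite lee_fin sqrtr_ge0|by rewrite lee_fin ltW].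
rewrite -EFinM ZE -expr2 sqr_sqrtr ?normsq_ge0//.
have -> : normsq Z = complex.Re (FT f u * conjc Z).
  by rewrite -/Z /normsq; case: (Z) => a b /=; ring.
rewrite -(integral_Re_FT _ _ jf).
have mg : measurable_fun setT (fun t : 'rV[mr]_n => (complex.Re (f t * phase t u * conjc Z))%:E).
  apply/measurable_EFinP.
  by have [] := cmeasM (cmeasM mf (cmeas_phase1 u)) (@cmeas_cst _ _ _ (conjc Z)).
apply: le_trans (lee_abs _) _; apply: le_trans (le_abse_integral mu measurableT mg) _.
apply: ge0_le_integral => //.
- by apply: measurableT_comp.
- by apply: emeasurable_funM => //; exact: measurable_cst.
have -> : complex.Re (FT f u * conjc Z) = normsq Z by rewrite -/Z /normsq; case: (Z) => a b /=; ring.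
move=> t _; rewrite abse_EFin -EFinM lee_fin -sqrtrM ?normsq_ge0//.
have -> : normsq (f t) * normsq Z = normsq (f t * phase t u * conjc Z).
  by rewrite !normsqM normsq_phase normsq_conj mulr1.
rewrite -sqrtr_sqr ler_wsqrtr// /normsq; set w := (_ * _ * _).
by rewrite lerDl sqr_ge0.
Qed.

Lemma normc_inversion_le y (t : E) : cintegrable mu y ->
  ((ComplexField.Normc.normc (inversion_integral y t))%:E <= \int[mu]_u (Num.sqrt (normsq (y u)))%:E)%E.
Proof.
move=> /cintegrable_conj jy; have := normc_FT_le t jy.
rewrite /inversion_integral; under eq_integral do rewrite normsq_conj.
have nC (z : R[i]) : ComplexField.Normc.normc (conjc z) = ComplexField.Normc.normc z by case: z => a b /=; rewrite sqrrN.
by rewrite nC.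
Qed.

End inversion_integral_regularity.

(** * Integrals over the orthant *)

Section orthant_integrals.
Context {R : realType}.
Notation leb := (@lebesgue_measure R).
Notation mr := (measurableTypeR R).
Notation lrV := (lebesgue_rV R).

Lemma ge0_integral_abs1 (c : R) (H : R -> \bar R) : 0 < c -> measurable_fun setT H ->
  (forall s, 0 <= H s)%E ->
  (\int[leb]_s H (c * `|s|)%R = (2 / c)%:E * \int[leb]_(s in `]0%R, +oo[) H s)%E.
Proof.
move=> c0 mH H0.
have mI : measurable (`[0%R, +oo[%classic : set mr) by exact: measurable_itv.
have mHc : measurable_fun setT (fun s : mr => H (c * `|s|)%R).
  by apply: measurableT_comp => //; apply: measurable_funM => //; exact: normr_measurable.
have mHr : measurable_fun setT (H \_ `[0%R, +oo[ : mr -> \bar R).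
  by apply: (iffLR (@measurable_restrictT _ _ mr _ _ H mI)); exact: measurable_funTS.
rewrite (@ge0_integral_symmetric R (fun s => H (c * `|s|)%R))//.
have -> : (\int[leb]_(u in `[0%R, +oo[) (H (c * `|u|)%R + H (c * `|- u|)%R) =
    \int[leb]_(u in `[0%R, +oo[) (2%:E * (H \_ `[0%R, +oo[) (c * u + 0)%R))%E.
  apply: eq_integral => u; rewrite inE/= in_itv/= andbT => u0.
  rewrite normrN ger0_norm// addr0 patchE mem_set/=; last by rewrite in_itv/= andbT mulr_ge0// ltW.
  by rewrite mule_natl mule2n.
rewrite integral_mkcond.
have -> : (\int[leb]_u ((fun u => 2%:E * (H \_ `[0%R, +oo[) (c * u + 0)%R) \_ `[0%R, +oo[) u =
    \int[leb]_u (2%:E * (H \_ `[0%R, +oo[) (c * u + 0)%R))%E.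
  apply: eq_integral => u _; rewrite patchE; case: ifPn => //.
  rewrite notin_setE/= in_itv/= andbT => /negP; rewrite -ltNge => u0.
  rewrite patchE memNset ?mule0//= in_itv/= andbT; apply/negP; rewrite -ltNge addr0.
  by rewrite nmulr_llt0.
have h0 s : (0 <= (H \_ `[0%R, +oo[) s)%E by apply: erestrict_ge0 => x _; exact: H0.
rewrite ge0_integralZl//.
- rewrite ge0_integral_affine// -integral_mkcond integral_itv_obnd_cbnd; last exact: measurable_funTS.
  by rewrite muleA -EFinM.
- apply: (measurableT_comp mHr); apply: measurable_funD => //; exact: measurable_funM.
Qed.

Lemma orthantE n : @orthant R n = [set t | forall i, `]0, +oo[%classic (t ord0 i)].
Proof. by apply/seteqP; split => t /= h i; have := h i; rewrite /= in_itv/= andbT. Qed.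

Lemma measurable_orthant n : measurable (@orthant R n : set 'rV[mr]_n).
Proof. by rewrite orthantE; apply: (@measurable_rV_box R n (fun=> `]0, +oo[%classic)) => i; exact: measurable_itv. Qed.

Lemma orthant_cons n (s : R) (v : 'rV[mr]_n) :
  orthant (cons_rV (s : mr, v) : 'rV[R]_n.+1) <-> (0 < s /\ orthant (v : 'rV[R]_n)).
Proof.
split=> [h|[s0 v0] i].
  split; first by have := h ord0; rewrite cons_rV0.
  by move=> i; have := h (lift ord0 i); rewrite cons_rVS.
by case: (unliftP ord0 i) => [j ->|->]; rewrite ?cons_rVS ?cons_rV0.
Qed.

Lemma measurable_cons_slice n (s : R) : measurable_fun setT (fun v : 'rV[mr]_n => cons_rV (s : mr, v)).
Proof.
apply: (measurableT_comp (@measurable_cons_rV _ mr n)).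
by apply/measurable_fun_pairP; split; [exact: measurable_cst|exact: measurable_id].
Qed.

(** Each coordinate contributes a factor 2 for its two signs and 1 / c for the scaling; the
    dimension is handled by Tonelli and induction. *)
Lemma ge0_integral_abs n (c : R) (G : 'rV[mr]_n -> \bar R) : 0 < c -> measurable_fun setT G ->
  (forall t, 0 <= G t)%E ->
  (\int[lrV n]_t G (c *: vabs t)%R = ((2 / c) ^+ n)%:E * \int[lrV n]_(t in orthant) G t)%E.
Proof.
move=> c0; elim: n => [|n IH] in G *; move=> mG G0.
  have mv : measurable_fun setT (fun t : 'rV[mr]_0 => G (c *: vabs t)%R).
    rewrite (_ : (fun _ => _) = G) //; apply/funext => t; congr G; by apply/rowP; case.
  have mo := @measurable_orthant 0.
  rewrite expr0 mul1e /= !integral_dirac//; last exact: measurable_funTS.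
  rewrite !diracE !mem_set// ?mul1e; last by case.
  by congr G; apply/rowP; case.
have consE s (v : 'rV[mr]_n) : (c *: vabs (cons_rV (s : mr, v) : 'rV[R]_n.+1))%R =
    cons_rV ((c * `|s|)%R : mr, (c *: vabs v)%R : 'rV[mr]_n).
  apply/rowP => i; case: (unliftP ord0 i) => [j ->|->]; rewrite [LHS]mxE [X in c * X]mxE.
    by rewrite !cons_rVS !mxE.
  by rewrite !cons_rV0.
have mabs : measurable_fun setT (fun t : 'rV[mr]_n.+1 => (c *: vabs t)%R : 'rV[mr]_n.+1).
  apply: measurable_fun_rV => i; rewrite (_ : (fun _ => _) = (fun t : 'rV[mr]_n.+1 => c * `|t ord0 i|)).
    apply: measurable_funM => //; apply: (measurableT_comp (@normr_measurable R setT)); exact: measurable_coord.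
  by apply/funext => t; rewrite !mxE.
rewrite ge0_integral_rVS//; last exact: (measurableT_comp mG mabs).
pose GO := G \_ (@orthant R n.+1 : set 'rV[mr]_n.+1).
have mGO : measurable_fun setT GO.
  by apply: (iffLR (@measurable_restrictT _ _ 'rV[mr]_n.+1 _ _ G (@measurable_orthant n.+1))); exact: measurable_funTS.
have GO0 t : (0 <= GO t)%E by apply: erestrict_ge0.
pose H' (s : mr) := (\int[lrV n]_(v in @orthant R n) G (cons_rV (s, v)))%E.
have mH : measurable_fun setT H'.
  rewrite (_ : H' = fun s => (\int[lrV n]_v ((G \o @cons_rV _ mr n) (s, v) * (\1_(@orthant R n) v)%:E))%E).
    apply: (@measurable_fun_integral_prod _ _ mr 'rV[mr]_n R (lrV n)
      (fun p => (G \o @cons_rV _ mr n) p * (\1_(@orthant R n) p.2)%:E)%E).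
    apply: emeasurable_funM; first exact: (measurableT_comp mG (@measurable_cons_rV _ mr n)).
    apply/measurable_EFinP.
    have mi : measurable_fun setT (\1_(@orthant R n) : 'rV[mr]_n -> R) by apply: measurable_indic; exact: measurable_orthant.
    exact: (measurableT_comp mi (@measurable_snd _ _ mr 'rV[mr]_n)).
  apply/funext => s; rewrite /H' integral_mkcond; apply: eq_integral => v _.
  by rewrite patchE indicE /=; case: (v \in _); rewrite ?mule1 ?mule0.
have H0 s : (0 <= H' s)%E by apply: integral_ge0 => v _; exact: G0.
transitivity (\int[leb]_s (((2 / c) ^+ n)%:E * H' (c * `|s|)%R))%E.
  apply: eq_integral => s _.
  under eq_integral do rewrite consE.
  rewrite (IH (fun v => G (cons_rV ((c * `|s|)%R : mr, v))))//.
  exact: (measurableT_comp mG (@measurable_cons_slice n _)).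
have e0 : 0 <= (2 / c) ^+ n by rewrite exprn_ge0// divr_ge0// ltW.
rewrite ge0_integralZl//; last first.
  by apply: (measurableT_comp mH); apply: measurable_funM => //; exact: normr_measurable.
rewrite (@ge0_integral_abs1 c H')// muleA -EFinM -exprSr; congr (_ * _)%E.
have -> : (\int[lrV n.+1]_(t in orthant) G t = \int[lrV n.+1]_t GO t)%E by rewrite integral_mkcond.
rewrite (ge0_integral_rVS mGO GO0) integral_mkcond.
apply: eq_integral => s _; rewrite patchE; case: ifPn => [|].
  rewrite inE/= in_itv/= andbT => s0; rewrite /H' integral_mkcond; apply: eq_integral => v _.
  rewrite /GO !patchE; congr (if _ then _ else _).
  apply/idP/idP; rewrite !inE => h; first exact/orthant_cons.
  by move/orthant_cons : h => [].
rewrite notin_setE/= in_itv/= andbT => s0.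
by rewrite integral0_eq// => v _; rewrite /GO patchE memNset// => /orthant_cons[].
Qed.

Lemma ge0_integral_prod_le n (psi : 'I_n -> R -> R) (c : 'I_n -> R) :
  (forall i, measurable_fun setT (psi i : mr -> R)) -> (forall i s, 0 <= psi i s) ->
  (forall i, \int[leb]_s (psi i s)%:E <= (c i)%:E)%E ->
  (\int[lrV n]_t (\prod_i psi i (t ord0 i))%:E <= (\prod_i c i)%:E)%E.
Proof.
elim: n => [|n IH] in psi c *; move=> mpsi psi0 psic.
  under eq_integral do rewrite big_ord0.
  rewrite integral_cst; last exact: measurableT.
  by rewrite mul1e big_ord0 /= diracE mem_set.
have c0 i : 0 <= c i by rewrite -lee_fin; apply: le_trans (psic i); apply: integral_ge0 => s _; rewrite lee_fin.
have mp k (f : 'I_k -> R -> R) : (forall i, measurable_fun setT (f i : mr -> R)) ->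
    measurable_fun setT (fun t : 'rV[mr]_k => (\prod_i f i (t ord0 i))%:E).
  move=> mf; apply/measurable_EFinP; apply: measurable_prod => i _.
  by apply: (measurableT_comp (mf i)); exact: measurable_coord.
rewrite ge0_integral_rVS; [|exact: mp|by move=> t; rewrite lee_fin prodr_ge0].
pose psi' i := psi (lift ord0 i); pose c' := \prod_i c (lift ord0 i).
apply: (@le_trans _ _ (\int[leb]_s ((psi ord0 s)%:E * c'%:E))%E); last first.
  have m0 : measurable_fun setT (fun s : mr => (psi ord0 s)%:E) by apply/measurable_EFinP.
  have p0 (s : mr) : setT s -> (0 <= (psi ord0 s)%:E)%E by rewrite lee_fin.
  have c'0 : (0 <= c'%:E)%E by rewrite lee_fin prodr_ge0.
  rewrite (ge0_integralZr leb measurableT m0 p0 c'0) big_ord_recl EFinM.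
  by apply: lee_pmul => //; exact: integral_ge0.
apply: ge0_le_integral => //.
- by move=> s _; apply: integral_ge0 => v _; rewrite lee_fin prodr_ge0.
- apply: (@measurable_fun_integral_prod _ _ mr 'rV[mr]_n R (lrV n)
      (fun p => (\prod_i psi i (cons_rV p ord0 i))%:E)).
  exact: (measurableT_comp (mp _ _ mpsi) (@measurable_cons_rV _ mr n)).
- by apply: emeasurable_funM => //; exact/measurable_EFinP.
move=> s _.
have -> : (\int[lrV n]_v (\prod_i psi i (cons_rV (s, v) ord0 i))%:E =
   \int[lrV n]_v ((psi ord0 s)%:E * (\prod_i psi' i (v ord0 i))%:E))%E.
  apply: eq_integral => v _; rewrite -EFinM big_ord_recl cons_rV0; congr (_ * _)%:E.
  by apply: eq_bigr => i _; rewrite cons_rVS.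
have m1 : measurable_fun setT (fun v : 'rV[mr]_n => (\prod_i psi' i (v ord0 i))%:E) by apply: mp => i; exact: mpsi.
have p1 (v : 'rV[mr]_n) : setT v -> (0 <= (\prod_i psi' i (v ord0 i))%:E)%E.
  by move=> _; rewrite lee_fin; apply: prodr_ge0 => i _; exact: psi0.
have p2 : (0 <= (psi ord0 s)%:E)%E by rewrite lee_fin.
rewrite (ge0_integralZl (lrV n) measurableT m1 p1 p2).
apply: lee_wpmul2l => //; apply: IH => i; [exact: mpsi|exact: psi0|exact: psic].
Qed.

End orthant_integrals.

(** * Unit cells of the integer lattice *)

Section cells.
Context {R : realType} (d : nat).
Notation leb := (@lebesgue_measure R).
Notation mr := (measurableTypeR R).
Notation mu := (lebesgue_rV R d).
Implicit Types (n : 'rV[int]_d) (f : 'rV[mr]_d -> \bar R).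

(** Half-open cells tile the space exactly, whereas the closed cells of the statement overlap in
    null sets; [integral_hcell] passes between them. *)
Definition hcell n : set 'rV[R]_d :=
  [set t | forall i, (n ord0 i)%:~R - 2^-1 <= t ord0 i < (n ord0 i)%:~R + 2^-1].

Lemma hcellE n : hcell n = [set t | forall i, `[(n ord0 i)%:~R - 2^-1, (n ord0 i)%:~R + 2^-1[%classic (t ord0 i)].
Proof. by apply/seteqP; split => t /= h i; have := h i; rewrite /= in_itv. Qed.

Lemma cellE n : @cell R d n = [set t | forall i, `[(n ord0 i)%:~R - 2^-1, (n ord0 i)%:~R + 2^-1]%classic (t ord0 i)].
Proof. by apply/seteqP; split => t /= h i; have := h i; rewrite /= in_itv. Qed.

Let half_lt (z : R) : z - 2^-1 < z + 2^-1. Proof. lra. Qed.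
Let halfE (z : R) : z + 2^-1 - (z - 2^-1) = 1. Proof. by lra. Qed.

Lemma measurable_hcell n : measurable (hcell n : set 'rV[mr]_d).
Proof.
rewrite hcellE; apply: (@measurable_rV_box R d (fun i => `[(n ord0 i)%:~R - 2^-1, (n ord0 i)%:~R + 2^-1[%classic)) => i.
exact: measurable_itv.
Qed.

Lemma measurable_cell n : measurable (cell n : set 'rV[mr]_d).
Proof.
rewrite cellE; apply: (@measurable_rV_box R d (fun i => `[(n ord0 i)%:~R - 2^-1, (n ord0 i)%:~R + 2^-1]%classic)) => i.
exact: measurable_itv.
Qed.

Lemma lebesgue_hcell n : mu (hcell n) = 1%E.
Proof.
rewrite hcellE (@lebesgue_rV_box R d (fun i => `[(n ord0 i)%:~R - 2^-1, (n ord0 i)%:~R + 2^-1[%classic)); last first.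
  by move=> i; exact: measurable_itv.
apply: big1 => i _; rewrite lebesgue_measure_itv/= lte_fin half_lt -EFinB; congr EFin; exact: halfE.
Qed.

Lemma lebesgue_cell n : mu (cell n) = 1%E.
Proof.
rewrite cellE (@lebesgue_rV_box R d (fun i => `[(n ord0 i)%:~R - 2^-1, (n ord0 i)%:~R + 2^-1]%classic)); last first.
  by move=> i; exact: measurable_itv.
apply: big1 => i _; rewrite lebesgue_measure_itv/= lte_fin half_lt -EFinB; congr EFin; exact: halfE.
Qed.

Lemma hcell_sub n : hcell n `<=` cell n.
Proof. by move=> t h i; have /andP[-> /ltW] := h i. Qed.

Lemma integral_hcell n f : measurable_fun setT f -> (forall t, 0 <= f t)%E ->
  (\int[mu]_(t in cell n) f t = \int[mu]_(t in hcell n) f t)%E.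
Proof.
move=> mf f0.
have mh := measurable_hcell n; have mc := measurable_cell n.
have mD : measurable (cell n `\` hcell n : set 'rV[mr]_d) by exact: measurableD.
rewrite (@ge0_negligible_integral _ _ _ mu _ (cell n `\` hcell n))//.
- by rewrite setDD; congr (integral _ _ _); apply/setIidPr; exact: hcell_sub.
- exact: measurable_funTS.
- have mo : (mu (cell n) < +oo)%E by rewrite lebesgue_cell ltry.
  rewrite (measureD mc mh mo).
  have -> : cell n `&` hcell n = hcell n by apply/setIidPr; exact: hcell_sub.
  apply: (@etrans _ _ (1 - 1)%E); last by rewrite subee.
  by congr (_ - _)%E; [exact: lebesgue_cell|exact: lebesgue_hcell].
Qed.

Lemma hcell_inj n n' t : hcell n t -> hcell n' t -> n = n'.
Proof.
move=> h h'; apply/rowP => i; have /andP[h1 h2] := h i; have /andP[h3 h4] := h' i.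
have a1 : (n ord0 i)%:~R < ((n' ord0 i) + 1)%:~R :> R by rewrite intrD; lra.
have a2 : (n' ord0 i)%:~R < ((n ord0 i) + 1)%:~R :> R by rewrite intrD; lra.
by apply/eqP; rewrite eq_le -!ltzD1 -!(ltr_int R) a1.
Qed.

(** Countable additivity, with [pickle] numbering the lattice points so that the cells form a
    sequence that is empty at all other indices. *)
Lemma esum_hcell (P : set 'rV[int]_d) f : measurable_fun setT f -> (forall t, 0 <= f t)%E ->
  (\esum_(n in P) \int[mu]_(t in hcell n) f t =
   \int[mu]_(t in \bigcup_(n in P) hcell n) f t)%E.
Proof.
move=> mf f0.
pose F (j : nat) : set 'rV[mr]_d := \bigcup_(n in [set n | P n /\ pickle n = j]) hcell n.
have FE n : P n -> F (pickle n) = hcell n.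
  move=> Pn; apply/seteqP; split => [t [n' [_ /(pcan_inj pickleK) ->]]//|t ht].
  by exists n.
have F0 j : ~ (exists2 n, P n & pickle n = j) -> F j = set0.
  by move=> nj; apply/seteqP; split => // t [n [Pn nE] _]; apply: nj; exists n.
have mF j : measurable (F j).
  have [[n Pn <-]|/F0->//] := pselect (exists2 n, P n & pickle n = j).
  by rewrite FE//; exact: measurable_hcell.
have -> : \bigcup_(n in P) hcell n = \bigcup_j F j.
  apply/seteqP; split => [t [n Pn ht]|t [j _ [n [Pn _] ht]]]; last by exists n.
  by exists (pickle n) => //; exists n.
rewrite ge0_integral_bigcup//; last 2 first.
- exact: measurable_funTS.
- apply/trivIsetP => i j _ _ ij; apply/seteqP; split => // t [[n [_ ni] hn] [n' [_ nj] hn']].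
  by move: ij; rewrite -ni -nj (hcell_inj hn hn') eqxx.
rewrite nneseries_esumT; last by move=> j; exact: integral_ge0.
transitivity (\esum_(n in P) \int[mu]_(t in F (pickle n)) f t)%E.
  by apply: eq_esum => n Pn; rewrite FE.
rewrite -(@esum_image R _ _ P pickle (fun j => \int[mu]_(t in F j) f t)%E); last first.
  by move=> n n' _ _ /(pcan_inj pickleK).
rewrite esum_mkcond; apply: eq_esum => j _; case: ifPn => //.
rewrite notin_setE/= => nj; rewrite F0 ?integral_set0// => -[n Pn nE]; apply: nj; exists n.
Qed.

(** The lattice points whose cells lie in the region |t_i| >= N + 1/2 for all i. For N = 0 this is
    [lattice_star]. *)
Definition far (N : nat) : set 'rV[int]_d := [set n | forall i, N.+1%:Z <= `|n ord0 i|].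

Lemma far_lattice N : far N `<=` lattice_star.
Proof.
move=> n h /=; apply/prodf_neq0 => i _; have := h i; lia.
Qed.

Lemma lattice_far n : lattice_star n -> far 0 n.
Proof. by move=> /prodf_neq0 h i; have := h i isT; lia. Qed.

Lemma far_cover N : [set t : 'rV[R]_d | forall i, N%:R + 2^-1 < `|t ord0 i|] `<=`
  \bigcup_(n in far N) hcell n.
Proof.
(* The nearest lattice point, halves rounded up to match the half-open cells. *)
move=> t h; exists (\row_i Num.floor (t ord0 i + 2^-1)).
  move=> i; rewrite mxE; have := h i; have /andP[] := floor_itv (t ord0 i + 2^-1).
  move: (Num.floor _) => z; have [t0|t0] := leP 0 (t ord0 i).
    rewrite ger0_norm// => _ h2 h3.
    have : N.+1%:~R < (z + 1)%:~R :> R by apply: le_lt_trans h2; rewrite -[N.+1%:~R]/(N.+1%:R) -addn1 natrD; lra.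
    rewrite ltr_int; lia.
  rewrite ltr0_norm// => h2 _ h3.
  have : z%:~R < (- N%:Z)%:~R :> R by apply: le_lt_trans h2 _; rewrite intrN -[N%:~R]/(N%:R); lra.
  rewrite ltr_int; lia.
move=> i; rewrite mxE; have /andP[] := floor_itv (t ord0 i + 2^-1); rewrite intrD1.
by move: (Num.floor _)%:~R => z h1 h2; apply/andP; split; lra.
Qed.

End cells.

(** * Logistic densities *)

Section logistic.
Context {R : realType}.
Notation leb := (@lebesgue_measure R).
Notation mr := (measurableTypeR R).
Variables b p : R.
Hypotheses (b0 : 0 < b) (p0 : 0 < p).

(* The density of the logistic antiderivative b t^p / (1 + b t^p). *)
Definition logistic (t : R) : R := b * p * t `^ (p - 1) / (1 + b * t `^ p) ^+ 2.

Let F (t : R) : R := - (1 + b * t `^ p)^-1.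

Let den_gt0 t : 0 < 1 + b * t `^ p.
Proof. by apply: ltr_pwDl => //; apply: mulr_ge0; [exact: ltW|exact: powR_ge0]. Qed.

Lemma logistic_ge0 t : 0 <= logistic t.
Proof.
apply: divr_ge0; last exact/exprn_ge0/ltW.
by apply: mulr_ge0; [apply: mulr_ge0; exact: ltW|exact: powR_ge0].
Qed.

Let is_derive_F (t : R) : 0 < t -> is_derive t 1 F (logistic t).
Proof.
move=> t0.
have h1 : is_derive t 1 (fun t => 1 + b * t `^ p) (b * (p * t `^ (p - 1))).
  have h := is_derive1_powR p t0.
  by apply: is_derive_eq; rewrite add0r mul1r.
have h2 := @is_deriveV R (fun t => 1 + b * t `^ p) t _ _ (lt0r_neq0 (den_gt0 t)) h1.
rewrite /F; apply: is_derive_eq; rewrite /GRing.scale/= /logistic.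
by field; rewrite gt_eqF.
Qed.

Lemma measurable_logistic : measurable_fun setT (logistic : mr -> R).
Proof.
have m2 : measurable_fun setT (fun t : mr => 1 + b * t `^ p).
  by apply: measurable_funD => //; apply: measurable_funM => //; exact: measurable_powR.
apply: measurable_funM.
  by apply: measurable_funM => //; exact: measurable_powR.
rewrite (_ : (fun t => _) = (fun t => ((1 + b * t `^ p) ^+ 2) `^ (-1))); last first.
  by apply/funext => t; rewrite powR_inv1// exprn_ge0// ltW.
apply: (measurableT_comp (measurable_powR (-1))).
exact: measurable_funX.
Qed.

(** The antiderivative F increases from -1 at 0 to 0 at infinity. It is evaluated on compact
    intervals exhausting the open half-line, since the density is singular at 0 when p < 1. *)
Lemma integral_logistic_le : (\int[leb]_(t in `]0%R, +oo[) (logistic t)%:E <= 1)%E.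
Proof.
pose D (j : nat) : set mr := `[(j.+2%:R)^-1, j.+2%:R]%classic.
have jV (j : nat) : 0 < (j.+2%:R)^-1 :> R by rewrite invr_gt0.
have jlt (j : nat) : (j.+2%:R)^-1 < j.+2%:R :> R.
  by apply: (@lt_trans _ _ 1); [rewrite invf_lt1// ltr1n|rewrite ltr1n].
have UD : \bigcup_j D j = `]0, +oo[%classic.
  apply/seteqP; split => [t [j _]|t]; rewrite /D/= !in_itv/= ?andbT.
    by move=> /andP[h _]; exact: lt_le_trans h.
  move=> t0; have [N /(_ N (leqnn N)) hN] := bound_nat (t + t^-1).
  exists N => //; rewrite /D/= in_itv/=; have tV : 0 < t^-1 by rewrite invr_gt0.
  have h2 : N%:R <= N.+2%:R :> R by rewrite ler_nat -addn2 leq_addr.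
  apply/andP; split; last by lra.
  by rewrite -[leRHS]invrK lef_pV2 ?posrE//; lra.
have mD j : measurable (D j) by exact: measurable_itv.
have mf : measurable_fun setT (fun t : mr => (logistic t)%:E).
  by apply/measurable_EFinP; exact: measurable_logistic.
rewrite -UD; apply: (cvge_le _ (@ge0_nondecreasing_set_cvg_integral _ mr R D (fun t => (logistic t)%:E) leb _ mD _ _)).
- apply: nearW => j; rewrite /D (@continuous_FTC2 R logistic F)//.
  + rewrite -EFinB lee_fin /F opprK.
    have i1 : (1 + b * (j.+2%:R)^-1 `^ p)^-1 <= 1.
      by rewrite invf_le1// lerDl mulr_ge0 ?powR_ge0// ltW.
    have i2 : 0 < (1 + b * (j.+2%:R) `^ p)^-1 by rewrite invr_gt0.
    by rewrite addrC; lra.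
  + apply: continuous_in_subspaceT => t; rewrite inE/= in_itv/= => /andP[jt _].
    have t0 : 0 < t by exact: lt_le_trans jt.
    have cp (q : R) : continuous_at t (fun t => t `^ q).
      apply: differentiable_continuous; apply/derivable1_diffP.
      by have [] := is_derive1_powR q t0.
    apply: cvgM; first by apply: cvgM; [exact: cvg_cst|exact: cp].
    apply: cvgV; first by rewrite expf_neq0// gt_eqF.
    rewrite expr2; under eq_fun do rewrite expr2.
    by apply: cvgM; (apply: cvgD; [exact: cvg_cst|apply: cvgM; [exact: cvg_cst|exact: cp]]).
  + have dF (t : R) : 0 < t -> derivable F t 1 by move=> t0; have [] := is_derive_F t0.
    have cF (t : R) : 0 < t -> continuous_at t F.
      by move=> t0; apply: differentiable_continuous; exact/derivable1_diffP/dF.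
    split.
    * by move=> t; rewrite in_itv/= => /andP[jt _]; apply: dF; exact: lt_trans jt.
    * by apply: cvg_at_right_filter; apply: cF.
    * by apply: cvg_at_left_filter; apply: cF.
  + move=> t; rewrite in_itv/= => /andP[jt _]; rewrite derive1E.
    by have h := is_derive_F (lt_trans (jV j) jt); rewrite derive_val.
- apply/nondecreasing_seqP => j; rewrite subsetEset => t; rewrite /D/= !in_itv/= => /andP[h1 h2].
  apply/andP; split; last by apply: le_trans h2 _; rewrite ler_nat.
  by apply: le_trans h1; rewrite lef_pV2 ?posrE// ler_nat.
- by move=> j; exact: measurable_funTS.
- by move=> j t _; rewrite lee_fin logistic_ge0.
Qed.

(** With y = b t^p the left side is min(y, 1/y) / t and the right side 4 y / (t (1 + y)^2), so the
    claim reads (1 + y)^2 <= 4 max(1, y^2). *)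
Lemma exp_abs_logistic (g t : R) : 0 < t -> p = 2 * g ->
  expR (- ln t) * expR (- (g * `|2 * ln t + ln b / g|)) <= 4 / p * logistic t.
Proof.
move=> t0 pg; have g0 : 0 < g by move: p0; rewrite pg; lra.
have tE q : t `^ q = expR (q * ln t) by rewrite /powR gt_eqF.
set y := b * t `^ p.
have yE : y = expR (g * (2 * ln t + ln b / g)).
  rewrite /y tE -{1}(lnK b0) -expRD; congr expR; rewrite pg; field; exact: lt0r_neq0.
have y0 : 0 < y by rewrite yE expR_gt0.
have -> : 4 / p * logistic t = expR (- ln t) * (4 * y / (1 + y) ^+ 2).
  have -> : expR (- ln t) = t^-1 by rewrite expRN (lnK t0).
  rewrite /logistic /y powRB ?powRr1 ?(ltW t0)//; last by rewrite (gt_eqF t0) implybT.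
  by field; rewrite !gt_eqF//= ltr_pwDl// ltW.
rewrite ler_pM2l ?expR_gt0// ler_pdivlMr ?exprn_gt0 ?addr_gt0//.
move: yE; set x := 2 * ln t + ln b / g => yE.
have [x0|x0] := leP 0 x.
  rewrite ger0_norm// expRN -yE mulrC ler_pdivrMr//.
  have y1 : 1 <= y by rewrite yE -expR0 ler_expR mulr_ge0// ltW.
  nra.
rewrite ltr0_norm// mulrN opprK -yE mulrC [leRHS]mulrC [leRHS]mulrC ler_pM2r//.
have : y <= 1 by rewrite yE -expR0 ler_expR pmulr_rle0// ltW.
nra.
Qed.

End logistic.

(** * Interior points of a convex hull, and the log-sum-exp bound *)

Section interior_left_inverse.
Context {R : realType} (d m : nat).
Variables (v : 'rV[R]_d) (r : 'I_m.+1 -> 'rV[R]_d).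

(* Moving v inside the hull in the direction s shows that s is not orthogonal
   to all the differences r l - v, unless it vanishes. *)
Lemma interior_hull_left_inverse : (conv_hull r)° v ->
  exists B : 'I_m.+1 -> 'I_d -> R, forall (s : 'I_d -> R) i,
    s i = \sum_l (\sum_j s j * (r l ord0 j - v ord0 j)) * B l i.
Proof.
move=> /nbhs_ballP[e /= e0 ve].
pose M : 'M[R]_(d, m.+1) := \matrix_(j, l) (r l ord0 j - v ord0 j).
have /row_freeP[B MB] : row_free M.
  apply: inj_row_free => s sM.
  pose q := \sum_j `|s ord0 j|; have q0 : 0 <= q by apply: sumr_ge0.
  (* Small enough for every coordinate of c s to stay below e; the 1 covers s = 0. *)
  pose c := e / (q + 1); have c0 : 0 < c by rewrite divr_gt0// ltr_wpDl.
  have [|w [w0 w1 vw]] := ve (v + c *: s).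
    split => // i j; rewrite (ord1 i) /ball/= !mxE opprD addrA subrr sub0r normrN normrM (gtr0_norm c0).
    rewrite /c -mulrA -ltr_pdivlMl// mulVf ?gt_eqF// mulrC ltr_pdivrMr ?mul1r; last by rewrite ltr_wpDl.
    by apply: (@le_lt_trans _ _ q); [rewrite /q (bigD1 j)//= lerDl sumr_ge0|rewrite ltrDl].
  have h l : \sum_j s ord0 j * (r l ord0 j - v ord0 j) = 0.
    have := congr1 (fun A : 'rV_m.+1 => A ord0 l) sM; rewrite !mxE => hh; rewrite -[RHS]hh.
    by apply: eq_bigr => j _; rewrite mxE.
  have csE j : c * s ord0 j = \sum_l w l * (r l ord0 j - v ord0 j).
    have := congr1 (fun A : 'rV_d => A ord0 j) vw; rewrite !mxE summxE => vwj.
    under [RHS]eq_bigr do rewrite mulrBr.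
    rewrite big_split/= sumrN -mulr_suml w1 mul1r; apply/eqP; rewrite eq_sym subr_eq addrC vwj; apply/eqP.
    by apply: eq_bigr => l _; rewrite mxE.
  (* Pairing the previous identity with s gives c |s|^2 = sum_l w_l <s, r_l - v>, where every inner
     product vanishes by assumption on s. *)
  have s2 : \sum_j s ord0 j ^+ 2 = 0.
    apply: (mulfI (lt0r_neq0 c0)); rewrite mulr0 mulr_sumr.
    transitivity (\sum_l w l * (\sum_j s ord0 j * (r l ord0 j - v ord0 j))).
      under [RHS]eq_bigr do rewrite mulr_sumr.
      rewrite exchange_big/=; apply: eq_bigr => j _.
      rewrite expr2 mulrA csE mulr_suml; apply: eq_bigr => l _; ring.
    by apply: big1 => l _; rewrite h mulr0.
  apply/rowP => j; rewrite mxE; apply/eqP; rewrite -sqrf_eq0; apply/eqP.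
  apply/eqP; move/eqP : s2; rewrite psumr_eq0 => [/allP/(_ j)|i _]; last exact: sqr_ge0.
  by rewrite mem_index_enum; apply.
exists B => s i.
have -> : s i = ((\row_j s j) *m M *m B) ord0 i by rewrite -mulmxA MB mulmx1 mxE.
rewrite mxE; apply: eq_bigr => l _; congr (_ * _); rewrite mxE; apply: eq_bigr => j _.
by rewrite !mxE.
Qed.

End interior_left_inverse.

Section lnsumexp.
Context {R : realType} (m : nat).
Variables lambda w : 'I_m.+1 -> R.
Hypotheses (lambda_gt0 : forall j, 0 < lambda j) (lambda_sum1 : \sum_j lambda j = 1).
Hypothesis w_mean0 : \sum_l lambda l * w l = 0.

(** Let q be the logarithm of the sum. No w_l exceeds q, so the zero mean forces q >= 0; moreover
    -lambda_j w_j is the weighted sum of the other w_l and hence also at most q. *)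
Lemma abs_le_lnsumexp j : `|w j| <= (lambda j)^-1 * ln (\sum_l expR (w l)).
Proof.
set X := \sum_l expR (w l); set q := ln X.
have X0 : 0 < X.
  by rewrite /X (bigD1 j)//= ltr_pwDl ?expR_gt0// sumr_ge0// => l _; rewrite expR_ge0.
have wq l : w l <= q.
  rewrite -(expRK (w l)) ler_ln ?posrE ?expR_gt0// /X (bigD1 l)//= lerDl.
  by rewrite sumr_ge0// => i _; rewrite expR_ge0.
have q0 : 0 <= q.
  have : \sum_l lambda l * w l <= \sum_l lambda l * q by apply: ler_sum => l _; rewrite ler_pM2l.
  by rewrite w_mean0 -mulr_suml lambda_sum1 mul1r.
have l1 : lambda j <= 1.
  by rewrite -lambda_sum1 (bigD1 j)//= lerDl sumr_ge0// => i _; rewrite ltW.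
have lj := lambda_gt0 j.
have : - (lambda j * w j) <= q.
  have -> : - (lambda j * w j) = \sum_(l | l != j) lambda l * w l.
    by move: w_mean0; rewrite (bigD1 j)//= => /eqP; rewrite addr_eq0 => /eqP ->; rewrite opprK.
  apply: (@le_trans _ _ (\sum_(l | l != j) lambda l * q)).
    by apply: ler_sum => l _; rewrite ler_pM2l.
  rewrite -mulr_suml -[leRHS]mul1r ler_wpM2r//.
  by move: lambda_sum1; rewrite (bigD1 j)//= => <-; rewrite lerDr ltW.
move=> h; rewrite ler_norml -mulrN ler_pdivrMl ?ler_pdivlMl//.
apply/andP; split; first by rewrite lerNl.
by apply: (@le_trans _ _ (lambda j * q)); [rewrite ler_pM2l|rewrite -[leRHS]mul1r ler_wpM2r].
Qed.

End lnsumexp.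

(** * Powers of vectors *)

Section vpow.
Context {R : realType} (d : nat).
Notation mr := (measurableTypeR R).
Implicit Types t a : 'rV[R]_d.

Lemma vpow_ge0 t a : 0 <= vpow t a.
Proof. by apply: prodr_ge0 => i _; exact: powR_ge0. Qed.

Lemma vpow_gt0 t a : (forall i, 0 < t ord0 i) -> 0 < vpow t a.
Proof. by move=> t0; apply: prodr_gt0 => i _; exact: powR_gt0. Qed.

Lemma vpow_exp t a : (forall i, 0 < t ord0 i) -> vpow t a = expR (\sum_i a ord0 i * ln (t ord0 i)).
Proof.
move=> t0; rewrite /vpow expR_sum; apply: eq_bigr => i _.
by rewrite /powR gt_eqF.
Qed.

Lemma measurable_vpow a : measurable_fun setT (fun t : 'rV[mr]_d => vpow t a).
Proof.
apply: measurable_prod => i _.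
exact: (measurableT_comp (measurable_powR (a ord0 i)) (measurable_coord i)).
Qed.

End vpow.

(** * A bound for the weighted integrand, uniform in the weights *)

Section extremal_integrand.
Context {R : realType} (d m : nat).
Notation leb := (@lebesgue_measure R).
Notation mr := (measurableTypeR R).
Notation mu := (lebesgue_rV R d).
Variables (k : 'rV[R]_d) (r : 'I_m.+1 -> 'rV[R]_d) (lambda : 'I_m.+1 -> R).
Implicit Types (h : 'I_m.+1 -> R) (t : 'rV[R]_d).

Definition weight h : R := \prod_j h j `^ lambda j.
Definition den h t : R := \sum_l h l * vpow t (2 *: r l).
Definition integrand h t : R := vpow t (2 *: k) / den h t.

Lemma weight_ge0 h : 0 <= weight h.
Proof. by apply: prodr_ge0 => j _; exact: powR_ge0. Qed.

Lemma weight_gt0 h : (forall j, 0 < h j) -> 0 < weight h.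
Proof. by move=> h0; apply: prodr_gt0 => j _; exact: powR_gt0. Qed.

Lemma den_ge0 h t : (forall j, 0 < h j) -> 0 <= den h t.
Proof. by move=> h0; apply: sumr_ge0 => l _; rewrite mulr_ge0 ?vpow_ge0// ltW. Qed.

Lemma den_gt0 h t : (forall j, 0 < h j) -> (forall i, 0 < t ord0 i) -> 0 < den h t.
Proof.
move=> h0 t0; rewrite /den (bigD1 ord0)//= ltr_pwDl//; first by rewrite mulr_gt0 ?vpow_gt0.
by apply: sumr_ge0 => l _; rewrite mulr_ge0 ?vpow_ge0// ltW.
Qed.

Lemma integrand_ge0 h t : (forall j, 0 < h j) -> 0 <= integrand h t.
Proof. by move=> h0; rewrite /integrand divr_ge0 ?vpow_ge0 ?den_ge0. Qed.

Lemma measurable_den h : measurable_fun setT (den h : 'rV[mr]_d -> R).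
Proof.
apply: measurable_sum => l; apply: measurable_funM => //; exact: measurable_vpow.
Qed.

Lemma measurable_integrand h : (forall j, 0 < h j) -> measurable_fun setT (integrand h : 'rV[mr]_d -> R).
Proof.
move=> h0; apply: measurable_funM; first exact: measurable_vpow.
rewrite (_ : (fun t => _) = (fun t => den h t `^ (-1))); last first.
  by apply/funext => t; rewrite powR_inv1// den_ge0.
exact: (measurableT_comp (measurable_powR (-1)) (measurable_den h)).
Qed.

Hypotheses (lambda_gt0 : forall j, 0 < lambda j) (lambda_sum1 : \sum_j lambda j = 1).
Hypothesis k_comb : k + const_mx 2^-1 = \sum_j lambda j *: r j.
Hypothesis k_int : (conv_hull r)° (k + const_mx 2^-1).

(** The left side equals 1 / (t_1 ... t_d X) with X = sum_l exp(w_l), where w_l is affine in ln t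
    and has lambda-mean zero because v is the lambda-barycentre of the r_l. As v is interior, the
    linear part of w has a left inverse, so ln X dominates a multiple of sum_i |2 ln t_i + beta_i|.
    This is exponential decay in each coordinate, and [exp_abs_logistic] bounds it by logistic
    densities. The weights h move only the centre -beta, hence p does not depend on them. *)
Lemma weighted_integrand_le : exists2 p : R, 0 < p & forall h, (forall j, 0 < h j) ->
  exists2 b : 'I_d -> R, (forall i, 0 < b i) & forall t, (forall i, 0 < t ord0 i) ->
    weight h * integrand h t <= \prod_i (4 / p * logistic (b i) p (t ord0 i)).
Proof.
pose v := k + const_mx 2^-1; have [B BE] := interior_hull_left_inverse k_int.
(* Chosen so that sum_i |s_i + beta_i| <= Q ln X, by [abs_le_lnsumexp]; the added 1 keeps Q
   positive. *)
pose Q := \sum_i \sum_l `|B l i| / lambda l + 1.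
have Q0 : 0 < Q.
  by rewrite ltr_wpDl// sumr_ge0// => i _; rewrite sumr_ge0// => l _; rewrite divr_ge0// ltW.
pose g := Q^-1; have g0 : 0 < g by rewrite invr_gt0.
exists (2 * g) => [|h h0]; first by rewrite mulr_gt0.
pose eta l := ln (h l); pose etab := \sum_l lambda l * eta l.
pose beta i := \sum_l (eta l - etab) * B l i.
exists (fun i => expR (g * beta i)) => [i|t t0]; first exact: expR_gt0.
pose L i := ln (t ord0 i); pose s i := 2 * L i.
pose a l := \sum_j s j * (r l ord0 j - v ord0 j).
pose w l := eta l - etab + a l.
have vE j : v ord0 j = \sum_l lambda l * r l ord0 j.
  by rewrite /v k_comb summxE; apply: eq_bigr => l _; rewrite mxE.
have a0 : \sum_l lambda l * a l = 0.
  transitivity (\sum_j s j * (\sum_l lambda l * (r l ord0 j - v ord0 j))).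
    under eq_bigr do rewrite mulr_sumr; rewrite exchange_big; apply: eq_bigr => j _.
    by rewrite mulr_sumr; apply: eq_bigr => l _; ring.
  apply: big1 => j _; under eq_bigr do rewrite mulrBr.
  by rewrite big_split/= sumrN -mulr_suml lambda_sum1 mul1r -vE subrr mulr0.
have w_mean0 : \sum_l lambda l * w l = 0.
  under eq_bigr do rewrite mulrDr mulrBr.
  by rewrite !big_split/= a0 sumrN -mulr_suml lambda_sum1 mul1r subrr addr0.
set X := \sum_l expR (w l).
have wX := abs_le_lnsumexp lambda_gt0 lambda_sum1 w_mean0; rewrite -/X in wX.
have X0 : 0 < X by rewrite /X (bigD1 ord0)//= ltr_pwDl ?expR_gt0// sumr_ge0// => l _; rewrite expR_ge0.
have lX : 0 <= ln X.
  by have := le_trans (normr_ge0 _) (wX ord0); rewrite pmulr_rge0// invr_gt0.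
have sB i : s i + beta i = \sum_l w l * B l i.
  rewrite (BE s i) /beta -big_split/=; apply: eq_bigr => l _.
  by rewrite -mulrDl addrC.
have sumle : \sum_i `|s i + beta i| <= Q * ln X.
  rewrite mulrDl mul1r; apply: ler_wpDr => //; rewrite mulr_suml; apply: ler_sum => i _.
  rewrite sB; apply: le_trans (ler_norm_sum _ _ _) _; rewrite mulr_suml; apply: ler_sum => l _.
  by rewrite normrM mulrC -mulrA ler_wpM2l.
have expX : X^-1 <= \prod_i expR (- (g * `|s i + beta i|)).
  rewrite -expR_sum sumrN expRN lef_pV2 ?posrE ?expR_gt0// -(lnK X0) ler_expR -mulr_sumr.
  by rewrite /g ler_pdivrMl.
(* The shift by 1/2 in v leaves the factor 1 / (t_1 ... t_d) after the powers of t are collected. *)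
have -> : weight h * integrand h t = (\prod_i expR (- L i)) * X^-1.
  have -> : weight h = expR etab.
    by rewrite /weight /etab expR_sum; apply: eq_bigr => j _; rewrite /powR gt_eqF.
  rewrite /integrand /den vpow_exp//.
  have -> : \sum_l h l * vpow t (2 *: r l) = X * expR (etab + \sum_i (2 * k ord0 i + 1) * L i).
    rewrite mulr_suml; apply: eq_bigr => l _; rewrite vpow_exp// -{1}(lnK (h0 l)) -!expRD; congr expR.
    rewrite /w -[ln (h l)]/(eta l).
    have -> : \sum_i (2 *: r l) ord0 i * ln (t ord0 i) = a l + \sum_i (2 * k ord0 i + 1) * L i.
      by rewrite -big_split/=; apply: eq_bigr => j _; rewrite /v !mxE /s -[ln _]/(L j); field.
    ring.
  rewrite -expR_sum sumrN.
  have -> : \sum_i (2 * k ord0 i + 1) * L i = \sum_i (2 *: k) ord0 i * ln (t ord0 i) + \sum_i L i.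
    by rewrite -big_split/=; apply: eq_bigr => i _; rewrite mxE mulrDl mul1r.
  rewrite !expRD expRN; set e1 := expR etab; set e2 := expR _; set e3 := expR _.
  field; by rewrite !gt_eqF ?expR_gt0.
have g20 : 0 < 2 * g by rewrite mulr_gt0.
have logE i : expR (- L i) * expR (- (g * `|s i + beta i|)) <= 4 / (2 * g) * logistic (expR (g * beta i)) (2 * g) (t ord0 i).
  have := @exp_abs_logistic R (expR (g * beta i)) (2 * g) (expR_gt0 _) g20 g _ (t0 i) erefl.
  by rewrite expRK [X in _ + X](_ : _ = beta i)//; field; rewrite gt_eqF.
apply: (@le_trans _ _ ((\prod_i expR (- L i)) * \prod_i expR (- (g * `|s i + beta i|)))).
  by rewrite ler_wpM2l// prodr_ge0// => i _; rewrite expR_ge0.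
rewrite -big_split/=; apply: ler_prod => i _; apply/andP; split; last exact: logE.
by rewrite mulr_ge0 ?expR_ge0.
Qed.

(** Each factor of the majorant has mass at most 4 / p, whatever h is. This makes the constant of
    the theorem finite. *)
Lemma weighted_integral_bound : exists M : R, forall h, (forall j, 0 < h j) ->
  ((weight h)%:E * \int[mu]_(t in orthant) (integrand h t)%:E <= M%:E)%E.
Proof.
have [p p0 hp] := weighted_integrand_le; exists ((4 / p) ^+ d) => h h0.
have [b b0 hb] := hp h h0; have q0 : 0 <= 4 / p by rewrite divr_ge0// ltW.
have mO := @measurable_orthant R d.
have mI : measurable_fun setT (fun t : 'rV[mr]_d => (integrand h t)%:E).
  by apply/measurable_EFinP; exact: measurable_integrand.
rewrite -ge0_integralZl//; last 3 first.
- exact: measurable_funTS.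
- by move=> t _; rewrite lee_fin integrand_ge0.
- by rewrite lee_fin weight_ge0.
pose psi i (s : R) := 4 / p * logistic (b i) p s * \1_(`]0, +oo[%classic) s.
have psi0 i s : 0 <= psi i s by rewrite /psi mulr_ge0// mulr_ge0// logistic_ge0.
have mI0 : measurable (`]0, +oo[%classic : set mr) by exact: measurable_itv.
have mpsi i : measurable_fun setT (psi i : mr -> R).
  apply: measurable_funM; last exact: measurable_indic.
  by apply: measurable_funM => //; exact: measurable_logistic.
have -> : ((4 / p) ^+ d)%:E = (\prod_(i < d) (4 / p))%:E :> \bar R by rewrite prodr_const card_ord.
apply: le_trans (@ge0_integral_prod_le R d psi (fun=> 4 / p) mpsi psi0 _); last first.
  move=> i; have mq : measurable_fun setT (fun s : mr => (logistic (b i) p s)%:E).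
    by apply/measurable_EFinP; exact: measurable_logistic.
  rewrite (_ : (\int[leb]_s _)%E = (\int[leb]_(s in `]0%R, +oo[) ((4 / p)%:E * (logistic (b i) p s)%:E))%E).
    rewrite ge0_integralZl//; [|exact: measurable_funTS|by move=> s _; rewrite lee_fin logistic_ge0].
    rewrite -[leRHS]mule1; apply: lee_wpmul2l; rewrite ?lee_fin//; exact: integral_logistic_le.
  rewrite [RHS]integral_mkcond; apply: eq_integral => s _; rewrite patchE /psi indicE.
  by case: (s \in _); rewrite ?mulr1 ?mulr0.
rewrite integral_mkcond; apply: ge0_le_integral => //.
- by move=> t _; apply: erestrict_ge0 => u _; rewrite lee_fin mulr_ge0 ?weight_ge0 ?integrand_ge0.
- apply: (iffLR (@measurable_restrictT _ _ 'rV[mr]_d _ _ _ mO)); apply: measurable_funTS.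
  by apply: emeasurable_funM => //; exact: measurable_cst.
- apply/measurable_EFinP; apply: measurable_prod => i _.
  by apply: (measurableT_comp (mpsi i)); exact: measurable_coord.
move=> t _; rewrite patchE; case: ifPn => [|_]; last by rewrite lee_fin prodr_ge0.
rewrite inE => t0; rewrite -EFinM lee_fin; apply: le_trans (hb t t0) _.
apply: ler_prod => i _; rewrite /psi indicE mem_set ?mulr1 ?lexx ?andbT; last by rewrite /= in_itv/= t0.
by rewrite mulr_ge0 ?logistic_ge0.
Qed.

End extremal_integrand.

(** * Cell averages of powers *)

Section cell_estimates.
Context {R : realType} (d : nat).
Notation mr := (measurableTypeR R).
Notation mu := (lebesgue_rV R d).
Implicit Types (n : 'rV[int]_d) (t u a : 'rV[R]_d).

Lemma vpow_sqr t a : (forall i, 0 < t ord0 i) -> vpow t (2 *: a) = vpow t a ^+ 2.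
Proof.
move=> t0; rewrite !vpow_exp// -expRM_natl; congr expR; rewrite mulr_sumr.
by apply: eq_bigr => i _; rewrite mxE mulrA.
Qed.

Definition size1 a : R := \sum_i `|a ord0 i|.

Lemma vpow_ratio (q : R) t u a : 1 <= q -> (forall i, 0 < t ord0 i) -> (forall i, 0 < u ord0 i) ->
  (forall i, t ord0 i <= q * u ord0 i) -> (forall i, u ord0 i <= q * t ord0 i) ->
  vpow t a <= q `^ size1 a * vpow u a.
Proof.
move=> q1 t0 u0 tu ut; have q0 : 0 < q by exact: lt_le_trans q1.
rewrite !vpow_exp// /powR gt_eqF// -expRD ler_expR /size1 mulr_suml -big_split/=; apply: ler_sum => i _.
rewrite -lerBlDr -mulrBr; apply: le_trans (ler_norm _) _; rewrite normrM ler_wpM2l//.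
have h1 : ln (t ord0 i) <= ln q + ln (u ord0 i) by rewrite -lnM ?posrE// ler_ln ?posrE ?mulr_gt0.
have h2 : ln (u ord0 i) <= ln q + ln (t ord0 i) by rewrite -lnM ?posrE// ler_ln ?posrE ?mulr_gt0.
by rewrite ler_norml; apply/andP; split; lra.
Qed.

(** Bounds |t_i| / |u_i| for t and u in one cell of [far N]. The worst case is |n_i| = N + 1, where
    |t_i| ranges from N + 1/2 to N + 3/2. *)
Definition ratio (N : nat) : R := (N%:R + 3 / 2) / (N%:R + 2^-1).

Lemma ratio_ge1 N : 1 <= ratio N.
Proof. by rewrite /ratio ler_pdivlMr ?ltr_wpDl// mul1r lerD2l; lra. Qed.

Lemma far_abs_gt0 N n t i : far N n -> cell n t -> 0 < `|t ord0 i|.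
Proof.
move=> /(_ i) nN /(_ i) /andP[h1 h2].
have : N.+1%:R <= `|n ord0 i|%:~R :> R by rewrite -[N.+1%:R]/(N.+1%:Z%:~R) ler_int.
rewrite intr_norm -natr1 => nN'; have N0 : 0 <= N%:R :> R by [].
rewrite normr_gt0; apply/eqP => t0; rewrite t0 in h1 h2.
suff : `|(n ord0 i)%:~R| <= 2^-1 :> R by lra.
by rewrite ler_norml; apply/andP; split; lra.
Qed.

Lemma far_abs_le N n t u i : far N n -> cell n t -> cell n u -> `|t ord0 i| <= ratio N * `|u ord0 i|.
Proof.
move=> /(_ i) nN /(_ i) /andP[h1 h2] /(_ i) /andP[h3 h4].
have : N.+1%:R <= `|n ord0 i|%:~R :> R by rewrite -[N.+1%:R]/(N.+1%:Z%:~R) ler_int.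
rewrite intr_norm -natr1 => nN'; have N0 : 0 <= N%:R :> R by [].
move: nN' h1 h2 h3 h4; set z := (n ord0 i)%:~R => nN' h1 h2 h3 h4.
have tz : `|t ord0 i| <= `|z| + 2^-1.
  have -> : t ord0 i = z + (t ord0 i - z) by ring.
  apply: le_trans (ler_normD _ _) _; rewrite lerD2l ler_norml; apply/andP; split; lra.
have uz : `|z| - 2^-1 <= `|u ord0 i|.
  rewrite lerBlDr; have {1}-> : z = u ord0 i + (z - u ord0 i) by ring.
  apply: le_trans (ler_normD _ _) _; rewrite lerD2l ler_norml; apply/andP; split; lra.
rewrite /ratio mulrAC ler_pdivlMr ?ltr_wpDl//.
move: tz uz nN'; move: `|z| `|t ord0 i| `|u ord0 i| => A B C tz uz nN'.
have a1 : B * (N%:R + 2^-1) <= (A + 2^-1) * (N%:R + 2^-1) by rewrite ler_wpM2r// addr_ge0.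
have a2 : (N%:R + 3 / 2) * (A - 2^-1) <= (N%:R + 3 / 2) * C by rewrite ler_wpM2l// addr_ge0// divr_ge0.
nra.
Qed.

Lemma measurable_scale_abs (c : R) : measurable_fun setT (fun t : 'rV[mr]_d => (c *: vabs t)%R : 'rV[mr]_d).
Proof.
apply: measurable_fun_rV => i; rewrite (_ : (fun _ => _) = (fun t : 'rV[mr]_d => c * `|t ord0 i|)).
  by apply: measurable_funM => //; apply: (measurableT_comp (@normr_measurable R setT)); exact: measurable_coord.
by apply/funext => t; rewrite !mxE.
Qed.

Variables (c : R) (N : nat) (n : 'rV[int]_d).
Hypotheses (c0 : 0 < c) (nN : far N n).

Let center : 'rV[R]_d := \row_i (n ord0 i)%:~R.

Let cell_center : cell n center.
Proof. by move=> i; rewrite [center _ _]mxE; apply/andP; split; lra. Qed.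

Lemma scale_abs_gt0 t i : cell n t -> 0 < (c *: vabs t) ord0 i.
Proof. by move=> ct; rewrite !mxE mulr_gt0// (far_abs_gt0 i nN ct). Qed.

Lemma cell_vpow_ratio t u a : cell n t -> cell n u ->
  vpow (c *: vabs t) a <= ratio N `^ size1 a * vpow (c *: vabs u) a.
Proof.
move=> ct cu; apply: vpow_ratio; first exact: ratio_ge1.
- by move=> i; exact: scale_abs_gt0.
- by move=> i; exact: scale_abs_gt0.
- by move=> i; rewrite !mxE mulrCA ler_pM2l// (far_abs_le i nN ct cu).
- by move=> i; rewrite !mxE mulrCA ler_pM2l// (far_abs_le i nN cu ct).
Qed.

Lemma measurable_vpow_abs a : measurable_fun setT (fun t : 'rV[mr]_d => vpow (c *: vabs t) a).
Proof. exact: (measurableT_comp (measurable_vpow a) (measurable_scale_abs c)). Qed.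

Definition cellint a : R := \int[mu]_(t in cell n) vpow (c *: vabs t) a.

Let integral_cell_cst (M : R) : (\int[mu]_(t in cell n) cst M%:E t = M%:E)%E.
Proof.
rewrite integral_cst; last exact: measurable_cell.
apply: (@etrans _ _ (M%:E * 1)%E); last by rewrite mule1.
by congr (_ * _)%E; exact: lebesgue_cell.
Qed.

Lemma integral_cell_le (f : 'rV[mr]_d -> R) (M : R) : measurable_fun setT f -> (forall t, 0 <= f t) ->
  (forall t, cell n t -> f t <= M) -> (\int[mu]_(t in cell n) (f t)%:E <= M%:E)%E.
Proof.
move=> mf f0 fM; have mc := @measurable_cell R d n.
have M0 : 0 <= M.
  have ct := cell_center.
  exact: le_trans (f0 _) (fM _ ct).
apply: (@le_trans _ _ (\int[mu]_(t in cell n) cst M%:E t)%E).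
  apply: ge0_le_integral => //.
  - by move=> t _; rewrite lee_fin.
  - by apply/measurable_EFinP; exact: measurable_funTS.
by rewrite integral_cell_cst.
Qed.

Lemma integral_cell_ge (f : 'rV[mr]_d -> R) (M : R) : measurable_fun setT f -> 0 <= M ->
  (forall t, cell n t -> M <= f t) -> (M%:E <= \int[mu]_(t in cell n) (f t)%:E)%E.
Proof.
move=> mf M0 fM; have mc := @measurable_cell R d n.
apply: (@le_trans _ _ (\int[mu]_(t in cell n) cst M%:E t)%E).
  by rewrite integral_cell_cst.
apply: ge0_le_integral => //.
- by apply/measurable_EFinP; exact: measurable_funTS.
Qed.

Lemma cellintE a : (cellint a)%:E = (\int[mu]_(t in cell n) (vpow (c *: vabs t) a)%:E)%E.
Proof.
rewrite /cellint /Rintegral fineK// ge0_fin_numE; last by apply: integral_ge0 => t _; rewrite lee_fin vpow_ge0.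
apply: le_lt_trans (ltry (ratio N `^ size1 a * vpow (c *: vabs center) a)).
apply: integral_cell_le; [exact: measurable_vpow_abs|by move=> t; exact: vpow_ge0|].
by move=> t ct; exact: cell_vpow_ratio.
Qed.

Lemma cellint_le a t : cell n t -> cellint a <= ratio N `^ size1 a * vpow (c *: vabs t) a.
Proof.
move=> ct; rewrite -lee_fin cellintE.
apply: integral_cell_le; [exact: measurable_vpow_abs|by move=> u; exact: vpow_ge0|].
by move=> u cu; exact: cell_vpow_ratio.
Qed.

Lemma cellint_ge a t : cell n t -> (ratio N `^ size1 a)^-1 * vpow (c *: vabs t) a <= cellint a.
Proof.
have r0 : 0 < ratio N `^ size1 a by rewrite powR_gt0// (lt_le_trans _ (ratio_ge1 N)).
move=> ct; rewrite -lee_fin cellintE.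
apply: integral_cell_ge; [exact: measurable_vpow_abs|by rewrite mulr_ge0 ?vpow_ge0// invr_ge0 ltW|].
by move=> u cu; rewrite ler_pdivrMl//; exact: cell_vpow_ratio.
Qed.

Lemma cellint_gt0 a : 0 < cellint a.
Proof.
apply: lt_le_trans (cellint_ge a cell_center).
rewrite mulr_gt0 ?invr_gt0 ?powR_gt0 ?(lt_le_trans _ (ratio_ge1 N))//.
by apply: vpow_gt0 => i; exact: scale_abs_gt0.
Qed.

Variables (m : nat) (k : 'rV[R]_d) (r : 'I_m.+1 -> 'rV[R]_d) (h : 'I_m.+1 -> R).
Hypothesis h0 : forall j, 0 < h j.

(** The summand of the discrete formula without rho^d, where c stands for 2 pi rho. *)
Definition cell_quotient : R := cellint k ^+ 2 / \sum_l h l * cellint (2 *: r l).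

Let D := \sum_l h l * cellint (2 *: r l).

Let D0 : 0 < D.
Proof.
rewrite /D (bigD1 ord0)//= ltr_pwDl//; first by rewrite mulr_gt0// cellint_gt0.
by apply: sumr_ge0 => l _; rewrite mulr_ge0 ?ltW ?cellint_gt0.
Qed.

Lemma cell_quotient_ge0 : 0 <= cell_quotient.
Proof. by rewrite /cell_quotient divr_ge0 ?sqr_ge0// ltW. Qed.

Let integral_den : (\int[mu]_(t in cell n) (den r h (c *: vabs t))%:E = D%:E)%E.
Proof.
have mc := @measurable_cell R d n.
under eq_integral do rewrite /den -sumEFin.
rewrite ge0_integral_sum//.
- rewrite /D -sumEFin; apply: eq_bigr => l _; rewrite EFinM cellintE -ge0_integralZl//.
  + by apply/measurable_EFinP; apply: measurable_funTS; exact: measurable_vpow_abs.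
  + by move=> t _; rewrite lee_fin vpow_ge0.
  + by rewrite lee_fin ltW.
- move=> l; apply/measurable_EFinP; apply: measurable_funTS; apply: measurable_funM => //.
  exact: measurable_vpow_abs.
- by move=> l t _; rewrite lee_fin mulr_ge0 ?vpow_ge0// ltW.
Qed.

(* Integrated form of 2 z w <= w^2 / den + z^2 den, with the optimal z. *)
Lemma cell_quotient_le :
  (cell_quotient%:E <= \int[mu]_(t in cell n) (integrand k r h (c *: vabs t))%:E)%E.
Proof.
have mc := @measurable_cell R d n.
pose W := cellint k; pose z := W / D.
have W0 : 0 < W := cellint_gt0 k; have z0 : 0 < z by rewrite divr_gt0.
have mden : measurable_fun setT (fun t : 'rV[mr]_d => den r h (c *: vabs t)).
  exact: (measurableT_comp (measurable_den r h) (measurable_scale_abs c)).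
have mint : measurable_fun setT (fun t : 'rV[mr]_d => integrand k r h (c *: vabs t)).
  exact: (measurableT_comp (measurable_integrand k r h0) (measurable_scale_abs c)).
have : ((2 * z * W)%:E <= \int[mu]_(t in cell n) (integrand k r h (c *: vabs t))%:E + (z ^+ 2 * D)%:E)%E.
  rewrite [in X in (_ <= _ + X)%E]EFinM -integral_den -ge0_integralZl//; last 3 first.
  - by apply/measurable_EFinP; exact: measurable_funTS.
  - by move=> t _; rewrite lee_fin den_ge0.
  - by rewrite lee_fin sqr_ge0.
  rewrite -ge0_integralD//; last 4 first.
  - by move=> t _; rewrite lee_fin integrand_ge0.
  - by apply/measurable_EFinP; exact: measurable_funTS.
  - by move=> t _; rewrite mule_ge0// lee_fin ?sqr_ge0 ?den_ge0.
  - apply: emeasurable_funM; first exact: measurable_cst.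
    by apply/measurable_EFinP; exact: measurable_funTS.
  rewrite EFinM cellintE -ge0_integralZl//; last 3 first.
  - by apply/measurable_EFinP; apply: measurable_funTS; exact: measurable_vpow_abs.
  - by move=> t _; rewrite lee_fin vpow_ge0.
  - by rewrite lee_fin mulr_ge0// ltW.
  apply: ge0_le_integral => //.
  - by move=> t _; rewrite -EFinM lee_fin mulr_ge0 ?vpow_ge0// mulr_ge0// ltW.
  - apply: emeasurable_funM; first exact: measurable_cst.
    by apply/measurable_EFinP; apply: measurable_funTS; exact: measurable_vpow_abs.
  - apply: emeasurable_funD; first by apply/measurable_EFinP; exact: measurable_funTS.
    apply: emeasurable_funM; first exact: measurable_cst.
    by apply/measurable_EFinP; exact: measurable_funTS.
  move=> t ct; rewrite -!EFinM -EFinD lee_fin.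
  have u0 i : 0 < (c *: vabs t) ord0 i by exact: scale_abs_gt0.
  have d0 := den_gt0 r h0 u0.
  have -> : integrand k r h (c *: vabs t) = vpow (c *: vabs t) k ^+ 2 / den r h (c *: vabs t).
    by rewrite /integrand vpow_sqr.
  move: d0; set x := vpow _ k; set y := den _ _ _ => y0.
  have -> : x ^+ 2 / y + z ^+ 2 * y = 2 * z * x + (x - z * y) ^+ 2 / y by field; rewrite gt_eqF.
  by rewrite lerDl divr_ge0 ?sqr_ge0// ltW.
rewrite -leeBlDr// -EFinB; congr (_ <= _)%E; congr EFin.
by rewrite /cell_quotient /z -/D -/W; field; rewrite gt_eqF.
Qed.

(** [cellint k] enters squared, hence the 2; the sum over l is a common upper bound for the
    exponents in the denominator. *)
Definition ratio_exponent : R := 2 * size1 k + \sum_l size1 (2 *: r l).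

(** On a far cell every power differs from its integral over the cell by at most a power of
    [ratio N], so the quotient of the integrals is comparable with the integrand at each point. *)
Lemma cell_quotient_ge :
  (\int[mu]_(t in cell n) ((ratio N `^ ratio_exponent)^-1 * integrand k r h (c *: vabs t))%:E <= cell_quotient%:E)%E.
Proof.
have q1 := ratio_ge1 N; have q0 : 0 < ratio N by exact: lt_le_trans q1.
have mint : measurable_fun setT (fun t : 'rV[mr]_d => integrand k r h (c *: vabs t)).
  exact: (measurableT_comp (measurable_integrand k r h0) (measurable_scale_abs c)).
have p0 : 0 < ratio N `^ ratio_exponent by rewrite powR_gt0.
apply: integral_cell_le.
- exact: measurable_funM.
- by move=> t; rewrite mulr_ge0 ?integrand_ge0// invr_ge0 ltW.
move=> t ct.
have u0 i : 0 < (c *: vabs t) ord0 i by exact: scale_abs_gt0.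
have d0 := den_gt0 r h0 u0; have w0 := vpow_gt0 k u0.
rewrite ler_pdivrMl//.
have -> : integrand k r h (c *: vabs t) = vpow (c *: vabs t) k ^+ 2 / den r h (c *: vabs t).
  by rewrite /integrand vpow_sqr.
have hW := cellint_ge k ct; have W0 := cellint_gt0 k.
have hD : D <= ratio N `^ (\sum_l size1 (2 *: r l)) * den r h (c *: vabs t).
  rewrite /D /den mulr_sumr; apply: ler_sum => l _; rewrite mulrCA ler_pM2l//.
  apply: le_trans (cellint_le _ ct) _; rewrite ler_wpM2r ?vpow_ge0// ler_powR//.
  rewrite (bigD1 l)//= lerDl; apply: sumr_ge0 => j _; exact: sumr_ge0.
rewrite /ratio_exponent powRD; last by rewrite (gt_eqF q0) implybT.
rewrite mulr_natl mulr2n powRD; last by rewrite (gt_eqF q0) implybT.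
move: hW hD; set q := ratio N `^ size1 k; set q' := ratio N `^ _.
have qp : 0 < q by rewrite powR_gt0.
have q'p : 0 < q' by rewrite powR_gt0.
rewrite /cell_quotient -/D ler_pdivrMl// => hW hD.
move: w0 d0 W0 hW hD; set x := vpow _ _; set y := den _ _ _; set W := cellint k => w0 d0 W0 hW hD.
rewrite ler_pdivrMr//.
apply: (@le_trans _ _ ((q * W) ^+ 2)).
  apply: lerXn2r; [by rewrite nnegrE; exact: ltW|by rewrite nnegrE; apply: mulr_ge0; exact: ltW|exact: hW].
have -> : q * q * q' * (W ^+ 2 / D) * y = (q * W) ^+ 2 * ((q' * y) / D) by field; rewrite gt_eqF.
by rewrite -[leLHS]mulr1 ler_wpM2l ?sqr_ge0// ler_pdivlMr// mul1r.
Qed.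

End cell_estimates.

Lemma measurable_bigcup_hcell {R : realType} d (P : set 'rV[int]_d) :
  measurable (\bigcup_(n in P) hcell n : set 'rV[measurableTypeR R]_d).
Proof.
rewrite bigcup_mkcond; apply: countable_bigcupT_measurable; first exact: countableP.
by move=> n; case: ifPn => // _; exact: measurable_hcell.
Qed.

(** * Comparison of the discrete sum with the integral *)

Section extremal_constant.
Context {R : realType} (d m : nat).
Notation mr := (measurableTypeR R).
Notation mu := (lebesgue_rV R d).
Variables (k : 'rV[R]_d) (r : 'I_m.+1 -> 'rV[R]_d) (lambda : 'I_m.+1 -> R).
Implicit Types (h : 'I_m.+1 -> R) (t : 'rV[R]_d).

Definition discrete_term (rho : R) h : \bar R :=
  \esum_(n in @lattice_star d) (rho ^+ d * cell_quotient (2 * pi * rho) n k r h)%:E.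

(** The factor rho^d and the factor (2 / (2 pi rho))^d from [ge0_integral_abs] multiply to pi^-d, so
    rho drops out. *)
Lemma scaled_integral (rho : R) (G : 'rV[mr]_d -> \bar R) : 0 < rho ->
  measurable_fun setT G -> (forall t, 0 <= G t)%E ->
  (\int[mu]_t ((rho ^+ d)%:E * G ((2 * pi * rho) *: vabs t)%R) = (pi ^- d)%:E * \int[mu]_(t in orthant) G t)%E.
Proof.
move=> rho0 mG G0; have p0 : 0 < pi :> R := pi_gt0 R.
have c0 : 0 < 2 * pi * rho by rewrite mulr_gt0// mulr_gt0.
have mGc := measurableT_comp mG (@measurable_scale_abs R d (2 * pi * rho)).
rewrite ge0_integralZl//; last by rewrite lee_fin exprn_ge0// ltW.
rewrite ge0_integral_abs// muleA -EFinM -exprMn -exprVn; congr (_%:E * _)%E; congr (_ ^+ _).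
by move: p0; move: pi => p p0; field; rewrite !gt_eqF.
Qed.

Variable h : 'I_m.+1 -> R.
Hypothesis h0 : forall j, 0 < h j.

Let mI : measurable_fun setT (integrand k r h : 'rV[mr]_d -> R).
Proof. exact: measurable_integrand. Qed.

Let mIc (c : R) : measurable_fun setT (fun t : 'rV[mr]_d => integrand k r h (c *: vabs t)).
Proof. exact: (measurableT_comp mI (measurable_scale_abs c)). Qed.

(** Cauchy-Schwarz on each cell, then summation; the cells left out of [lattice_star] only lower the
    sum. *)
Lemma discrete_term_le (rho : R) : 0 < rho ->
  (discrete_term rho h <= (pi ^- d)%:E * \int[mu]_(t in orthant) (integrand k r h t)%:E)%E.
Proof.
move=> rho0; set c := 2 * pi * rho.
have c0 : 0 < c by rewrite mulr_gt0// mulr_gt0// pi_gt0.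
have rd0 : (0 <= (rho ^+ d)%:E)%E by rewrite lee_fin exprn_ge0// ltW.
rewrite -(@scaled_integral rho (fun t => (integrand k r h t)%:E))//; last 2 first.
- exact/measurable_EFinP.
- by move=> t; rewrite lee_fin integrand_ge0.
pose f (t : 'rV[mr]_d) := ((rho ^+ d)%:E * (integrand k r h (c *: vabs t))%:E)%E.
have mf : measurable_fun setT f.
  by apply: emeasurable_funM; [exact: measurable_cst|apply/measurable_EFinP; exact: mIc].
have f0 t : (0 <= f t)%E by rewrite mule_ge0// lee_fin integrand_ge0.
apply: (@le_trans _ _ (\esum_(n in @lattice_star d) \int[mu]_(t in hcell n) f t)%E).
  apply: le_esum => n /lattice_far nN; rewrite -integral_hcell// EFinM.
  rewrite ge0_integralZl//; last 3 first.
  - exact: measurable_cell.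
  - by apply/measurable_EFinP; exact: measurable_funTS.
  - by move=> t _; rewrite lee_fin integrand_ge0.
  by apply: lee_wpmul2l => //; exact: (cell_quotient_le c0 nN).
rewrite esum_hcell//; apply: ge0_subset_integral => //.
exact: measurable_bigcup_hcell.
Qed.


Let P0 : R := ratio_exponent k r.

(** The orthant away from the coordinate hyperplanes. One N governs this distance and, in
    [discrete_term_ge], the choice of far cells, so that a single limit handles both. *)
Definition tail (N : nat) : set 'rV[R]_d := [set u | forall i, (N.+1%:R)^-1 < u ord0 i].

Lemma measurable_tail N : measurable (tail N : set 'rV[mr]_d).
Proof.
have -> : tail N = [set t | forall i, `](N.+1%:R)^-1, +oo[%classic (t ord0 i)].
  by apply/seteqP; split => t /= ht i; have := ht i; rewrite /= in_itv/= andbT.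
by apply: (@measurable_rV_box R d (fun=> `](N.+1%:R)^-1, +oo[%classic)) => i; exact: measurable_itv.
Qed.

(** The condition on rho ensures that any t whose image under t -> 2 pi rho |t| lies in [tail N]
    belongs to a cell of [far N]; on those cells [cell_quotient_ge] loses only a power of
    [ratio N]. *)
Lemma discrete_term_ge (rho : R) N : 0 < rho -> 2 * pi * rho * (N%:R + 2^-1) <= (N.+1%:R)^-1 ->
  (((ratio N `^ P0)^-1 * pi ^- d)%:E * \int[mu]_(t in tail N) (integrand k r h t)%:E <= discrete_term rho h)%E.
Proof.
move=> rho0; set c := 2 * pi * rho => cN.
have c0 : 0 < c by rewrite mulr_gt0// mulr_gt0// pi_gt0.
have p0 : 0 < (ratio N `^ P0)^-1.
  by rewrite invr_gt0 powR_gt0//; apply: lt_le_trans (ratio_ge1 N).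
set q := (ratio N `^ P0)^-1 in p0 *.
have rd0 : (0 <= (rho ^+ d)%:E)%E by rewrite lee_fin exprn_ge0// ltW.
pose A : set 'rV[mr]_d := [set u | forall i, `]c * (N%:R + 2^-1), +oo[%classic (u ord0 i)].
have mA : measurable A.
  by apply: (@measurable_rV_box R d (fun=> `]c * (N%:R + 2^-1), +oo[%classic)) => i; exact: measurable_itv.
have mqI : measurable_fun setT (fun t : 'rV[mr]_d => (q * integrand k r h t)%:E).
  by apply/measurable_EFinP; apply: measurable_funM.
have qI0 t : (0 <= (q * integrand k r h t)%:E)%E by rewrite lee_fin mulr_ge0 ?integrand_ge0 ?ltW.
pose G := (fun t : 'rV[mr]_d => (q * integrand k r h t)%:E) \_ A.
have mG : measurable_fun setT G.
  apply: (iffLR (@measurable_restrictT _ _ 'rV[mr]_d _ _ _ mA)); exact: measurable_funTS.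
have G0 t : (0 <= G t)%E by apply: erestrict_ge0.
pose g (t : 'rV[mr]_d) := ((rho ^+ d)%:E * (q * integrand k r h (c *: vabs t))%:E)%E.
have mg : measurable_fun setT g.
  apply: emeasurable_funM; first exact: measurable_cst.
  by apply/measurable_EFinP; apply: measurable_funM => //; exact: mIc.
have g0 t : (0 <= g t)%E by rewrite mule_ge0.
pose U : set 'rV[mr]_d := \bigcup_(n in far N) hcell n.
have mU : measurable U by exact: measurable_bigcup_hcell.
have mO := @measurable_orthant R d; have mT := measurable_tail N.
have pd0 : 0 <= pi ^- d :> R by rewrite invr_ge0 exprn_ge0// pi_ge0.
apply: (@le_trans _ _ ((pi ^- d)%:E * \int[mu]_(t in orthant) G t)%E).
  rewrite EFinM muleAC [X in (X <= _)%E]muleC; apply: lee_wpmul2l; first by rewrite lee_fin.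
  rewrite -ge0_integralZl//; last 3 first.
  - by apply/measurable_EFinP; exact: measurable_funTS.
  - by move=> t _; rewrite lee_fin integrand_ge0.
  - by rewrite lee_fin ltW.
  rewrite -integral_mkcondr; apply: ge0_subset_integral => //.
  - exact: measurableI.
  - exact: measurable_funTS.
  - by move=> t _; exact: qI0.
  move=> t tN; split=> i; last by rewrite /= in_itv/= andbT; apply: le_lt_trans cN (tN i).
  by apply: lt_trans (tN i); rewrite invr_gt0.
rewrite -(@scaled_integral rho G)// -/c.
apply: (@le_trans _ _ (\int[mu]_(t in U) g t)%E).
  rewrite [in leRHS]integral_mkcond; apply: ge0_le_integral => //.
  - by move=> t _; rewrite mule_ge0.
  - apply: emeasurable_funM; first exact: measurable_cst.
    exact: (measurableT_comp mG (@measurable_scale_abs R d c)).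
  - by apply: (iffLR (@measurable_restrictT _ _ 'rV[mr]_d _ _ _ mU)); exact: measurable_funTS.
  move=> t _; rewrite /G patchE; case: ifPn => [|_]; last by rewrite mule0; exact: erestrict_ge0.
  rewrite inE => tA; rewrite patchE mem_set//; apply: far_cover => i.
  by have := tA i; rewrite /= in_itv/= andbT !mxE ltr_pM2l.
rewrite -esum_hcell//.
apply: (@le_trans _ _ (\esum_(n in @far d N) (rho ^+ d * cell_quotient (2 * pi * rho) n k r h)%:E)%E).
  apply: le_esum => n nN; rewrite -integral_hcell// ge0_integralZl//; last 2 first.
  - exact: measurable_cell.
  - by apply/measurable_EFinP; apply: measurable_funTS; apply: measurable_funM => //; exact: mIc.
  rewrite EFinM; apply: lee_wpmul2l => //; exact: (cell_quotient_ge c0 nN).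
rewrite /discrete_term [leLHS]esum_mkcond [leRHS]esum_mkcond; apply: le_esum => n _.
case: ifPn => [nN|_].
  by rewrite mem_set//; apply: (@far_lattice d N); rewrite inE in nN.
case: ifPn => //; rewrite inE => /lattice_far nN.
by rewrite lee_fin mulr_ge0 ?exprn_ge0 ?(ltW rho0)// (cell_quotient_ge0 c0 nN).
Qed.

End extremal_constant.

(** * Equality of the two formulas for the constant *)

Section constant_limit.
Context {R : realType} (d m : nat).
Notation mr := (measurableTypeR R).
Notation mu := (lebesgue_rV R d).
Variables (k : 'rV[R]_d) (r : 'I_m.+1 -> 'rV[R]_d) (lambda : 'I_m.+1 -> R).
Implicit Types (h : 'I_m.+1 -> R).

Definition discrete_sup (rho : R) : \bar R :=
  ereal_sup [set ((weight lambda h)%:E * discrete_term k r rho h)%E | h in [set h | forall j, (0 < h j)%R]].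

Definition continuous_sup : \bar R :=
  ereal_sup [set ((weight lambda h)%:E * \int[mu]_(t in orthant) (integrand k r h t)%:E)%E
            | h in [set h | forall j, (0 < h j)%R]].

Lemma cvg_ratio (p : R) : (ratio N `^ p)^-1 @[N --> \oo] --> (1 : R).
Proof.
have h1 : (ratio N : R) @[N --> \oo] --> (1 : R).
  apply/cvgrPdist_le => e e0; near=> N.
  have N0 : 0 < N%:R + 2^-1 :> R by rewrite ltr_wpDl.
  have -> : ratio N = 1 + (N%:R + 2^-1)^-1 :> R.
    by rewrite /ratio; move: N0; set x := N%:R => N0; field; move: N0; rewrite -(ltr_pM2l (ltr0n R 2)) => x0; apply/lt0r_neq0; lra.
  have Ni : 0 <= (N%:R + 2^-1)^-1 :> R by rewrite invr_ge0 ltW.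
  rewrite opprD addrA subrr sub0r normrN (ger0_norm Ni) -[leRHS]invrK lef_pV2 ?posrE ?invr_gt0//.
  apply: (@le_trans _ _ N%:R); last by rewrite lerDl.
  by near: N; have [M MP] := bound_nat e^-1; exists M.
have h2 : continuous_at (1 : R) (fun x : R => x `^ p).
  apply: differentiable_continuous; apply/derivable1_diffP.
  by have [] := is_derive1_powR p (@ltr01 R).
have h3 : (ratio N : R) `^ p @[N --> \oo] --> (1 : R).
  have E1 : 1 = 1 `^ p :> R by rewrite powR1.
  rewrite [X in _ --> X]E1; exact: (cvg_comp _ _ h1 h2).
by rewrite -[X in _ --> X]invr1; apply: cvgV.
Unshelve. all: by end_near. Qed.

Lemma bigcup_tail : \bigcup_N (@tail R d N) = orthant.
Proof.
apply/seteqP; split => [t [N _ tN] i|t t0]; first by apply: lt_trans (tN i); rewrite invr_gt0.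
have [M MP] : exists M : nat, forall i, (t ord0 i)^-1 <= M%:R.
  have [M MP] := bound_nat (\sum_i (t ord0 i)^-1); exists M => i; apply: le_trans (MP M (leqnn M)).
  by rewrite (bigD1 i)//= lerDl sumr_ge0// => j _; rewrite invr_ge0 ltW// t0.
exists M => // i; rewrite -[ltRHS]invrK ltf_pV2 ?posrE ?invr_gt0 ?t0//.
by apply: le_lt_trans (MP i) _; rewrite ltr_nat.
Qed.

Hypothesis I_fin : forall h, (forall j, 0 < h j) ->
  (\int[mu]_(t in orthant) (integrand k r h t)%:E)%E \is a fin_num.

(** One h and one N at a time: for all small rho the supremum is at least the bound of
    [discrete_term_ge], and this bound tends to the left side as N grows. *)
Lemma discrete_liminf_ge h : (forall j, 0 < h j) ->
  ((pi ^- d)%:E * ((weight lambda h)%:E * \int[mu]_(t in orthant) (integrand k r h t)%:E) <=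
   limf_einf discrete_sup 0^'+)%E.
Proof.
move=> h0; have w0 := weight_ge0 lambda h.
set P := ratio_exponent k r.
set I := (\int[mu]_(t in orthant) _)%E; have If : I \is a fin_num by exact: I_fin.
have mT N := @measurable_tail R d N.
have mI : measurable_fun setT (fun t : 'rV[mr]_d => (integrand k r h t)%:E).
  by apply/measurable_EFinP; exact: measurable_integrand.
have cJ : (\int[mu]_(t in tail N) (integrand k r h t)%:E @[N --> \oo] --> I)%E.
  rewrite /I -bigcup_tail; apply: ge0_nondecreasing_set_cvg_integral => //.
  - apply/nondecreasing_seqP => N; rewrite subsetEset => t tN i; apply: le_lt_trans (tN i).
    by rewrite lef_pV2 ?posrE// ler_nat.
  - by move=> N; exact: measurable_funTS.
  - by move=> N t _; rewrite lee_fin integrand_ge0.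
have cc : (((ratio N `^ P)^-1 * pi ^- d)%:E * (\int[mu]_(t in tail N) (integrand k r h t)%:E) @[N --> \oo]
    --> (pi ^- d)%:E * I)%E.
  apply: cvgeM; [exact: mule_def_fin| |exact: cJ].
  apply: cvg_EFin; first exact: nearW.
  rewrite -[X in _ --> X]mul1r; apply: cvgM; [exact: cvg_ratio|exact: cvg_cst].
rewrite muleCA.
have cw := cvgeZl (isT : (weight lambda h)%:E \is a fin_num) cc.
apply: (cvge_le _ cw); apply: nearW => N.
have c0 : 0 < 2 * pi * (N%:R + 2^-1) :> R by rewrite mulr_gt0 ?ltr_wpDl// mulr_gt0 ?pi_gt0.
pose V : set R := [set rho | 0 < rho /\ 2 * pi * rho * (N%:R + 2^-1) <= (N.+1%:R)^-1].
have FV : 0^'+ V.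
  exists ((N.+1%:R)^-1 / (2 * pi * (N%:R + 2^-1))); first by rewrite /= divr_gt0// invr_gt0.
  move=> rho /=; rewrite sub0r normrN => rl rho0; split => //; rewrite gtr0_norm// in rl.
  by apply: ltW; move: rl; rewrite ltr_pdivlMr// mulrC mulrAC.
rewrite limf_einfE; apply: le_trans (ereal_sup_ubound _); last by exists V.
apply: le_ereal_inf_tmp => _ [rho [rho0 rhoN] <-].
apply: le_trans (ereal_sup_ubound _); last by exists h.
by apply: lee_wpmul2l; [rewrite lee_fin|exact: discrete_term_ge].
Qed.

Lemma discrete_liminfE : limf_einf discrete_sup 0^'+ = ((pi ^- d)%:E * continuous_sup)%E.
Proof.
have pd0 : 0 < pi ^- d :> R by rewrite invr_gt0 exprn_gt0// pi_gt0.
apply/eqP; rewrite eq_le; apply/andP; split.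
  (* [discrete_term_le] holds for every rho > 0, so one positive rho in each right neighbourhood of
     0 is enough. *)
  rewrite limf_einfE; apply: ge_ereal_sup => _ [V FV <-].
  have [rho [Vrho rho0]] : exists rho, V rho /\ 0 < rho.
    have F2 : (0 : R)^'+ (V `&` [set x | 0 < x]) by apply: filterI => //; exact: nbhs_right_gt.
    by have [rho []] := @filter_ex _ _ _ _ F2; exists rho.
  apply: (@le_trans _ _ (discrete_sup rho)); first by apply: ereal_inf_lbound; exists rho.
  apply: ge_ereal_sup => _ [h h0 <-].
  apply: (@le_trans _ _ ((weight lambda h)%:E * ((pi ^- d)%:E * \int[mu]_(t in orthant) (integrand k r h t)%:E))%E).
    by apply: lee_wpmul2l; [rewrite lee_fin weight_ge0|exact: discrete_term_le].
  rewrite muleCA; apply: lee_wpmul2l; first by rewrite lee_fin ltW.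
  by apply: ereal_sup_ubound; exists h.
rewrite /continuous_sup -ereal_sup_pZl//; apply: ge_ereal_sup => _ [_ [h h0 <-] <-].
exact: discrete_liminf_ge.
Qed.

End constant_limit.

(** * Multiplication operators and the norms of the statement *)

Section multiplier.
Context {R : realType} (d : nat).
Notation mr := (measurableTypeR R).
Notation mu := (lebesgue_rV R d).
Notation L2 := (@L2 _ 'rV[mr]_d R mu).
Notation nn := (@nn _ 'rV[mr]_d R mu).
Notation N2 := (@N2 _ 'rV[mr]_d R mu).
Implicit Types (t a : 'rV[R]_d) (f x y : 'rV[R]_d -> R[i]).

Definition mabs t : 'rV[R]_d := (2 * pi) *: vabs t.

Let two_pi_gt0 : 0 < 2 * pi :> R. Proof. by rewrite mulr_gt0 ?pi_gt0. Qed.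

Lemma mabsE t i : mabs t ord0 i = 2 * pi * `|t ord0 i|.
Proof. by rewrite !mxE. Qed.

Lemma measurable_mabs : measurable_fun setT (mabs : 'rV[mr]_d -> 'rV[mr]_d).
Proof. exact: measurable_scale_abs. Qed.

Definition symbol a t : R[i] := \prod_i pow2pii (t ord0 i) (a ord0 i).

Lemma opEE a f t : opE a f t = symbol a t * f t. Proof. by []. Qed.

Let normsq_prod (I : finType) (z : I -> R[i]) : normsq (\prod_i z i) = \prod_i normsq (z i).
Proof.
elim/big_ind2 : _ => //; first by rewrite /normsq/= expr1n expr0n addr0.
by move=> z1 r1 z2 r2 <- <-; rewrite normsqM.
Qed.

Lemma normsq_symbol a t : normsq (symbol a t) = vpow (mabs t) (2 *: a).
Proof.
rewrite /symbol normsq_prod; apply: eq_bigr => i _; rewrite /pow2pii normsqM normsq_cexpi mulr1.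
have -> : normsq (Complex (`|2 * pi * t ord0 i| `^ a ord0 i) 0) = (`|2 * pi * t ord0 i| `^ a ord0 i) ^+ 2.
  by rewrite /normsq/= [X in _ + X]expr0n addr0.
rewrite mabsE [(2 *: a) _ _]mxE [2 * a _ _]mulrC powRrM powR_mulrn ?powR_ge0//.
by rewrite normrM (gtr0_norm two_pi_gt0).
Qed.

Let cmeas_prod (I : eqType) (s : seq I) (F : I -> 'rV[mr]_d -> R[i]) : (forall i, cmeas (F i)) ->
  cmeas (fun t => \prod_(i <- s) F i t).
Proof.
move=> mF; elim: s => [|i s IH].
  by under eq_fun do rewrite big_nil; exact: cmeas_cst.
by under eq_fun do rewrite big_cons; exact: (cmeasM (mF i) IH).
Qed.

Lemma cmeas_symbol a : cmeas (symbol a : 'rV[mr]_d -> R[i]).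
Proof.
apply: cmeas_prod => i; apply: cmeasM.
  split => /=; last exact: measurable_cst.
  apply: (measurableT_comp (measurable_powR (a ord0 i))); apply: (measurableT_comp (@normr_measurable R setT)).
  by apply: measurable_funM => //; exact: measurable_coord.
apply: (@cmeas_cexpi _ 'rV[mr]_d R (fun t => pi * a ord0 i * Num.sg (t ord0 i) / 2)).
apply: measurable_funM => //; apply: measurable_funM => //.
have msg : measurable_fun setT (Num.sg : mr -> R).
  have -> : Num.sg = (fun s : R => \1_(`]0%R, +oo[%classic : set R) s - \1_(`]-oo, 0%R[%classic : set R) s).
    apply/funext => s; rewrite !indicE; have [s0|s0|->] := ltgtP s 0.
    - by rewrite ltr0_sg// memNset ?mem_set ?sub0r//= in_itv/= ?andbT ?s0//; apply/negP; rewrite -leNgt ltW.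
    - by rewrite gtr0_sg// mem_set ?memNset ?subr0//= in_itv/= ?andbT ?s0//; apply/negP; rewrite -leNgt ltW.
    - by rewrite sgr0 !memNset ?subr0//= in_itv/= ltxx.
  by apply: measurable_funB; apply: measurable_indic; exact: measurable_itv.
exact: (measurableT_comp msg (measurable_coord i)).
Qed.

Lemma cmeas_opE a f : cmeas (f : 'rV[mr]_d -> R[i]) -> cmeas (opE a f : 'rV[mr]_d -> R[i]).
Proof. by move=> mf; exact: (cmeasM (cmeas_symbol a) mf). Qed.

Lemma normsq_opE a f t : normsq (opE a f t) = vpow (mabs t) (2 *: a) * normsq (f t).
Proof. by rewrite opEE normsqM normsq_symbol. Qed.

Lemma Lnorm2kE a x : cmeas (fourier x : 'rV[mr]_d -> R[i]) -> Lnorm2k a x = N2 (opE a (fourier x)).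
Proof.
move=> mx; have c0 : (0 <= ((2 * pi) `^ (\sum_i 2 * a ord0 i))%:E :> \bar R)%E by rewrite lee_fin powR_ge0.
rewrite /Lnorm2k -ge0_integralZl//; last 2 first.
- apply/measurable_EFinP; apply: measurable_funM.
    have h : measurable_fun setT (fun t : 'rV[mr]_d => vpow (1 *: vabs t) (2 *: a)).
      exact: (measurableT_comp (measurable_vpow _) (@measurable_scale_abs R d 1)).
    by apply: eq_measurable_fun h => t _; rewrite scale1r.
  rewrite (_ : (fun t => _) = (fun t => normsq (fourier x t))); last by apply/funext => t; rewrite normsqE.
  exact: (@measurable_normsq _ 'rV[mr]_d R _ mx).
- by move=> t _; rewrite lee_fin mulr_ge0 ?vpow_ge0// sqr_ge0.
apply: eq_integral => t _; rewrite normsq_opE -EFinM normsqE mulrA; congr (_ * _)%:E.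
have tp : 2 * pi != 0 :> R by rewrite gt_eqF.
have -> : (2 * pi) `^ (\sum_i 2 * a ord0 i) = \prod_i (2 * pi) `^ (2 * a ord0 i) :> R.
  by rewrite /powR (negbTE tp) mulr_suml expR_sum.
rewrite /vpow -big_split/=; apply: eq_bigr => i _.
have -> : vabs t ord0 i = `|t ord0 i| by rewrite mxE.
by rewrite mabsE [(2 *: a) _ _]mxE [RHS]powRM ?normr_ge0 ?(ltW two_pi_gt0).
Qed.

(** Pointwise identities between powers break down where a coordinate is 0, since [powR] there
    follows a convention; this happens only on a null set. *)
Lemma ae_nonzero : {ae mu, forall t : 'rV[mr]_d, forall i, t ord0 i != 0}.
Proof.
apply: filter_forall => i.
pose A j : set R := if j == i then [set 0] else setT.
have mA j : measurable (A j : set mr) by rewrite /A; case: ifPn => _; [exact: measurable_set1|exact: measurableT].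
exists [set t : 'rV[mr]_d | forall j, A j (t ord0 j)]; split.
- exact: (@measurable_rV_box R d A).
- rewrite (@lebesgue_rV_box R d A)// (bigD1 i)//= /A eqxx.
  by rewrite [X in (X * _)%E](_ : _ = 0%E) ?mul0e//; exact: lebesgue_measure_set1.
move=> t /= /negP; rewrite negbK => /eqP t0 j; rewrite /A; case: ifPn => [/eqP ->|//].
exact: t0.
Qed.

Lemma mabs_gt0 t : (forall i, t ord0 i != 0) -> forall i, 0 < mabs t ord0 i.
Proof. by move=> t0 i; rewrite mabsE mulr_gt0// normr_gt0. Qed.

Lemma spaceL_L2 a x : spaceL a x -> L2 x /\ L2 (opE a (fourier x)).
Proof.
move=> [/memL2P Lx xoo]; split => //.
have [_ [mx _] _] := fourierP Lx; split; first exact: cmeas_opE.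
by rewrite -Lnorm2kE.
Qed.

Lemma L2norm_opD a x : L2 (opE a (fourier x)) -> L2norm (opD a x) = (Num.sqrt (nn (opE a (fourier x))))%:E.
Proof.
move=> Ly; have Fy := inv_fourierP Ly; have [Lo _ _] := Fy.
by rewrite /opD L2norm_sqrt// (isF_isometry Fy).
Qed.

End multiplier.

(** * The supremum norm of an inverse transform *)

Section Cnorm_inversion.
Context {R : realType} (d : nat).
Notation mr := (measurableTypeR R).
Notation mu := (lebesgue_rV R d).
Implicit Types y : 'rV[R]_d -> R[i].

Lemma Cnorm_inv_fourier_le y : cintegrable mu y ->
  (Cnorm (inv_fourier y) <= \int[mu]_u (Num.sqrt (normsq (y u)))%:E)%E.
Proof.
move=> jy; have [c1 c2] := inversion_integral_continuous jy.
apply: (@le_trans _ _ (ereal_sup [set (ComplexField.Normc.normc (inversion_integral y t))%:E | t in setT])).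
  by apply: ereal_inf_lbound; exists (inversion_integral y); split => //; exact: inv_fourier_ae.
by apply: ge_ereal_sup => _ [t _ <-]; exact: normc_inversion_le.
Qed.

(** By [ae_eq_continuous] the inversion integral is the only continuous representative, so the
    infimum in [Cnorm] runs over a single value. *)
Lemma Cnorm_inv_fourier_ge y t : cintegrable mu y ->
  ((ComplexField.Normc.normc (inversion_integral y t))%:E <= Cnorm (inv_fourier y))%E.
Proof.
move=> jy; have [c1 c2] := inversion_integral_continuous jy.
apply: le_ereal_inf_tmp => _ [g [g1 g2 yg ->]].
have E : g = inversion_integral y.
  have ae : {ae mu, forall t, g t = inversion_integral y t}.
    have [A [mA A0 hA]] := yg; have [B [mB B0 hB]] := inv_fourier_ae jy.
    exists (A `|` B); split; [exact: measurableU|by rewrite measureU0|].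
    move=> u /= nu; have [Au|nAu] := pselect (A u); [by left|right; apply: hB => /= Bu].
    by apply: nAu; apply: hA => /= Au; apply: nu; rewrite -Au.
  have e1 : (fun t => complex.Re (g t)) = (fun t => complex.Re (inversion_integral y t)).
    apply: ae_eq_continuous => //; have [A [mA A0 hA]] := ae; exists A; split => // u /= nu.
    by apply: hA => /= Au; apply: nu; rewrite Au.
  have e2 : (fun t => complex.Im (g t)) = (fun t => complex.Im (inversion_integral y t)).
    apply: ae_eq_continuous => //; have [A [mA A0 hA]] := ae; exists A; split => // u /= nu.
    by apply: hA => /= Au; apply: nu; rewrite Au.
  apply/funext => u; move/(congr1 (@^~ u)) : e1; move/(congr1 (@^~ u)) : e2.
  by case: (g u) (inversion_integral y u) => a b [c e] /= -> ->.
by rewrite E; apply: ereal_sup_ubound; exists t.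
Qed.

End Cnorm_inversion.

(** * The inequality *)

Section interpolation_inequality.
Context {R : realType} (d m : nat).
Notation mr := (measurableTypeR R).
Notation mu := (lebesgue_rV R d).
Notation L2 := (@L2 _ 'rV[mr]_d R mu).
Notation nn := (@nn _ 'rV[mr]_d R mu).
Variables (k : 'rV[R]_d) (r : 'I_m.+1 -> 'rV[R]_d) (lambda : 'I_m.+1 -> R).
Implicit Types (h : 'I_m.+1 -> R) (f x : 'rV[R]_d -> R[i]).

Lemma integral_mabs (G : 'rV[mr]_d -> \bar R) : measurable_fun setT G -> (forall t, 0 <= G t)%E ->
  (\int[mu]_t G (mabs t) = (pi ^- d)%:E * \int[mu]_(t in orthant) G t)%E.
Proof.
move=> mG G0; rewrite -(@scaled_integral R d 1 G)//; apply: eq_integral => t _.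
by rewrite expr1n mul1e mulr1.
Qed.

Lemma integral_den f h : (forall j, 0 < h j) -> cmeas (f : 'rV[mr]_d -> R[i]) ->
  (forall l, L2 (opE (r l) f)) ->
  (\int[mu]_t (den r h (mabs t) * normsq (f t))%:E = (\sum_l h l * nn (opE (r l) f))%:E)%E.
Proof.
move=> h0 mf Lf.
transitivity (\sum_l (h l)%:E * N2 mu (opE (r l) f))%E; last first.
  by rewrite -sumEFin; apply: eq_bigr => l _; rewrite EFinM (nnK (Lf l)).
have mN l : measurable_fun setT (fun t : 'rV[mr]_d => (normsq (opE (r l) f t))%:E).
  by apply: (@measurable_normsqE _ 'rV[mr]_d R); have [] := Lf l.
transitivity (\sum_l \int[mu]_t ((h l)%:E * (normsq (opE (r l) f t))%:E))%E; last first.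
  apply: eq_bigr => l _; rewrite ge0_integralZl//.
  - by move=> t _; rewrite lee_fin normsq_ge0.
  - by rewrite lee_fin ltW.
rewrite -ge0_integral_sum//.
- apply: eq_integral => t _; rewrite /den mulr_suml -sumEFin; apply: eq_bigr => l _.
  by rewrite normsq_opE -EFinM mulrA.
- by move=> l; apply: emeasurable_funM; [exact: measurable_cst|exact: mN].
- by move=> l t _; rewrite -EFinM lee_fin mulr_ge0 ?normsq_ge0// ltW.
Qed.

Lemma measurable_sqrt_normsq f : cmeas (f : 'rV[mr]_d -> R[i]) ->
  measurable_fun setT (fun t : 'rV[mr]_d => (Num.sqrt (normsq (f t)))%:E).
Proof.
move=> mf; apply/measurable_EFinP; have mq := @measurable_normsq _ 'rV[mr]_d R _ mf.
by apply: (measurableT_comp _ mq); apply: continuous_measurable_fun; exact: sqrt_continuous.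
Qed.

(** Wherever no coordinate vanishes, |[opE k f]|^2 is the product of the integrand and den |f|^2;
    weight the two factors by e and 1 / e and use 2 sqrt(A B) <= A + B. *)
Lemma integral_opE_le f h (e : R) : (forall j, 0 < h j) -> 0 < e -> cmeas (f : 'rV[mr]_d -> R[i]) ->
  (forall l, L2 (opE (r l) f)) ->
  (2%:E * \int[mu]_t (Num.sqrt (normsq (opE k f t)))%:E <=
   e%:E * \int[mu]_t (integrand k r h (mabs t))%:E + (e^-1 * \sum_l h l * nn (opE (r l) f))%:E)%E.
Proof.
move=> h0 e0 mf Lf; have ms := measurable_sqrt_normsq (cmeas_opE k mf).
have mi : measurable_fun setT (fun t : 'rV[mr]_d => (integrand k r h (mabs t))%:E).
  by apply/measurable_EFinP; exact: (measurableT_comp (measurable_integrand k r h0) (@measurable_mabs R d)).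
have md : measurable_fun setT (fun t : 'rV[mr]_d => (den r h (mabs t) * normsq (f t))%:E).
  apply/measurable_EFinP; apply: measurable_funM.
    exact: (measurableT_comp (measurable_den r h) (@measurable_mabs R d)).
  exact: (@measurable_normsq _ 'rV[mr]_d R _ mf).
have i0 t : 0 <= integrand k r h (mabs t) by exact: integrand_ge0.
have d0 t : 0 <= den r h (mabs t) * normsq (f t) by rewrite mulr_ge0 ?normsq_ge0 ?den_ge0.
have ei : 0 < e^-1 by rewrite invr_gt0.
have i0E (t : 'rV[mr]_d) : setT t -> (0 <= (integrand k r h (mabs t))%:E)%E by rewrite lee_fin.
have d0E (t : 'rV[mr]_d) : setT t -> (0 <= (den r h (mabs t) * normsq (f t))%:E)%E by rewrite lee_fin.
have s0E (t : 'rV[mr]_d) : setT t -> (0 <= (Num.sqrt (normsq (opE k f t)))%:E)%E by rewrite lee_fin sqrtr_ge0.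
have eE : (0 <= e%:E)%E by rewrite lee_fin ltW.
have eiE : (0 <= (e^-1)%:E)%E by rewrite lee_fin ltW.
have tE : (0 <= 2%:E :> \bar R)%E by rewrite lee_fin.
rewrite EFinM -(integral_den h0 mf Lf) -(ge0_integralZl mu measurableT mi i0E eE).
rewrite -(ge0_integralZl mu measurableT md d0E eiE) -(ge0_integralZl mu measurableT ms s0E tE).
have mZ (q : R) (g : 'rV[mr]_d -> \bar R) : measurable_fun setT g -> measurable_fun setT (fun t => q%:E * g t)%E.
  by move=> mg; apply: emeasurable_funM => //; exact: measurable_cst.
have iZ (t : 'rV[mr]_d) : setT t -> (0 <= e%:E * (integrand k r h (mabs t))%:E)%E by move=> tT; rewrite mule_ge0// i0E.
have dZ (t : 'rV[mr]_d) : setT t -> (0 <= (e^-1)%:E * (den r h (mabs t) * normsq (f t))%:E)%E by move=> tT; rewrite mule_ge0// d0E.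
rewrite -(ge0_integralD mu measurableT iZ (mZ e _ mi) dZ (mZ e^-1 _ md)).
have a1 (t : 'rV[mr]_d) : setT t -> (0 <= 2%:E * (Num.sqrt (normsq (opE k f t)))%:E)%E by move=> tT; rewrite mule_ge0// s0E.
have a2 (t : 'rV[mr]_d) : setT t -> (0 <= e%:E * (integrand k r h (mabs t))%:E + (e^-1)%:E * (den r h (mabs t) * normsq (f t))%:E)%E.
  by move=> tT; apply: adde_ge0; [exact: iZ|exact: dZ].
apply: (ae_ge0_le_integral measurableT a1 (mZ 2 _ ms) a2); first by apply: emeasurable_funD; exact: mZ.
apply: filterS (@ae_nonzero R d) => t t0 _; rewrite -!EFinM -EFinD lee_fin.
have dp := den_gt0 r h0 (mabs_gt0 t0).
set A := e * _; set B := e^-1 * _.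
have -> : normsq (opE k f t) = A * B.
  by rewrite normsq_opE /A /B /integrand; move: dp; set D := den _ _ _ => dp; field; rewrite !gt_eqF.
have A0 : 0 <= A by rewrite mulr_ge0// ltW.
have B0 : 0 <= B by rewrite mulr_ge0// ltW.
have h2 : Num.sqrt (A * B) <= Num.sqrt (((A + B) / 2) ^+ 2).
  apply: ler_wsqrtr; rewrite exprMn; have := sqr_ge0 (A - B); nra.
rewrite sqrtr_sqr ger0_norm in h2; last by rewrite divr_ge0// addr_ge0.
lra.
Qed.

Lemma le_of_weighted_sum (A E : R) : 0 <= E -> (forall e, 0 < e -> 2 * A <= e * E ^+ 2 + e^-1) -> A <= E.
Proof.
move=> E0 H; rewrite leNgt; apply/negP => EA; have A0 : 0 < A by exact: le_lt_trans EA.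
(* At e = 1 / A the assumption reads A^2 <= E^2. *)
have := H A^-1; rewrite invr_gt0 invrK => /(_ A0).
rewrite -(ler_pM2l A0) mulrDr mulVKf ?gt_eqF//; nra.
Qed.

Lemma cintegrable_sqrt_normsq f : cmeas (f : 'rV[mr]_d -> R[i]) ->
  (\int[mu]_t (Num.sqrt (normsq (f t)))%:E < +oo)%E -> cintegrable mu f.
Proof.
move=> mf foo; have ms := measurable_sqrt_normsq mf.
have ig : mu.-integrable setT (fun t => (Num.sqrt (normsq (f t)))%:E).
  apply/integrableP; split => //; under eq_integral do rewrite gee0_abs ?lee_fin ?sqrtr_ge0//.
  exact: foo.
have [m1 m2] := mf; split; apply: (@le_integrable _ _ _ mu setT measurableT _ _ _ _ ig).
- exact/measurable_EFinP.
- move=> t _; rewrite /= lee_fin (ger0_norm (sqrtr_ge0 _)) -sqrtr_sqr ler_wsqrtr//.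
  by rewrite lerDl sqr_ge0.
- exact/measurable_EFinP.
- move=> t _; rewrite /= lee_fin (ger0_norm (sqrtr_ge0 _)) -sqrtr_sqr ler_wsqrtr//.
  by rewrite lerDr sqr_ge0.
Qed.

Hypotheses (lambda_gt0 : forall j, 0 < lambda j) (lambda_sum1 : \sum_j lambda j = 1).
Variable c : R.
Hypothesis cE : ((pi ^- d)%:E * continuous_sup k r lambda)%E = c%:E.

Lemma weighted_integral_mabs_le h : (forall j, 0 < h j) ->
  ((weight lambda h)%:E * \int[mu]_t (integrand k r h (mabs t))%:E <= c%:E)%E.
Proof.
move=> h0; rewrite (integral_mabs (G := fun t => (integrand k r h t)%:E)); last 2 first.
- by apply/measurable_EFinP; exact: measurable_integrand.
- by move=> t; rewrite lee_fin integrand_ge0.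
rewrite muleCA -cE; apply: lee_wpmul2l; first by rewrite lee_fin invr_ge0 exprn_ge0// pi_ge0.
by apply: ereal_sup_ubound; exists h.
Qed.

Let c0 : 0 <= c.
Proof.
rewrite -lee_fin; apply: le_trans (weighted_integral_mabs_le (h := fun=> 1) (fun=> ltr01)).
by rewrite mule_ge0// ?lee_fin ?weight_ge0//; apply: integral_ge0 => t _; rewrite lee_fin integrand_ge0.
Qed.

Let Lam : R := \prod_j lambda j `^ (- lambda j).
Let K : R := Num.sqrt (c * Lam).

Let Lam_gt0 : 0 < Lam.
Proof. by apply: prodr_gt0 => j _; exact: powR_gt0. Qed.

Lemma integral_opE_le_prod f : cmeas (f : 'rV[mr]_d -> R[i]) -> (forall l, L2 (opE (r l) f)) ->
  (\int[mu]_t (Num.sqrt (normsq (opE k f t)))%:E <=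
   (K * \prod_j Num.sqrt (nn (opE (r j) f)) `^ lambda j)%:E)%E.
Proof.
move=> mf Lf; pose X l := Num.sqrt (nn (opE (r l) f)).
have ms := measurable_sqrt_normsq (cmeas_opE k mf).
have X2 l : nn (opE (r l) f) = X l ^+ 2 by rewrite sqr_sqrtr// nn_ge0.
have E0 : 0 <= K * \prod_j X j `^ lambda j.
  by rewrite mulr_ge0 ?sqrtr_ge0// prodr_ge0// => j _; rewrite powR_ge0.
(* If one norm vanishes then f is 0 almost everywhere, since the symbol can vanish only on the
   coordinate hyperplanes. *)
have [[l Xl0]|nX] := pselect (exists l, X l = 0).
  have h1 : {ae mu, forall t, opE (r l) f t = 0} by apply: (nn_eq0_ae (Lf l)); rewrite X2 Xl0 expr0n.
  rewrite (@ge0_ae_eq_integral _ _ _ mu setT _ (cst 0%E))//; first by rewrite integral0 lee_fin.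
  apply: filterS2 (@ae_nonzero R d) h1 => t t0 ft0 _ /=.
  have := normsq_opE (r l) f t; rewrite ft0 => /esym/eqP.
  have -> : normsq (0 : R[i]) = 0 by apply/eqP; rewrite normsq_eq0.
  rewrite mulf_eq0 (gt_eqF (vpow_gt0 _ (mabs_gt0 t0)))/=.
  by rewrite normsq_opE => /eqP ->; rewrite mulr0 sqrtr0.
have X0 l : 0 < X l.
  by rewrite lt_neqAle sqrtr_ge0 andbT eq_sym; apply/eqP => Xl; apply: nX; exists l.
(* With these weights sum_l h_l X_l^2 is 1 and [weight lambda h] is the inverse of [Lam] times the
   squared product of norms, which is how [Lam] enters the constant. *)
pose h l := lambda l / X l ^+ 2.
have h0 l : 0 < h l by rewrite divr_gt0// exprn_gt0.
have hX : \sum_l h l * nn (opE (r l) f) = 1.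
  rewrite -lambda_sum1; apply: eq_bigr => l _; rewrite X2 /h mulfVK// expf_neq0// gt_eqF//.
have wE : weight lambda h = (Lam * (\prod_j X j `^ lambda j) ^+ 2)^-1.
  rewrite /weight /Lam -prodrXl -big_split/= -prodfV; apply: eq_bigr => j _.
  rewrite /h powRN /powR !gt_eqF ?divr_gt0 ?exprn_gt0// ln_div ?posrE ?exprn_gt0// lnXn//.
  by rewrite -expRM_natl -!expRN -expRD -expRN; congr expR; rewrite mulr_natl -mulr_natl; ring.
have wI := weighted_integral_mabs_le h0.
set I := (\int[mu]_t (integrand k r h (mabs t))%:E)%E in wI.
have P0 : 0 < \prod_j X j `^ lambda j by apply: prodr_gt0 => j _; exact: powR_gt0.
have KE : (K * \prod_j X j `^ lambda j) ^+ 2 = c * (Lam * (\prod_j X j `^ lambda j) ^+ 2).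
  have cL : 0 <= c * Lam by apply: mulr_ge0 => //; exact: ltW.
  by rewrite exprMn (sqr_sqrtr cL) mulrA.
have IE : (I <= ((K * \prod_j X j `^ lambda j) ^+ 2)%:E)%E.
  have w0 := weight_gt0 lambda h0; have wi : 0 < (weight lambda h)^-1 by rewrite invr_gt0.
  rewrite KE -(@lee_pmul2l _ (weight lambda h)%:E)//; apply: le_trans wI _.
  by rewrite -EFinM lee_fin wE mulrCA mulVf ?mulr1// gt_eqF// mulr_gt0// exprn_gt0.
have H (e : R) : 0 < e -> (2%:E * \int[mu]_t (Num.sqrt (normsq (opE k f t)))%:E <=
    (e * (K * \prod_j X j `^ lambda j) ^+ 2 + e^-1)%:E)%E.
  move=> e0; apply: le_trans (integral_opE_le h0 e0 mf Lf) _; rewrite hX mulr1 EFinD EFinM.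
  by apply: leeD => //; apply: lee_wpmul2l => //; rewrite lee_fin ltW.
set J := (\int[mu]_t _)%E in H *.
have J0 : (0 <= J)%E by apply: integral_ge0 => t _; rewrite lee_fin sqrtr_ge0.
have Jf : J \is a fin_num.
  rewrite ge0_fin_numE//; have := H 1 ltr01; case: (J) J0 => [j|//|//] _; first by rewrite ltry.
  by rewrite gt0_muley.
rewrite -(fineK Jf) lee_fin; apply: le_of_weighted_sum => // e e0.
by rewrite -lee_fin EFinM fineK//; exact: H.
Qed.

(** The bound on the integral of |[opE k (fourier x)]| first shows that the inversion integral
    converges absolutely and then bounds its supremum. *)
Lemma interpolation_inequality x : (forall l, spaceL (r l) x) ->
  (Cnorm (opD k x) <= K%:E * \prod_j L2norm (opD (r j) x) `^ lambda j)%E.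
Proof.
move=> sx; have Lf l : L2 (opE (r l) (fourier x)) by have [] := spaceL_L2 (sx l).
have [Lx _] := spaceL_L2 (sx ord0); have [_ [mf _] _] := fourierP Lx.
have H := integral_opE_le_prod mf Lf.
have -> : (\prod_j L2norm (opD (r j) x) `^ lambda j = (\prod_j Num.sqrt (nn (opE (r j) (fourier x))) `^ lambda j)%:E)%E.
  by rewrite -prodEFin; apply: eq_bigr => j _; rewrite L2norm_opD// poweR_EFin.
rewrite -EFinM; apply: le_trans (H); apply: Cnorm_inv_fourier_le.
apply: cintegrable_sqrt_normsq; first exact: cmeas_opE.
by apply: le_lt_trans H _; rewrite ltry.
Qed.

End interpolation_inequality.

(** * Extremal functions *)

(** After division by J each factor satisfies p/J <= exp(p/J - 1), and the lambda-weighted sum of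
    these exponents is zero. *)
Lemma weighted_amgm {R : realType} (m : nat) (lambda p : 'I_m.+1 -> R) (J : R) :
  (forall j, 0 < lambda j) -> \sum_j lambda j = 1 -> (forall j, 0 <= p j) ->
  0 < J -> \sum_j lambda j * p j = J -> \prod_j p j `^ lambda j <= J.
Proof.
move=> l0 l1 p0 J0 pJ.
have -> : \prod_j p j `^ lambda j = J * \prod_j (p j / J) `^ lambda j.
  have {1}-> : J = \prod_j J `^ lambda j by rewrite /powR gt_eqF// -expR_sum -mulr_suml l1 mul1r lnK.
  rewrite -big_split/=; apply: eq_bigr => j _.
  by rewrite -powRM ?(ltW J0) ?divr_ge0 ?(ltW J0)// mulrC divfK// gt_eqF.
rewrite -[leRHS]mulr1 ler_pM2l//.
apply: (@le_trans _ _ (\prod_j expR (lambda j * (p j / J - 1)))); last first.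
  rewrite -expR_sum; under eq_bigr do rewrite mulrBr mulr1 mulrA.
  by rewrite big_split/= sumrN l1 -mulr_suml pJ divff ?gt_eqF// subrr expR0.
apply: ler_prod => j _; rewrite powR_ge0/=.
have -> : expR (lambda j * (p j / J - 1)) = expR (p j / J - 1) `^ lambda j.
  by rewrite /powR gt_eqF ?expR_gt0// expRK.
apply: ge0_ler_powR; first exact: ltW.
- by rewrite nnegrE divr_ge0// ltW.
- by rewrite nnegrE expR_ge0.
by apply: le_trans (expR_ge1Dx _); rewrite addrC subrK.
Qed.

Section sharpness.
Context {R : realType} (d m : nat).
Notation mr := (measurableTypeR R).
Notation mu := (lebesgue_rV R d).
Notation L2 := (@L2 _ 'rV[mr]_d R mu).
Notation nn := (@nn _ 'rV[mr]_d R mu).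
Variables (k : 'rV[R]_d) (r : 'I_m.+1 -> 'rV[R]_d) (lambda : 'I_m.+1 -> R).
Implicit Types (f x : 'rV[R]_d -> R[i]) (t : 'rV[R]_d).

Lemma L2_bounded f (M : R) (N : nat) : cmeas (f : 'rV[mr]_d -> R[i]) ->
  (forall t, normsq (f t) <= M) -> csupp N f -> L2 f.
Proof.
move=> mf fM fN; split => //.
have mc := @measurable_cube R d N; have co := @lebesgue_cube_lty R d N.
have M0 : 0 <= M by apply: le_trans (fM 0); exact: normsq_ge0.
have mq := @measurable_normsqE _ 'rV[mr]_d R _ mf.
apply: (@le_lt_trans _ _ (\int[mu]_(t in cube N) cst M%:E t)%E).
  rewrite /N2 [leRHS]integral_mkcond; apply: ge0_le_integral => //.
  - by move=> t _; rewrite lee_fin normsq_ge0.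
  - by apply: (iffLR (@measurable_restrictT _ _ 'rV[mr]_d _ _ _ mc)); exact: measurable_cst.
  move=> t _; rewrite patchE; case: ifPn => [_|]; first by rewrite lee_fin.
  rewrite notin_setE => /fN ->.
  by have -> : normsq (0 : R[i]) = 0 by apply/eqP; rewrite normsq_eq0.
rewrite integral_cst//; apply: lte_mul_pinfty; [by rewrite lee_fin|by []|exact: co].
Qed.

Variable h : 'I_m.+1 -> R.
Hypothesis h0 : forall j, 0 < h j.

(** A bounded region on which den is bounded below and all powers involved are bounded above, so
    that the truncated extremal transform lies in every weighted L2 space. *)
Definition goodset (N : nat) : set 'rV[R]_d := [set t | [/\ cube N t,
  (N.+1%:R)^-1 <= den r h (mabs t), vpow (mabs t) (2 *: k) <= N%:R
  & \sum_l vpow (mabs t) (2 *: r l) <= N%:R]].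

Let mvpow a : measurable_fun setT (fun t : 'rV[mr]_d => vpow (mabs t) a).
Proof. exact: (measurableT_comp (measurable_vpow a) (@measurable_mabs R d)). Qed.

Let mden : measurable_fun setT (fun t : 'rV[mr]_d => den r h (mabs t)).
Proof. exact: (measurableT_comp (measurable_den r h) (@measurable_mabs R d)). Qed.

Let mint : measurable_fun setT (fun t : 'rV[mr]_d => integrand k r h (mabs t)).
Proof. exact: (measurableT_comp (measurable_integrand k r h0) (@measurable_mabs R d)). Qed.

Lemma measurable_goodset N : measurable (goodset N : set 'rV[mr]_d).
Proof.
have sub (g : 'rV[mr]_d -> R) (A : set R) : measurable_fun setT g -> measurable (A : set mr) -> measurable (g @^-1` A).
  by move=> mg mA; rewrite -[X in measurable X]setTI; exact: mg.
have -> : goodset N = cube N `&` ((fun t => den r h (mabs t)) @^-1` `[(N.+1%:R)^-1, +oo[ `&`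
    ((fun t => vpow (mabs t) (2 *: k)) @^-1` `]-oo, N%:R] `&` (fun t => \sum_l vpow (mabs t) (2 *: r l)) @^-1` `]-oo, N%:R])).
  apply/seteqP; split => t /=; rewrite !in_itv/= ?andbT; first by case.
  by case=> ? [? []].
apply: measurableI; first exact: measurable_cube.
apply: measurableI; first by apply: sub => //; exact: measurable_itv.
apply: measurableI; first by apply: sub => //; exact: measurable_itv.
by apply: sub; [exact: measurable_sum|exact: measurable_itv].
Qed.

Lemma cvg_integral_goodset :
  (\int[mu]_(t in goodset N) (integrand k r h (mabs t))%:E @[N --> \oo] -->
   \int[mu]_t (integrand k r h (mabs t))%:E)%E.
Proof.
have mi : measurable_fun setT (fun t : 'rV[mr]_d => (integrand k r h (mabs t))%:E) by apply/measurable_EFinP.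
have -> : (\int[mu]_t (integrand k r h (mabs t))%:E = \int[mu]_(t in \bigcup_N goodset N) (integrand k r h (mabs t))%:E)%E.
  rewrite [RHS]integral_mkcond; apply: eq_integral => t _; rewrite patchE; case: ifPn => //.
  (* Only points with den = 0 escape all good sets, and there the integrand is 0 because the inverse
     of 0 is 0. *)
  rewrite notin_setE => nt; have [d0|d0] := eqVneq (den r h (mabs t)) 0.
    by rewrite /integrand d0 invr0 mulr0.
  have dp : 0 < den r h (mabs t) by rewrite lt_neqAle eq_sym d0 den_ge0.
  exfalso; apply: nt.
  pose s := \sum_i `|t ord0 i| + (den r h (mabs t))^-1 + vpow (mabs t) (2 *: k) + \sum_l vpow (mabs t) (2 *: r l).
  have [N /(_ N (leqnn N)) sN] := bound_nat s.
  have s1 : 0 <= \sum_i `|t ord0 i| by apply: sumr_ge0.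
  have s2 : 0 < (den r h (mabs t))^-1 by rewrite invr_gt0.
  have s3 := vpow_ge0 (mabs t) (2 *: k).
  have s4 : 0 <= \sum_l vpow (mabs t) (2 *: r l) by apply: sumr_ge0 => l _; exact: vpow_ge0.
  exists N => //; rewrite /s in sN; split; [move=> i| |lra|lra].
    apply: (@le_trans _ _ (\sum_i `|t ord0 i|)); last by lra.
    by rewrite (bigD1 i)//= lerDl sumr_ge0.
  rewrite -[leRHS]invrK lef_pV2 ?posrE ?invr_gt0//.
  by apply: (@le_trans _ _ N%:R); [lra|rewrite ler_nat].
apply: ge0_nondecreasing_set_cvg_integral.
- apply/nondecreasing_seqP => N; rewrite subsetEset => t [t1 t2 t3 t4].
  have NN : N%:R <= N.+1%:R :> R by rewrite ler_nat.
  split; [by move=> i; exact: le_trans (t1 i) NN| |exact: le_trans t3 NN|exact: le_trans t4 NN].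
  by apply: le_trans t2; rewrite lef_pV2 ?posrE// ler_nat.
- by move=> N; exact: measurable_goodset.
- by move=> N; exact: measurable_funTS.
- by move=> N t _; rewrite lee_fin integrand_ge0.
Qed.

(* The extremal Fourier transform, truncated: its image under [opE k] is the
   nonnegative function [integrand], so that D^k x is largest at the origin. *)
Definition extremizer (N : nat) : 'rV[R]_d -> R[i] :=
  restrict (goodset N) (fun t => conjc (symbol k t) * Complex (den r h (mabs t))^-1 0).

Let cmeas_den : cmeas ((fun t => Complex (den r h (mabs t))^-1 0) : 'rV[mr]_d -> R[i]).
Proof.
split => /=; last exact: measurable_cst.
rewrite (_ : (fun t => _) = (fun t => den r h (mabs t) `^ (-1))); last first.
  by apply/funext => t; rewrite powR_inv1// den_ge0.
exact: (measurableT_comp (measurable_powR (-1)) mden).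
Qed.

Lemma cmeas_extremizer N : cmeas (extremizer N : 'rV[mr]_d -> R[i]).
Proof.
apply: restrict_cmeas; first exact: measurable_goodset.
apply: cmeasM; last exact: cmeas_den.
exact: (cmeas_conj (cmeas_symbol k)).
Qed.

Let den_good N t : goodset N t -> 0 < den r h (mabs t).
Proof. by case=> _ h2 _ _; apply: lt_le_trans h2; rewrite invr_gt0. Qed.

Lemma normsq_extremizer N t : normsq (extremizer N t) =
  if t \in goodset N then vpow (mabs t) (2 *: k) / den r h (mabs t) ^+ 2 else 0.
Proof.
rewrite /extremizer /restrict; case: ifPn => _; last by apply/eqP; rewrite normsq_eq0.
rewrite normsqM normsq_conj normsq_symbol; congr (_ * _).
by rewrite /normsq/= [X in _ + X]expr0n addr0 exprVn.
Qed.

Lemma opE_extremizer N t : opE k (extremizer N) t =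
  Complex (if t \in goodset N then integrand k r h (mabs t) else 0) 0.
Proof.
rewrite opEE /extremizer /restrict; case: ifPn => _; last by rewrite mulr0.
rewrite mulrA; have -> : symbol k t * conjc (symbol k t) = Complex (normsq (symbol k t)) 0.
  by case: (symbol k t) => a b; apply/eqP; rewrite eq_complex /normsq/=; apply/andP; split; apply/eqP; ring.
by rewrite normsq_symbol /integrand; apply/eqP; rewrite eq_complex/= !mulr0 !mul0r subr0 addr0 !eqxx.
Qed.

Lemma csupp_extremizer a N : csupp N (opE a (extremizer N)).
Proof.
move=> t nt; rewrite opEE /extremizer /restrict memNset ?mulr0//.
by case=> /nt.
Qed.

Lemma extremizer_bound N t : normsq (extremizer N t) <= N%:R * N.+1%:R ^+ 2.
Proof.
rewrite normsq_extremizer; case: ifPn => [|_]; last by rewrite mulr_ge0// exprn_ge0.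
rewrite inE => tN; have dp := den_good tN; case: tN => _ h2 h3 _.
apply: ler_pM => //; [exact: vpow_ge0|by rewrite invr_ge0 exprn_ge0// ltW|].
rewrite -exprVn; apply: lerXn2r; rewrite ?nnegrE// ?invr_ge0 ?(ltW dp)//.
by rewrite -[leRHS]invrK lef_pV2 ?posrE ?invr_gt0.
Qed.

Lemma L2_extremizer N : L2 (extremizer N).
Proof.
apply: (L2_bounded (cmeas_extremizer N) (extremizer_bound N) (N := N)).
by move=> t nt; rewrite /extremizer /restrict memNset//; case=> /nt.
Qed.

Lemma L2_opE_extremizer N l : L2 (opE (r l) (extremizer N)).
Proof.
apply: (@L2_bounded _ (N%:R * (N%:R * N.+1%:R ^+ 2)) N).
- exact/cmeas_opE/cmeas_extremizer.
- move=> t; have [tN|tN] := pselect (goodset N t).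
    rewrite normsq_opE; apply: ler_pM (extremizer_bound N t); [exact: vpow_ge0|exact: normsq_ge0|].
    case: tN => _ _ _; apply: le_trans; rewrite (bigD1 l)//= lerDl sumr_ge0// => j _; exact: vpow_ge0.
  rewrite normsq_opE normsq_extremizer memNset// mulr0 mulr_ge0// mulr_ge0// exprn_ge0//.
- exact: csupp_extremizer.
Qed.

Let J N : R := \sum_l h l * nn (opE (r l) (extremizer N)).

(** On the good set den times |extremizer|^2 is the integrand itself; hence the weighted sum of
    squared norms and the value of D^k x at the origin are the same number. *)
Lemma integral_goodset N : (\int[mu]_(t in goodset N) (integrand k r h (mabs t))%:E = (J N)%:E)%E.
Proof.
rewrite /J -(integral_den h0 (cmeas_extremizer N) (L2_opE_extremizer N)) integral_mkcond.
apply: eq_integral => t _; rewrite patchE normsq_extremizer; case: ifPn => [|_]; last by rewrite mulr0.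
rewrite inE => /den_good dp; congr EFin; rewrite /integrand; move: dp; set D := den _ _ _ => dp.
by field; rewrite gt_eqF.
Qed.

End sharpness.

Lemma powR_sqr {R : realType} (x a : R) : 0 <= x -> (x ^+ 2) `^ a = (x `^ a) ^+ 2.
Proof. by move=> x0; rewrite -!powR_mulrn ?powR_ge0// -!powRrM mulrC. Qed.

(** * Sharpness of the constant *)

Section sharp_constant.
Context {R : realType} (d m : nat).
Notation mr := (measurableTypeR R).
Notation mu := (lebesgue_rV R d).
Notation L2 := (@L2 _ 'rV[mr]_d R mu).
Notation nn := (@nn _ 'rV[mr]_d R mu).
Variables (k : 'rV[R]_d) (r : 'I_m.+1 -> 'rV[R]_d) (lambda : 'I_m.+1 -> R).
Hypotheses (lambda_gt0 : forall j, 0 < lambda j) (lambda_sum1 : \sum_j lambda j = 1).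
Variable c : R.
Hypothesis cE : ((pi ^- d)%:E * continuous_sup k r lambda)%E = c%:E.
Variable K' : R.
Hypothesis K'P : forall x : 'rV[R]_d -> R[i], (forall l, spaceL (r l) x) ->
  (Cnorm (opD k x) <= K'%:E * \prod_j L2norm (opD (r j) x) `^ lambda j)%E.

Let Lam : R := \prod_j lambda j `^ (- lambda j).

Section fixed_weights.
Variable h : 'I_m.+1 -> R.
Hypothesis h0 : forall j, 0 < h j.

Let J N : R := \sum_l h l * nn (opE (r l) (extremizer k r h N)).

Let X N j : R := Num.sqrt (nn (opE (r j) (extremizer k r h N))).

(** Apply the assumed inequality to a preimage x of the extremizer. The sup norm is at least the
    value at 0, which is the integral of the nonnegative function [opE k] of the extremizer, that
    is, [J N]. *)
Lemma extremizer_test N : J N <= K' * \prod_j X N j `^ lambda j.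
Proof.
set f := extremizer k r h N.
have mf : cmeas (f : 'rV[mr]_d -> R[i]) by exact: cmeas_extremizer.
have Lf l : L2 (opE (r l) f) by exact: L2_opE_extremizer.
have [x Fx] := isF_surj (L2_extremizer k r h0 N); have [Lx _ _] := Fx.
have ae : {ae mu, forall t : 'rV[mr]_d, fourier x t = f t} := isF_unique (fourierP Lx) Fx.
have [_ [mx _] _] := fourierP Lx.
have aeE a : {ae mu, forall t : 'rV[mr]_d, opE a (fourier x) t = opE a f t}.
  by apply: filterS ae => t; rewrite !opEE => ->.
have Lx' l : L2 (opE (r l) (fourier x)) /\ nn (opE (r l) (fourier x)) = nn (opE (r l) f).
  exact: (eq_ae_L2 (cmeas_opE (r l) mx) (Lf l) (aeE (r l))).
have sx l : spaceL (r l) x.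
  by split; [exact/memL2P|rewrite Lnorm2kE//; have [[]] := Lx' l].
have := K'P sx.
have -> : (\prod_j L2norm (opD (r j) x) `^ lambda j = (\prod_j X N j `^ lambda j)%:E)%E.
  rewrite -prodEFin; apply: eq_bigr => j _; have [L1 E1] := Lx' j.
  rewrite (L2norm_opD L1) poweR_EFin E1; reflexivity.
rewrite -EFinM -lee_fin; apply: le_trans.
(* The inequality with the known constant supplies integrability, so the inversion integral is the
   continuous representative and may be evaluated at 0. *)
have jy : cintegrable mu (opE k (fourier x)).
  apply: cintegrable_sqrt_normsq; first exact: cmeas_opE.
  apply: le_lt_trans (integral_opE_le_prod lambda_gt0 lambda_sum1 cE mx (fun l => (Lx' l).1)) _.
  by rewrite ltry.
apply: le_trans (Cnorm_inv_fourier_ge 0 jy); rewrite lee_fin inversion_integralE//.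
have normc_ge (z : R[i]) : complex.Re z <= ComplexField.Normc.normc z.
  case: z => a b /=; apply: le_trans (ler_norm a) _; rewrite -sqrtr_sqr ler_wsqrtr// lerDl; exact: sqr_ge0.
apply: le_trans (normc_ge _); rewrite /cintegral/=.
have -> : \int[mu]_t complex.Re (opE k (fourier x) t * cexpi (2 * pi * dotv 0 t)) =
    \int[mu]_t complex.Re (opE k (fourier x) t).
  apply: eq_Rintegral => t _; have -> : dotv 0 t = 0 by apply: big1 => i _; rewrite mxE mul0r.
  by rewrite mulr0 cexpi0 mulr1.
have [my1 _] := cmeas_opE k mx; have [mo1 _] := cmeas_opE k mf.
have ge0Re t : 0 <= complex.Re (opE k f t).
  by rewrite /f opE_extremizer//=; case: ifPn => // _; exact: integrand_ge0.
have E1 : (\int[mu]_t (complex.Re (opE k (fourier x) t))%:E = (J N)%:E)%E.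
  rewrite -(integral_goodset k r h0 N) [RHS]integral_mkcond.
  transitivity (\int[mu]_t (complex.Re (opE k f t))%:E)%E.
    apply: ae_eq_integral => //; [exact/measurable_EFinP|exact/measurable_EFinP|].
    by apply: filterS (aeE k) => t -> _.
  apply: eq_integral => t _; rewrite /f opE_extremizer// patchE /=.
  by case: ifPn.
by rewrite /Rintegral E1.
Qed.

Let J_ge0 N : 0 <= J N.
Proof. by apply: sumr_ge0 => l _; rewrite mulr_ge0 ?nn_ge0// ltW. Qed.

Lemma test_constant_gt0 N : 0 < J N -> 0 < K'.
Proof.
move=> J0; have := lt_le_trans J0 (extremizer_test N).
apply: contraTT; rewrite -!leNgt => K0; apply: mulr_le0_ge0 => //.
by apply: prodr_ge0 => j _; exact: powR_ge0.
Qed.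

(** Weighted AM-GM for p_j = h_j X_j^2 / lambda_j, whose lambda-mean is J, gives Lam weight P^2 <=
    J, where P is the product of the X_j^lambda_j. Together with J <= K' P this yields Lam weight
    J^2 <= K'^2 J. *)
Lemma test_constant_ge N : Lam * weight lambda h * J N <= K' ^+ 2.
Proof.
have [->|JN] := eqVneq (J N) 0; first by rewrite mulr0 sqr_ge0.
have J0 : 0 < J N by rewrite lt_neqAle eq_sym JN J_ge0.
have K0 := test_constant_gt0 J0; set P := \prod_j X N j `^ lambda j.
have P0 : 0 <= P by apply: prodr_ge0 => j _; exact: powR_ge0.
have X0 j : 0 <= X N j by exact: sqrtr_ge0.
have X2 j : nn (opE (r j) (extremizer k r h N)) = X N j ^+ 2 by rewrite sqr_sqrtr// nn_ge0.
pose p j := h j * X N j ^+ 2 / lambda j.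
have p0 j : 0 <= p j by rewrite divr_ge0 ?(ltW (lambda_gt0 j))// mulr_ge0 ?sqr_ge0// ltW.
have pJ : \sum_j lambda j * p j = J N.
  by apply: eq_bigr => j _; rewrite X2 /p mulrC divfK// gt_eqF.
have := weighted_amgm lambda_gt0 lambda_sum1 p0 J0 pJ.
have -> : \prod_j p j `^ lambda j = Lam * weight lambda h * P ^+ 2.
  rewrite /Lam /weight /P -prodrXl -!big_split/=; apply: eq_bigr => j _.
  have lj := lambda_gt0 j; rewrite /p powRM ?invr_ge0 ?(ltW lj) ?mulr_ge0 ?sqr_ge0 ?(ltW (h0 j))//.
  rewrite powRM ?sqr_ge0 ?(ltW (h0 j))//.
  rewrite (powR_sqr _ (X0 j)).
  have -> : (lambda j)^-1 `^ lambda j = lambda j `^ (- lambda j).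
    by rewrite -powR_inv1 ?(ltW lj)// -powRrM mulN1r.
  by rewrite mulrC mulrA.
move=> amgm; have JKP : J N ^+ 2 <= K' ^+ 2 * P ^+ 2.
  rewrite -exprMn; apply: lerXn2r; rewrite ?nnegrE//; last exact: extremizer_test.
  by rewrite mulr_ge0// ltW.
have LW0 : 0 <= Lam * weight lambda h.
  by rewrite mulr_ge0 ?weight_ge0//; apply: prodr_ge0 => j _; exact: powR_ge0.
rewrite -(ler_pM2r J0); apply: (@le_trans _ _ (Lam * weight lambda h * (K' ^+ 2 * P ^+ 2))).
  by rewrite -[leLHS]mulrA -expr2 ler_wpM2l.
by rewrite mulrCA ler_wpM2l// sqr_ge0.
Qed.

Lemma test_constant_integral :
  ((Lam * weight lambda h)%:E * \int[mu]_t (integrand k r h (mabs t))%:E <= (K' ^+ 2)%:E)%E.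
Proof.
have cw := cvgeZl (isT : (Lam * weight lambda h)%:E \is a fin_num) (@cvg_integral_goodset _ _ _ k r _ h0).
apply: (cvge_le _ cw); apply: nearW => N; rewrite (integral_goodset k r h0 N) -EFinM lee_fin.
exact: test_constant_ge.
Qed.

(** The cell around (1, ..., 1) alone contributes a positive amount, by [cell_quotient_le]. *)
Lemma integral_mabs_gt0 : (0 < \int[mu]_t (integrand k r h (mabs t))%:E)%E.
Proof.
pose n : 'rV[int]_d := \row_i 1.
have nN : far 0 n by move=> i; rewrite mxE.
have c0 : 0 < 2 * pi :> R by rewrite mulr_gt0 ?pi_gt0.
apply: (@lt_le_trans _ _ (cell_quotient (2 * pi) n k r h)%:E).
  rewrite lte_fin /cell_quotient divr_gt0 ?exprn_gt0 ?(cellint_gt0 c0 nN)//.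
  rewrite (bigD1 ord0)//= ltr_pwDl//; first by rewrite mulr_gt0 ?(cellint_gt0 c0 nN).
  by apply: sumr_ge0 => l _; rewrite mulr_ge0 ?ltW ?(cellint_gt0 c0 nN).
apply: le_trans (cell_quotient_le c0 nN k r h0) _.
apply: ge0_subset_integral => //.
- exact: measurable_cell.
- by apply/measurable_EFinP; exact: (measurableT_comp (measurable_integrand k r h0) (@measurable_mabs R d)).
- by move=> t _; rewrite lee_fin integrand_ge0.
Qed.

(** K' is an arbitrary real number; its sign is what allows K <= K' to be deduced from K^2 <=
    K'^2. *)
Lemma test_constant_pos : 0 < K'.
Proof.
have [[N JN]|nJ] := pselect (exists N, 0 < J N); first exact: (test_constant_gt0 JN).
have := integral_mabs_gt0; rewrite ltNge => /negP[].
apply: (cvge_le _ (@cvg_integral_goodset _ _ _ k r _ h0)); apply: nearW => N.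
rewrite (integral_goodset k r h0 N) lee_fin leNgt; apply/negP => JN; apply: nJ.
by exists N.
Qed.

End fixed_weights.

(** Supremum over h in [test_constant_integral], after folding the integral over the space onto the
    orthant, which brings in pi^-d. *)
Lemma sharp_constant_le : Num.sqrt (c * Lam) <= K'.
Proof.
have K0 : 0 < K' := @test_constant_pos (fun=> 1) (fun=> ltr01).
have Lam0 : 0 < Lam by apply: prodr_gt0 => j _; exact: powR_gt0.
rewrite -[leRHS](ger0_norm (ltW K0)) -sqrtr_sqr; apply: ler_wsqrtr.
have pd0 : 0 < pi ^- d :> R by rewrite invr_gt0 exprn_gt0// pi_gt0.
rewrite -lee_fin mulrC EFinM -cE muleA -EFinM /continuous_sup -ereal_sup_pZl ?mulr_gt0//.
apply: ge_ereal_sup => _ [_ [h h0 <-] <-]; apply: le_trans (test_constant_integral h0).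
rewrite (integral_mabs (G := fun t => (integrand k r h t)%:E)); last 2 first.
- by apply/measurable_EFinP; exact: measurable_integrand.
- by move=> t; rewrite lee_fin integrand_ge0.
by rewrite !muleA -!EFinM [Lam * weight _ _ * _]mulrAC.
Qed.

End sharp_constant.

(** * The sharp inequality and its constant *)

Theorem theorem17 (R : realType) (d m : nat) (k : 'rV[R]_d)
  (r : 'I_m.+1 -> 'rV[R]_d) (lambda : 'I_m.+1 -> R)
  (d_gt0 : (0 < d)%N) (m_gt0 : (0 < m)%N)
  (lambda_gt0 : forall j, 0 < lambda j)
  (lambda_sum1 : \sum_j lambda j = 1)
  (k_comb : k + const_mx 2^-1 = \sum_j lambda j *: r j)
  (k_int : (conv_hull r)° (k + const_mx 2^-1)) :
  let mu := lebesgue_rV R d in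
  let C : \bar R :=
    limf_einf (fun rho : R =>
      ereal_sup [set
        ((\prod_j h j `^ lambda j)%:E *
         \esum_(n in @lattice_star d)
           (rho ^+ d *
            (\int[mu]_(t in cell n) vpow ((2 * pi * rho) *: vabs t) k) ^+ 2 /
            (\sum_l h l *
              \int[mu]_(t in cell n)
                vpow ((2 * pi * rho) *: vabs t) (2 *: r l)))%:E)%E
        | h in [set h : 'I_m.+1 -> R | forall j, (0 < h j)%R]])
      (0^'+) in
  let K : R :=
    Num.sqrt (fine C * \prod_j lambda j `^ (- lambda j)) in
  [/\ C =
      ((pi ^- d)%:E *
       ereal_sup [set
         ((\prod_j h j `^ lambda j)%:E *
          \int[mu]_(t in orthant)
            (vpow t (2 *: k) / (\sum_l h l * vpow t (2 *: r l)))%:E)%E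
         | h in [set h : 'I_m.+1 -> R | forall j, (0 < h j)%R]])%E,
      C \is a fin_num,
      forall x : 'rV[R]_d -> R[i], (forall l, spaceL (r l) x) ->
        (Cnorm (opD k x) <=
         K%:E * \prod_j L2norm (opD (r j) x) `^ lambda j)%E
    & forall K' : R,
        (forall x : 'rV[R]_d -> R[i], (forall l, spaceL (r l) x) ->
          (Cnorm (opD k x) <=
           K'%:E * \prod_j L2norm (opD (r j) x) `^ lambda j)%E) ->
        K <= K'].
Proof.
move=> mu C K.
have CE : C = limf_einf (discrete_sup k r lambda) 0^'+.
  rewrite /C; congr limf_einf; apply/funext => rho; congr ereal_sup; congr image; apply/funext => h.
  congr (_ * _)%E; apply: eq_esum => n _; congr EFin.
  by rewrite /cell_quotient mulrA.
(* One bound M for all h gives finiteness both of each single integral, the weight being positive,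
   and of the supremum. *)
have [M MP] := weighted_integral_bound lambda_gt0 lambda_sum1 k_comb k_int.
have Ifin h : (forall j, 0 < h j) ->
    (\int[mu]_(t in orthant) (integrand k r h t)%:E)%E \is a fin_num.
  move=> h0; have I0 : (0 <= \int[mu]_(t in orthant) (integrand k r h t)%:E)%E.
    by apply: integral_ge0 => t _; rewrite lee_fin integrand_ge0.
  have w0 := weight_gt0 lambda h0; have := MP h h0; rewrite (ge0_fin_numE I0) ltey => H.
  by apply/negP => /eqP Iy; move: H; rewrite Iy gt0_muley ?lte_fin.
have CS : C = ((pi ^- d)%:E * continuous_sup k r lambda)%E by rewrite CE discrete_liminfE.
have Sfin : continuous_sup k r lambda \is a fin_num.
  have h1 (j : 'I_m.+1) : 0 < (fun=> 1 : R) j by [].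
  have S0 : (0 <= continuous_sup k r lambda)%E.
    apply: le_trans (ereal_sup_ubound _); last by exists (fun=> 1).
    apply: mule_ge0; first by rewrite lee_fin weight_ge0.
    by apply: integral_ge0 => t _; rewrite lee_fin integrand_ge0.
  rewrite (ge0_fin_numE S0); apply: le_lt_trans (ltry M).
  by apply: ge_ereal_sup => _ [h h0 <-]; exact: MP.
have Cfin : C \is a fin_num by rewrite CS fin_numM.
have cE : ((pi ^- d)%:E * continuous_sup k r lambda)%E = (fine C)%:E by rewrite (fineK Cfin) CS.
split; [exact: CS|exact: Cfin| |].
- exact: (interpolation_inequality lambda_gt0 lambda_sum1 cE).
- exact: (sharp_constant_le lambda_gt0 lambda_sum1 cE).
Qed.
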